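(* Let $E$ be a Hermite–Biehler entire function with no real zeros whose phase function satisfies $\varphi'\in L^\infty(\mathbb{R})$, and let $0<p<\infty$. Then $$C(p,E)\le\frac{\lVert\varphi'\rVert_\infty^{1/p}}{2^{1/p}K(p)},\qquad\text{where } K(p)=\left(\int_{-\pi/2}^{\pi/2}\lvert\cos x\rvert^p\,dx\right)^{1/p}.$$
   Context: An entire function $E$ is Hermite–Biehler if $\lvert E(\overline{z})\rvert < \lvert E(z)\rvert$ for $z$ in the upper half-plane $\mathbb{C}_+$. Let $E^{\#}(z)=\overline{E(\overline z)}$; the phase function $\varphi$ is a smooth real function on $\mathbb{R}$ with $E^{\#}(x)/E(x)=e^{i\varphi(x)}$. For $0<p<\infty$, $\mathcal{H}^p(E)$ is the space of entire $f$ with $f/E, f^{\#}/E$ in the Hardy space $H^p(\mathbb{C}_+)$, $\lVert f/E\rVert_p=(\int_{\mathbb{R}}\lvert f/E\rvert^p dx)^{1/p}$; $\mathcal{H}^\infty(E)$ is defined with bounded analytic functions and $\lVert f/E\rVert_\infty=\sup_{\mathbb{R}}\lvert f/E\rvert$. When $\varphi'\in L^\infty$, $\mathcal{H}^p(E)\subset\mathcal{H}^\infty(E)$ and $C(p,E)$ is the norm of this embedding. *)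

(* Defs.v *)
From Stdlib Require Import Reals.
From Coquelicot Require Import Coquelicot.
Open Scope R_scope.

Definition C_holo_at (f : C -> C) (z : C) : Prop :=
  @ex_derive C_AbsRing C_NormedModule f z.

Definition entire (f : C -> C) : Prop := forall z, C_holo_at f z.

(* x^y for x >= 0, y > 0, with the convention 0^y = 0 *)
Definition rpow (x y : R) : R := if Rle_dec x 0 then 0 else Rpower x y.

Definition sharp (f : C -> C) : C -> C := fun z => Cconj (f (Cconj z)).

Definition upper (z : C) : Prop := 0 < Im z.

Definition hermite_biehler (E : C -> C) : Prop :=
  entire E /\ forall z, upper z -> Cmod (E (Cconj z)) < Cmod (E z).

(* integral over R of a nonnegative continuous function, as a value in [0,+oo] *)
Definition int_R (g : R -> R) : Rbar :=
  Lub_Rbar (fun v => exists a b, a <= b /\ v = RInt g a b).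

Definition hardy_p (p : R) (F : C -> C) : Prop :=
  (forall z, upper z -> C_holo_at F z) /\
  exists B : R, forall y, 0 < y ->
    Rbar_le (int_R (fun x => rpow (Cmod (F (x, y))) p)) (Finite B).

Definition HpE (p : R) (E f : C -> C) : Prop :=
  entire f /\
  hardy_p p (fun z => (f z / E z)%C) /\ hardy_p p (fun z => (sharp f z / E z)%C).

Definition Lp_norm_R (p : R) (E f : C -> C) : Rbar :=
  match int_R (fun x => rpow (Cmod (f (RtoC x) / E (RtoC x))%C) p) with
  | Finite v => Finite (rpow v (1 / p))
  | r => r
  end.

Definition Linf_norm_R (E f : C -> C) : Rbar :=
  Lub_Rbar (fun v => exists x : R, v = Cmod (f (RtoC x) / E (RtoC x))%C).

Definition embed_const (p : R) (E : C -> C) : Rbar :=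
  Rbar_lub (fun v => exists f, HpE p E f /\
                       Rbar_le (Lp_norm_R p E f) (Finite 1) /\ v = Linf_norm_R E f).

Definition phase_function (E : C -> C) (phi : R -> R) : Prop :=
  (forall n x, ex_derive_n phi n x) /\
  forall x : R, (sharp E (RtoC x) / E (RtoC x))%C = (cos (phi x), sin (phi x)).

Definition sup_abs (g : R -> R) : Rbar :=
  Lub_Rbar (fun v => exists x, v = Rabs (g x)).

Definition K (p : R) : R :=
  rpow (RInt (fun x => rpow (Rabs (cos x)) p) (- (PI / 2)) (PI / 2)) (1 / p).

(* Main.v *)
(** Write f/E for a function of H^p(E).  A Cauchy estimate bounds |f/E|^p by C/y at
    height y.  Near the real axis E is replaced by its reflection below it; since
    log |E(x + i|y|)| has normal derivative phi'/2 <= M/2, the factor z - x0 + ir with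
    r < 1/M excludes a maximum on the axis, and so f/E and f#/E are bounded in C_+.  By
    Phragmen-Lindelof both are then bounded by L, the supremum of |f/E| on the real line.

    If f is real (f# = f), |f| <= rho |E| in C_+ with rho < 1, and |lam| = 1, then
    E - lam f is again of Hermite-Biehler type and its phase is monotone.  Varying lam gives
    the Bernstein-Szego inequality h'^2 <= (phi'/2)^2 (1 - h^2) for h = f/|E|, so arccos h is
    M/2-Lipschitz: near a point where |f/E| is almost L one has
    |f/E|(x) >= L cos(c + M|x - x0|/2).  Integrating the p-th power gives
    L^p 2 K(p)^p <= M ||f/E||_p^p. *)

Require Import Defs.
From Stdlib Require Import Reals Lra Lia Classical ClassicalEpsilon.
From Coquelicot Require Import Coquelicot.
Open Scope R_scope.

(** * Rectangles and continuity *)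

(** The Hardy condition controls integrals along lines Im z = y > 0 only, and the resulting bound
    C/y says nothing at the axis. The rectangles resting on the axis therefore carry a polynomial
    factor vanishing at their two corners there, which absorbs the blow-up along the vertical sides;
    the side on the axis is handled by the phase bound. That step needs f and f# together: since
    |f#(z)| = |f(conj z)|, the product of the two bounds is even in y as far as f is concerned, so
    only E and the auxiliary factor contribute to first order. A general f is reduced to a real one
    by rotating it so that f(x0) > 0 and averaging with f#, which on the axis takes the real part.
    The supremum L need not be attained: a scale L' slightly above L makes the contraction strict,
    and an angle c > 0 measures the loss; both disappear in a limit. The constant comes from one
    arch of a cosine of frequency M/2, whose p-th power has integral K(p)^p / (M/2). *)

Lemma rect_bisection (P : R -> R -> R -> R -> Prop) (a b c d : R) :
  (forall a b c d, a <= b -> c <= d ->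
     P a ((a + b) / 2) c ((c + d) / 2) -> P ((a + b) / 2) b c ((c + d) / 2) ->
     P a ((a + b) / 2) ((c + d) / 2) d -> P ((a + b) / 2) b ((c + d) / 2) d ->
     P a b c d) ->
  a <= b -> c <= d ->
  (forall x y, a <= x <= b -> c <= y <= d -> exists del, 0 < del /\
     forall a' b' c' d', a <= a' -> a' <= x <= b' -> b' <= b ->
       c <= c' -> c' <= y <= d' -> d' <= d ->
       b' - a' < del -> d' - c' < del -> P a' b' c' d') ->
  P a b c d.
Proof.
  intros Hq Hab Hcd Hloc.
  apply NNPP; intros HP.
  (* [step] keeps the first quarter on which P fails. If the first three satisfy P, the fourth is
     returned untested: the quartering hypothesis forces P to fail there. *)
  pose (step := fun q : R * R * R * R =>
    let '(a, b, c, d) := q in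
    if excluded_middle_informative (P a ((a + b) / 2) c ((c + d) / 2)) then
    if excluded_middle_informative (P ((a + b) / 2) b c ((c + d) / 2)) then
    if excluded_middle_informative (P a ((a + b) / 2) ((c + d) / 2) d) then
      ((a + b) / 2, b, (c + d) / 2, d)
    else (a, (a + b) / 2, (c + d) / 2, d)
    else ((a + b) / 2, b, c, (c + d) / 2)
    else (a, (a + b) / 2, c, (c + d) / 2)).
  pose (s := fun n => Nat.iter n step (a, b, c, d)).
  pose (u1 := fun n => fst (fst (fst (s n)))). pose (u2 := fun n => snd (fst (fst (s n)))).
  pose (u3 := fun n => snd (fst (s n))). pose (u4 := fun n => snd (s n)).
  assert (Hs : forall n, ~ P (u1 n) (u2 n) (u3 n) (u4 n) /\
    u1 n <= u2 n /\ u3 n <= u4 n /\ u1 n <= u1 (S n) /\ u2 (S n) <= u2 n /\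
    u3 n <= u3 (S n) /\ u4 (S n) <= u4 n /\
    u2 n - u1 n = (b - a) * (/ 2) ^ n /\ u4 n - u3 n = (d - c) * (/ 2) ^ n).
  { induction n as [|n IH].
    - unfold u1, u2, u3, u4, s; simpl.
      repeat destruct excluded_middle_informative; simpl; repeat split; auto; lra.
    - destruct IH as (I1 & I2 & I3 & _ & _ & _ & _ & I4 & I5).
      assert (E0 : s n = (u1 n, u2 n, u3 n, u4 n)).
      { unfold u1, u2, u3, u4. destruct (s n) as [[[? ?] ?] ?]; reflexivity. }
      assert (E1 : s (S n) = step (s n)) by reflexivity.
      assert (K1 : ~ P (u1 (S n)) (u2 (S n)) (u3 (S n)) (u4 (S n)) /\
        u1 (S n) <= u2 (S n) /\ u3 (S n) <= u4 (S n) /\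
        u2 (S n) - u1 (S n) = (b - a) * (/ 2) ^ S n /\
        u4 (S n) - u3 (S n) = (d - c) * (/ 2) ^ S n).
      { rewrite E0 in E1. unfold u1 at 1 2 3, u2 at 1 2 3, u3 at 1 2 3, u4 at 1 2 3.
        rewrite E1. generalize (u1 n) (u2 n) (u3 n) (u4 n) I1 I2 I3 I4 I5.
        intros. unfold step.
        repeat destruct excluded_middle_informative; simpl; repeat split; auto; try lra. }
      destruct K1 as (K1 & K2 & K3 & K4 & K5).
      assert (E2 : s (S (S n)) = step (s (S n))) by reflexivity.
      assert (E3 : s (S n) = (u1 (S n), u2 (S n), u3 (S n), u4 (S n))).
      { unfold u1, u2, u3, u4. destruct (s (S n)) as [[[? ?] ?] ?]; reflexivity. }
      rewrite E3 in E2.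
      assert (K6 : u1 (S n) <= u1 (S (S n)) /\ u2 (S (S n)) <= u2 (S n) /\
        u3 (S n) <= u3 (S (S n)) /\ u4 (S (S n)) <= u4 (S n)).
      { unfold u1 at 2, u2 at 1, u3 at 2, u4 at 1. rewrite E2.
        unfold step.
        repeat destruct excluded_middle_informative; simpl; repeat split; auto; try lra. }
      tauto. }
  assert (M1 : forall m n, (m <= n)%nat -> u1 m <= u1 n /\ u2 n <= u2 m /\ u3 m <= u3 n /\ u4 n <= u4 m).
  { intros m n H; induction H as [|n H IH]; [lra|].
    destruct (Hs n); lra. }
  assert (M2 : forall m n, u1 m <= u2 n /\ u3 m <= u4 n).
  { intros m n. destruct (M1 m (max m n)) as (? & _ & ? & _); [lia|].
    destruct (M1 n (max m n)) as (_ & ? & _ & ?); [lia|].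
    destruct (Hs (max m n)) as (_ & ? & ? & _). lra. }
  destruct (completeness (fun x => exists n, x = u1 n)) as [x [Hx1 Hx2]].
  { exists (u2 0%nat). intros y [n ->]. apply M2. }
  { exists (u1 0%nat), 0%nat; reflexivity. }
  destruct (completeness (fun x => exists n, x = u3 n)) as [y [Hy1 Hy2]].
  { exists (u4 0%nat). intros z [n ->]. apply M2. }
  { exists (u3 0%nat), 0%nat; reflexivity. }
  assert (X1 : forall n, u1 n <= x <= u2 n).
  { intros n; split; [apply Hx1; eauto|]. apply Hx2. intros z [m ->]. apply M2. }
  assert (X2 : forall n, u3 n <= y <= u4 n).
  { intros n; split; [apply Hy1; eauto|]. apply Hy2. intros z [m ->]. apply M2. }
  assert (B : forall n, a <= u1 n /\ u2 n <= b /\ c <= u3 n /\ u4 n <= d).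
  { intros n. apply (M1 0%nat n). lia. }
  destruct (Hloc x y) as [del [Hd HL]].
  { generalize (X1 0%nat) (B 0%nat); lra. }
  { generalize (X2 0%nat) (B 0%nat); lra. }
  (* One N shrinks both sides below [del]; the 1 keeps the denominator positive for degenerate
     rectangles. *)
  destruct (pow_lt_1_zero (/ 2)) with (y := del / (1 + (b - a) + (d - c))) as [N HN].
  { rewrite Rabs_pos_eq; lra. }
  { apply Rdiv_lt_0_compat; lra. }
  specialize (HN N (le_n N)).
  assert (Hp : 0 < (/ 2) ^ N) by (apply pow_lt; lra).
  rewrite Rabs_pos_eq in HN by lra.
  apply Rlt_div_r in HN; [|lra].
  destruct (Hs N) as (S1 & S2 & S3 & _ & _ & _ & _ & S4 & S5).
  apply S1.
  destruct (B N) as (? & ? & ? & ?).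
  apply HL; auto; try apply X1; try apply X2.
  - rewrite S4. nra.
  - rewrite S5. nra.
Qed.

Definition ccont (g : C -> C) (z : C) : Prop :=
  forall eps, 0 < eps -> exists del, 0 < del /\
    forall w, Cmod (w - z)%C < del -> Cmod (g w - g z)%C < eps.

Lemma is_derive_C_eps (g : C -> C) (z l : C) :
  @is_derive C_AbsRing C_NormedModule g z l <->
  forall eps, 0 < eps -> exists del, 0 < del /\
    forall w, Cmod (w - z)%C < del ->
      Cmod (g w - g z - l * (w - z))%C <= eps * Cmod (w - z)%C.
Proof.
  split.
  - intros [_ H] eps He.
    destruct (H z (fun P HP => HP) (mkposreal eps He)) as [d Hd].
    exists d; split; [apply d|]. intros w Hw.
    specialize (Hd w Hw). 
    replace (g w - g z - l * (w - z))%C with (g w - g z - (w - z) * l)%C by ring.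
    exact Hd.
  - intros H. split.
    + apply is_linear_scal_l.
    + intros x Hx. rewrite <- (@is_filter_lim_locally_unique C_AbsRing (AbsRing_NormedModule C_AbsRing) z x Hx). clear x Hx.
      intros [eps He]. destruct (H eps He) as [d [Hd Hw]].
      exists (mkposreal d Hd). intros w Hb. 
      specialize (Hw w Hb).
      replace (g w - g z - l * (w - z))%C with (g w - g z - (w - z) * l)%C in Hw by ring.
      exact Hw.
Qed.

Lemma holo_ccont g z : C_holo_at g z -> ccont g z.
Proof.
  intros [l Hl] eps He.
  destruct (proj1 (is_derive_C_eps g z l) Hl 1 Rlt_0_1) as [d [Hd H]].
  assert (Hc : 0 <= Cmod l) by apply Cmod_ge_0.
  assert (He' : 0 < eps / (2 + Cmod l)) by (apply Rdiv_lt_0_compat; lra).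
  exists (Rmin d (eps / (2 + Cmod l))); split.
  { apply Rmin_pos; auto. }
  intros w Hw.
  assert (H1 := H w (Rlt_le_trans _ _ _ Hw (Rmin_l _ _))).
  assert (H2 := Rlt_le_trans _ _ _ Hw (Rmin_r _ _)).
  replace (g w - g z)%C with ((g w - g z - l * (w - z)) + l * (w - z))%C by ring.
  eapply Rle_lt_trans; [apply Cmod_triangle|]. rewrite Cmod_mult.
  apply Rlt_div_r in H2; [|lra].
  generalize (Cmod_ge_0 (w - z)%C). nra.
Qed.

Lemma im_le_Cmod (z : C) : Rabs (Im z) <= Cmod z.
Proof. eapply Rle_trans; [apply Rmax_r|apply Rmax_Cmod]. Qed.

Lemma Cmod_le_sum (z : C) : Cmod z <= Rabs (fst z) + Rabs (snd z).
Proof.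
  destruct z as [x y]; simpl.
  assert (E : (x, y) = (RtoC x + Ci * RtoC y)%C)
    by (unfold RtoC, Ci, Cmult, Cplus; simpl; f_equal; ring).
  rewrite E.
  eapply Rle_trans; [apply Cmod_triangle|].
  rewrite Cmod_mult, Cmod_Ci, !Cmod_R. lra.
Qed.

Lemma continuous_R_eps (f : R -> R) (x : R) :
  (forall eps, 0 < eps -> exists del, 0 < del /\
     forall y, Rabs (y - x) < del -> Rabs (f y - f x) < eps) -> continuous f x.
Proof.
  intros H. apply continuity_pt_filterlim. intros eps He.
  destruct (H eps He) as [d [Hd Hy]]. exists d; split; auto.
  intros y [_ Hy']. apply Hy. exact Hy'.
Qed.

Lemma ccont_hline g x y : ccont g (x, y) -> 
  continuous (fun t : R => Re (g (t, y))) x /\ continuous (fun t => Im (g (t, y))) x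
  /\ continuous (fun t : R => Cmod (g (t, y))) x.
Proof.
  intros H.
  assert (K : forall eps, 0 < eps -> exists del, 0 < del /\ forall t, Rabs (t - x) < del ->
     Cmod (g (t, y) - g (x, y))%C < eps).
  { intros eps He. destruct (H eps He) as [d [Hd Hw]]. exists d; split; auto.
    intros t Ht. apply Hw. replace ((t, y) - (x, y))%C with (RtoC (t - x)).
    rewrite Cmod_R; auto. unfold RtoC, Cminus, Cplus, Copp; simpl; f_equal; ring. }
  repeat split; apply continuous_R_eps; intros eps He; destruct (K eps He) as [d [Hd Hw]];
    exists d; split; auto; intros t Ht; eapply Rle_lt_trans; try apply (Hw t Ht).
  - eapply Rle_trans; [|apply re_le_Cmod]. right; f_equal.
  - eapply Rle_trans; [|apply im_le_Cmod]. right; f_equal.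
  - apply Rabs_le.
    generalize (Cmod_triangle (g (t, y) - g (x, y)) (g (x, y)))
               (Cmod_triangle (g (x, y) - g (t, y)) (g (t, y))).
    replace (g (t, y) - g (x, y) + g (x, y))%C with (g (t, y)) by ring.
    replace (g (x, y) - g (t, y) + g (t, y))%C with (g (x, y)) by ring.
    replace (g (x, y) - g (t, y))%C with (- (g (t, y) - g (x, y)))%C by ring.
    rewrite Cmod_opp. lra.
Qed.

(** Exchanging the coordinates preserves [Cmod], although it is not holomorphic; so vertical lines
    need no separate argument. *)
Lemma ccont_swap g x y : ccont g (x, y) -> ccont (fun z => g (snd z, fst z)) (y, x).
Proof.
  intros H eps He. destruct (H eps He) as [d [Hd Hw]]. exists d; split; auto.
  intros [u v] Hu. simpl. apply Hw. revert Hu. unfold Cmod; simpl.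
  intros Hu. eapply Rle_lt_trans; [|exact Hu]. right. f_equal; ring.
Qed.

Lemma ccont_vline g x y : ccont g (x, y) -> 
  continuous (fun t : R => Re (g (x, t))) y /\ continuous (fun t => Im (g (x, t))) y
  /\ continuous (fun t : R => Cmod (g (x, t))) y.
Proof.
  intros H. exact (ccont_hline _ _ _ (ccont_swap _ _ _ H)).
Qed.

(** * Goursat's theorem on rectangles *)

(* Im of the contour integral of g over the boundary of [a,b] x [c,d].  It suffices for Cauchy's
   estimate, because g may be rotated so that its value at the interior point is positive. *)
Definition contour_im (g : C -> C) (a b c d : R) : R :=
  RInt (fun x => Im (g (x, c))) a b + RInt (fun y => Re (g (b, y))) c d
  - RInt (fun x => Im (g (x, d))) a b - RInt (fun y => Re (g (a, y))) c d.

Definition on_rect (a b c d : R) (P : C -> Prop) : Prop :=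
  forall x y, a <= x <= b -> c <= y <= d -> P (x, y).

Definition on_sides (a b c d : R) (P : C -> Prop) : Prop :=
  (forall x, a <= x <= b -> P (x, c) /\ P (x, d)) /\
  (forall y, c <= y <= d -> P (a, y) /\ P (b, y)).

Lemma on_rect_sides a b c d P : a <= b -> c <= d -> on_rect a b c d P -> on_sides a b c d P.
Proof. intros ? ? H; split; intros; split; apply H; lra. Qed.

Lemma ex_RInt_hline_Im (g : C -> C) (a b y : R) : a <= b ->
  (forall t, a <= t <= b -> ccont g (t, y)) -> ex_RInt (fun t : R => Im (g (t, y))) a b.
Proof.
  intros Hab H. apply (@ex_RInt_continuous R_CompleteNormedModule).
  intros t; rewrite Rmin_left, Rmax_right by lra; intros Ht.
  exact (proj1 (proj2 (ccont_hline g t y (H t Ht)))).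
Qed.

Lemma ex_RInt_hline_Cmod (g : C -> C) (a b y : R) : a <= b ->
  (forall t, a <= t <= b -> ccont g (t, y)) -> ex_RInt (fun t : R => Cmod (g (t, y))) a b.
Proof.
  intros Hab H. apply (@ex_RInt_continuous R_CompleteNormedModule).
  intros t; rewrite Rmin_left, Rmax_right by lra; intros Ht.
  exact (proj2 (proj2 (ccont_hline g t y (H t Ht)))).
Qed.

Lemma ex_RInt_vline_Re (g : C -> C) (a b y : R) : a <= b ->
  (forall t, a <= t <= b -> ccont g (y, t)) -> ex_RInt (fun t : R => Re (g (y, t))) a b.
Proof.
  intros Hab H. apply (@ex_RInt_continuous R_CompleteNormedModule).
  intros t; rewrite Rmin_left, Rmax_right by lra; intros Ht.
  exact (proj1 (ccont_vline g y t (H t Ht))).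
Qed.

Lemma ex_RInt_vline_Cmod (g : C -> C) (a b y : R) : a <= b ->
  (forall t, a <= t <= b -> ccont g (y, t)) -> ex_RInt (fun t : R => Cmod (g (y, t))) a b.
Proof.
  intros Hab H. apply (@ex_RInt_continuous R_CompleteNormedModule).
  intros t; rewrite Rmin_left, Rmax_right by lra; intros Ht.
  exact (proj2 (proj2 (ccont_vline g y t (H t Ht)))).
Qed.

Lemma contour_im_split_x g a m b c d : a <= m <= b ->
  (forall x, a <= x <= b -> ccont g (x, c) /\ ccont g (x, d)) ->
  contour_im g a b c d = contour_im g a m c d + contour_im g m b c d.
Proof.
  intros Hm H. unfold contour_im.
  rewrite <- (@RInt_Chasles R_CompleteNormedModule (fun x => Im (g (x, c))) a m b).
  rewrite <- (@RInt_Chasles R_CompleteNormedModule (fun x => Im (g (x, d))) a m b).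
  unfold plus; simpl; ring.
  all: apply (ex_RInt_hline_Im g); try lra; intros; apply H; lra.
Qed.

Lemma contour_im_split_y g a b c m d : c <= m <= d ->
  (forall y, c <= y <= d -> ccont g (a, y) /\ ccont g (b, y)) ->
  contour_im g a b c d = contour_im g a b c m + contour_im g a b m d.
Proof.
  intros Hm H. unfold contour_im.
  rewrite <- (@RInt_Chasles R_CompleteNormedModule (fun x => Re (g (a, x))) c m d).
  rewrite <- (@RInt_Chasles R_CompleteNormedModule (fun x => Re (g (b, x))) c m d).
  unfold plus; simpl; ring.
  all: apply (ex_RInt_vline_Re g); try lra; intros; apply H; lra.
Qed.

Lemma RInt_Rplus f g a b : ex_RInt f a b -> ex_RInt g a b ->
  RInt (fun x => f x + g x) a b = RInt f a b + RInt g a b.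
Proof. exact (@RInt_plus R_CompleteNormedModule f g a b). Qed.

Lemma contour_im_plus g1 g2 a b c d : a <= b -> c <= d ->
  on_sides a b c d (ccont g1) -> on_sides a b c d (ccont g2) ->
  contour_im (fun z => g1 z + g2 z)%C a b c d = contour_im g1 a b c d + contour_im g2 a b c d.
Proof.
  intros Hab Hcd [H1 V1] [H2 V2]. unfold contour_im.
  rewrite (RInt_Rplus (fun x => Im (g1 (x, c))) (fun x => Im (g2 (x, c))))
    by (apply ex_RInt_hline_Im; auto; intros; first [apply H1 | apply H2]; auto).
  rewrite (RInt_Rplus (fun x => Im (g1 (x, d))) (fun x => Im (g2 (x, d))))
    by (apply ex_RInt_hline_Im; auto; intros; first [apply H1 | apply H2]; auto).
  rewrite (RInt_Rplus (fun x => Re (g1 (a, x))) (fun x => Re (g2 (a, x))))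
    by (apply ex_RInt_vline_Re; auto; intros; first [apply V1 | apply V2]; auto).
  rewrite (RInt_Rplus (fun x => Re (g1 (b, x))) (fun x => Re (g2 (b, x))))
    by (apply ex_RInt_vline_Re; auto; intros; first [apply V1 | apply V2]; auto).
  ring.
Qed.

Lemma contour_im_ext g1 g2 a b c d : a <= b -> c <= d ->
  on_sides a b c d (fun z => g1 z = g2 z) ->
  contour_im g1 a b c d = contour_im g2 a b c d.
Proof.
  intros Hab Hcd [H V]. unfold contour_im.
  f_equal; [f_equal; [f_equal|]|]; apply RInt_ext; intros t; rewrite Rmin_left, Rmax_right by lra;
  intros Ht; f_equal; first [apply H | apply V]; lra.
Qed.

Lemma contour_im_bound g a b c d m : a <= b -> c <= d ->
  on_sides a b c d (ccont g) ->
  on_sides a b c d (fun z => Cmod (g z) <= m) ->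
  Rabs (contour_im g a b c d) <= m * (2 * ((b - a) + (d - c))).
Proof.
  intros Hab Hcd [H V] [Hm Vm]. unfold contour_im.
  assert (I1 : Rabs (RInt (fun x => Im (g (x, c))) a b) <= (b - a) * m).
  { apply abs_RInt_le_const; auto; [apply (ex_RInt_hline_Im g); auto; intros; apply H; auto|].
    intros; eapply Rle_trans; [apply im_le_Cmod|]; apply Hm; auto. }
  assert (I2 : Rabs (RInt (fun x => Im (g (x, d))) a b) <= (b - a) * m).
  { apply abs_RInt_le_const; auto; [apply (ex_RInt_hline_Im g); auto; intros; apply H; auto|].
    intros; eapply Rle_trans; [apply im_le_Cmod|]; apply Hm; auto. }
  assert (I3 : Rabs (RInt (fun x => Re (g (a, x))) c d) <= (d - c) * m).
  { apply abs_RInt_le_const; auto; [apply (ex_RInt_vline_Re g); auto; intros; apply V; auto|].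
    intros; eapply Rle_trans; [apply re_le_Cmod|]; apply Vm; auto. }
  assert (I4 : Rabs (RInt (fun x => Re (g (b, x))) c d) <= (d - c) * m).
  { apply abs_RInt_le_const; auto; [apply (ex_RInt_vline_Re g); auto; intros; apply V; auto|].
    intros; eapply Rle_trans; [apply re_le_Cmod|]; apply Vm; auto. }
  apply Rabs_le. apply Rabs_le_between in I1, I2, I3, I4. lra.
Qed.

Lemma RInt_affine p q a b : RInt (fun x => p + q * x) a b = p * (b - a) + q * (b ^ 2 - a ^ 2) / 2.
Proof.
  apply is_RInt_unique.
  replace (p * (b - a) + q * (b ^ 2 - a ^ 2) / 2)
    with (minus (p * b + q * b ^ 2 / 2) (p * a + q * a ^ 2 / 2))
    by (unfold minus, plus, opp; simpl; field).
  apply (is_RInt_derive (fun x => p * x + q * x ^ 2 / 2)).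
  - intros x _. auto_derive; auto. field.
  - intros x _. apply (ex_derive_continuous (fun x => p + q * x)). auto_derive; auto.
Qed.

Lemma contour_im_affine al l z0 a b c d :
  contour_im (fun z => al + l * (z - z0))%C a b c d = 0.
Proof.
  unfold contour_im.
  destruct al as [a1 a2], l as [l1 l2], z0 as [x0 y0].
  rewrite (RInt_ext (fun x => Im ((a1, a2) + (l1, l2) * ((x, c) - (x0, y0)))%C)
            (fun x => (a2 + l1 * (c - y0) - l2 * x0) + l2 * x)) by (intros; simpl; ring).
  rewrite (RInt_ext (fun x => Im ((a1, a2) + (l1, l2) * ((x, d) - (x0, y0)))%C)
            (fun x => (a2 + l1 * (d - y0) - l2 * x0) + l2 * x)) by (intros; simpl; ring).
  rewrite (RInt_ext (fun x => Re ((a1, a2) + (l1, l2) * ((a, x) - (x0, y0)))%C)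
            (fun x => (a1 + l1 * (a - x0) + l2 * y0) + (- l2) * x)) by (intros; simpl; ring).
  rewrite (RInt_ext (fun x => Re ((a1, a2) + (l1, l2) * ((b, x) - (x0, y0)))%C)
            (fun x => (a1 + l1 * (b - x0) + l2 * y0) + (- l2) * x)) by (intros; simpl; ring).
  rewrite !RInt_affine. field.
Qed.

Lemma C_holo_affine al l z0 z : C_holo_at (fun z => al + l * (z - z0))%C z.
Proof.
  exists l. apply is_derive_C_eps. intros eps He. exists 1; split; [lra|].
  intros w _. replace (al + l * (w - z0) - (al + l * (z - z0)) - l * (w - z))%C with (RtoC 0) by ring.
  rewrite Cmod_0. generalize (Cmod_ge_0 (w - z)%C). nra.
Qed.

Lemma ccont_plus g1 g2 z : ccont g1 z -> ccont g2 z -> ccont (fun w => g1 w + g2 w)%C z.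
Proof.
  intros H1 H2 eps He.
  destruct (H1 (eps / 2)) as [d1 [Hd1 K1]]; [lra|].
  destruct (H2 (eps / 2)) as [d2 [Hd2 K2]]; [lra|].
  exists (Rmin d1 d2); split; [apply Rmin_pos; auto|].
  intros w Hw.
  specialize (K1 w (Rlt_le_trans _ _ _ Hw (Rmin_l _ _))).
  specialize (K2 w (Rlt_le_trans _ _ _ Hw (Rmin_r _ _))).
  replace (g1 w + g2 w - (g1 z + g2 z))%C with ((g1 w - g1 z) + (g2 w - g2 z))%C by ring.
  eapply Rle_lt_trans; [apply Cmod_triangle|]. lra.
Qed.

Lemma rect_dist a b c d x y x0 y0 : a <= x <= b -> c <= y <= d -> a <= x0 <= b -> c <= y0 <= d ->
  Cmod ((x, y) - (x0, y0))%C <= (b - a) + (d - c).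
Proof.
  intros. eapply Rle_trans; [apply Cmod_le_sum|]. simpl.
  apply Rplus_le_compat; apply Rabs_le; lra.
Qed.

(** Goursat's argument with the bound eps times the squared half-perimeter: quartering divides this
    square by 4, so the four pieces add up exactly, and on small rectangles differentiability gives
    the bound. *)
Theorem goursat_rect g a b c d : a <= b -> c <= d -> on_rect a b c d (C_holo_at g) ->
  contour_im g a b c d = 0.
Proof.
  intros Hab Hcd Hg.
  assert (Hc : on_rect a b c d (ccont g)) by (intros x y ? ?; apply holo_ccont, Hg; auto).
  apply Rabs_eq_0, Rle_antisym; [|apply Rabs_pos].
  apply le_epsilon; intros e0 He0. rewrite Rplus_0_l.
  pose (eps := e0 / (1 + ((b - a) + (d - c)) ^ 2)).
  assert (Hs : 0 < 1 + ((b - a) + (d - c)) ^ 2) by nra.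
  assert (He : 0 < eps) by (apply Rdiv_lt_0_compat; auto).
  apply Rle_trans with (eps * ((b - a) + (d - c)) ^ 2).
  2:{ replace e0 with (eps * (1 + ((b - a) + (d - c)) ^ 2)) by (unfold eps; field; lra). nra. }
  (* The inclusions are part of [P] because the quartering premise ranges over all rectangles, while
     g is holomorphic only in the given one. *)
  pose (P := fun a' b' c' d' => a <= a' -> b' <= b -> c <= c' -> d' <= d ->
    Rabs (contour_im g a' b' c' d') <= eps * ((b' - a') + (d' - c')) ^ 2).
  cut (P a b c d); [intros HP; apply HP; apply Rle_refl|].
  apply (rect_bisection P a b c d); auto; unfold P; clear P.
  - intros a' b' c' d' Hab' Hcd' P1 P2 P3 P4 Ha Hb Hc' Hd.
    rewrite (contour_im_split_x g a' ((a' + b') / 2) b') by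
      (try lra; intros; split; apply Hc; lra).
    rewrite !(contour_im_split_y g _ _ c' ((c' + d') / 2) d') by
      (try lra; intros; split; apply Hc; lra).
    assert (Q1 := P1 ltac:(lra) ltac:(lra) ltac:(lra) ltac:(lra)).
    assert (Q2 := P2 ltac:(lra) ltac:(lra) ltac:(lra) ltac:(lra)).
    assert (Q3 := P3 ltac:(lra) ltac:(lra) ltac:(lra) ltac:(lra)).
    assert (Q4 := P4 ltac:(lra) ltac:(lra) ltac:(lra) ltac:(lra)).
    clear P1 P2 P3 P4.
    apply Rabs_le. apply Rabs_le_between in Q1, Q2, Q3, Q4. 
    replace (((a' + b') / 2 - a' + ((c' + d') / 2 - c')) ^ 2) with (((b' - a') + (d' - c')) ^ 2 / 4) in Q1 by field.
    replace ((b' - (a' + b') / 2 + ((c' + d') / 2 - c')) ^ 2) with (((b' - a') + (d' - c')) ^ 2 / 4) in Q2 by field.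
    replace (((a' + b') / 2 - a' + (d' - (c' + d') / 2)) ^ 2) with (((b' - a') + (d' - c')) ^ 2 / 4) in Q3 by field.
    replace ((b' - (a' + b') / 2 + (d' - (c' + d') / 2)) ^ 2) with (((b' - a') + (d' - c')) ^ 2 / 4) in Q4 by field.
    lra.
  - intros x y Hx Hy. destruct (Hg x y Hx Hy) as [l Hl].
    destruct (proj1 (is_derive_C_eps g (x, y) l) Hl (eps / 2)) as [del [Hd Hdel]]; [lra|].
    exists (del / 2); split; [lra|].
    intros a' b' c' d' Ha Hx' Hb Hc' Hy' Hd' Hw Hh _ _ _ _.
    pose (A := fun z => (g (x, y) + l * (z - (x, y)))%C).
    (* [A'] is minus the first-order expansion of g. It has zero contour integral, and the remainder
       is at most eps/2 times the half-perimeter on a boundary whose length is twice the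
       half-perimeter. *)
    pose (A' := fun z => (- g (x, y) + (- l) * (z - (x, y)))%C).
    assert (HA : on_sides a' b' c' d' (ccont A')).
    { apply on_rect_sides; try lra. intros u v _ _. apply holo_ccont, C_holo_affine. }
    assert (HG : on_sides a' b' c' d' (ccont g)).
    { apply on_rect_sides; try lra. intros u v ? ?. apply Hc; lra. }
    replace (contour_im g a' b' c' d') with (contour_im (fun z => g z + A' z)%C a' b' c' d').
    2:{ rewrite contour_im_plus; auto; try lra. unfold A'. rewrite contour_im_affine. ring. }
    assert (Hn : 0 <= b' - a' + (d' - c')) by lra.
    replace (eps * (b' - a' + (d' - c')) ^ 2) with ((eps / 2 * (b' - a' + (d' - c'))) * (2 * (b' - a' + (d' - c')))) by field.
    apply contour_im_bound; try lra.
    + destruct HA as [HA1 HA2], HG as [HG1 HG2]. 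
      split; intros; split; apply ccont_plus; first [apply HA1|apply HA2|apply HG1|apply HG2]; auto.
    + apply on_rect_sides; try lra. intros u v Hu Hv.
      replace (g (u, v) + A' (u, v))%C with (g (u, v) - g (x, y) - l * ((u, v) - (x, y)))%C
        by (unfold A'; ring).
      assert (D := rect_dist a' b' c' d' u v x y ltac:(lra) ltac:(lra) ltac:(lra) ltac:(lra)).
      eapply Rle_trans; [apply Hdel; lra|].
      apply Rmult_le_compat_l; lra.
Qed.

(** * Holomorphic functions, Cauchy's estimate and the maximum principle *)

Lemma is_derive_C_id z : @is_derive C_AbsRing C_NormedModule (fun w => w) z (RtoC 1).
Proof.
  apply is_derive_C_eps. intros eps He. exists 1; split; [lra|]. intros w _.
  replace (w - z - 1 * (w - z))%C with (RtoC 0) by ring. rewrite Cmod_0.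
  generalize (Cmod_ge_0 (w - z)%C). nra.
Qed.

Lemma is_derive_C_const (k z : C) : @is_derive C_AbsRing C_NormedModule (fun _ => k) z (RtoC 0).
Proof. exact (@is_derive_const C_AbsRing C_NormedModule k z). Qed.

Lemma is_derive_C_plus (f g : C -> C) (z l m : C) :
  @is_derive C_AbsRing C_NormedModule f z l -> @is_derive C_AbsRing C_NormedModule g z m ->
  @is_derive C_AbsRing C_NormedModule (fun w => f w + g w)%C z (l + m)%C.
Proof. exact (@is_derive_plus C_AbsRing C_NormedModule f g z l m). Qed.

Lemma is_derive_C_minus (f g : C -> C) (z l m : C) :
  @is_derive C_AbsRing C_NormedModule f z l -> @is_derive C_AbsRing C_NormedModule g z m ->
  @is_derive C_AbsRing C_NormedModule (fun w => f w - g w)%C z (l - m)%C.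
Proof. exact (@is_derive_minus C_AbsRing C_NormedModule f g z l m). Qed.

Lemma is_derive_C_mult (f g : C -> C) (z l m : C) :
  @is_derive C_AbsRing C_NormedModule f z l -> @is_derive C_AbsRing C_NormedModule g z m ->
  @is_derive C_AbsRing C_NormedModule (fun w => f w * g w)%C z (l * g z + f z * m)%C.
Proof.
  intros Hl Hm.
  (* The product rule concerns the ring as a module over itself; the approximation clause carries
     over unchanged and only linearity is proved again. *)
  assert (H1 : @is_derive C_AbsRing (AbsRing_NormedModule C_AbsRing) f z l).
  { split; [apply is_linear_scal_l | exact (proj2 Hl)]. }
  assert (H2 : @is_derive C_AbsRing (AbsRing_NormedModule C_AbsRing) g z m).
  { split; [apply is_linear_scal_l | exact (proj2 Hm)]. }
  assert (H := is_derive_mult f g z l m H1 H2 Cmult_comm).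
  split; [apply is_linear_scal_l | exact (proj2 H)].
Qed.

Lemma C_holo_id z : C_holo_at (fun w => w) z.
Proof. eexists; apply is_derive_C_id. Qed.

Lemma C_holo_const k z : C_holo_at (fun _ => k) z.
Proof. eexists; apply is_derive_C_const. Qed.

Lemma C_holo_plus f g z : C_holo_at f z -> C_holo_at g z -> C_holo_at (fun w => f w + g w)%C z.
Proof. intros [l Hl] [m Hm]. eexists; eapply is_derive_C_plus; eauto. Qed.

Lemma C_holo_minus f g z : C_holo_at f z -> C_holo_at g z -> C_holo_at (fun w => f w - g w)%C z.
Proof. intros [l Hl] [m Hm]. eexists; eapply is_derive_C_minus; eauto. Qed.

Lemma C_holo_mult f g z : C_holo_at f z -> C_holo_at g z -> C_holo_at (fun w => f w * g w)%C z.
Proof. intros [l Hl] [m Hm]. eexists; eapply is_derive_C_mult; eauto. Qed.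

Lemma C_holo_pow f n z : C_holo_at f z -> C_holo_at (fun w => f w ^ n)%C z.
Proof.
  intros H. induction n as [|n IH]; [exact (C_holo_const (RtoC 1) z)|].
  exact (C_holo_mult _ _ _ H IH).
Qed.

Lemma ccont_neq_0 f z : ccont f z -> f z <> 0%C -> exists del, 0 < del /\
  forall w, Cmod (w - z)%C < del -> Cmod (f z) / 2 < Cmod (f w).
Proof.
  intros H Hn. assert (Hp := proj1 (Cmod_gt_0 (f z)) Hn).
  destruct (H (Cmod (f z) / 2)) as [d [Hd Hw]]; [lra|].
  exists d; split; auto. intros w Hw'. specialize (Hw w Hw').
  generalize (Cmod_triangle (f w) (- (f w - f z))).
  replace (f w + - (f w - f z))%C with (f z) by ring. rewrite Cmod_opp. lra.
Qed.

Lemma Cmod_gt_neq_0 (z : C) (r : R) : 0 <= r -> r < Cmod z -> z <> 0%C.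
Proof. intros Hr H ->. rewrite Cmod_0 in H. lra. Qed.

Lemma C_holo_inv f z : C_holo_at f z -> f z <> 0%C -> C_holo_at (fun w => / f w)%C z.
Proof.
  intros Hf Hn. assert (Hc := holo_ccont f z Hf). destruct Hf as [l Hl].
  assert (Hp := proj1 (Cmod_gt_0 (f z)) Hn).
  destruct (ccont_neq_0 f z Hc Hn) as [d0 [Hd0 H0]].
  set (A := Cmod (f z)) in *.
  exists (- l / (f z * f z))%C. apply is_derive_C_eps. intros eps He.
  assert (Hcl := Cmod_ge_0 l).
  (* The two thresholds make each term of the error decomposition below at most [eps / 2 * X], given
     |f w| > A/2. *)
  assert (He1 : 0 < eps * A ^ 2 / 4) by (apply Rdiv_lt_0_compat; [apply Rmult_lt_0_compat; nra|lra]).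
  assert (He2 : 0 < eps * A ^ 3 / (4 * (Cmod l + 1))).
  { apply Rdiv_lt_0_compat; [apply Rmult_lt_0_compat; [lra|apply pow_lt; lra]|lra]. }
  destruct (proj1 (is_derive_C_eps f z l) Hl _ He1) as [d1 [Hd1 H1]].
  destruct (Hc _ He2) as [d2 [Hd2 H2]].
  exists (Rmin d0 (Rmin d1 d2)); split; [repeat apply Rmin_pos; auto|].
  intros w Hw.
  assert (Hw0 := Rlt_le_trans _ _ _ Hw (Rmin_l _ _)).
  assert (Hw12 := Rlt_le_trans _ _ _ Hw (Rmin_r _ _)).
  specialize (H0 w Hw0). specialize (H1 w (Rlt_le_trans _ _ _ Hw12 (Rmin_l _ _))).
  specialize (H2 w (Rlt_le_trans _ _ _ Hw12 (Rmin_r _ _))). clear Hw Hw0 Hw12.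
  assert (Hfw : f w <> 0%C) by (apply (Cmod_gt_neq_0 _ (A / 2)); lra).
  replace (/ f w - / f z - - l / (f z * f z) * (w - z))%C
    with (- (f w - f z - l * (w - z)) / (f w * f z)
          + l * (w - z) * (f w - f z) / (f w * f z * f z))%C by (field; auto).
  eapply Rle_trans; [apply Cmod_triangle|].
  assert (Hn2 : (f w * f z)%C <> 0%C) by (apply Cmult_neq_0; auto).
  rewrite !Cmod_div by (try apply Cmult_neq_0; auto).
  rewrite Cmod_opp, !Cmod_mult. fold A.
  set (X := Cmod (w - z)%C) in *. set (B := Cmod (f w)) in *.
  assert (HX : 0 <= X) by apply Cmod_ge_0.
  assert (HB : 0 < B) by lra.
  apply Rle_trans with (eps / 2 * X + eps / 2 * X); [|lra].
  apply Rplus_le_compat.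
  - apply Rle_div_l; [nra|]. eapply Rle_trans; [apply H1|].
    replace (eps * A ^ 2 / 4 * X) with (eps / 2 * X * (A / 2 * A)) by field.
    apply Rmult_le_compat_l; [nra|]. apply Rmult_le_compat_r; lra.
  - apply Rle_div_l; [apply Rmult_lt_0_compat; nra|].
    apply Rlt_le in H2. 
    apply Rle_trans with (Cmod l * X * (eps * A ^ 3 / (4 * (Cmod l + 1)))).
    { apply Rmult_le_compat_l; [nra|]. exact H2. }
    apply Rle_trans with (eps / 2 * X * (A / 2 * A * A)).
    { replace (Cmod l * X * (eps * A ^ 3 / (4 * (Cmod l + 1))))
        with (eps / 2 * X * (A / 2 * A * A) * (Cmod l / (Cmod l + 1))) by (field; lra).
      rewrite <- (Rmult_1_r (eps / 2 * X * (A / 2 * A * A))) at 2.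
      apply Rmult_le_compat_l; [apply Rmult_le_pos; [nra|]; repeat apply Rmult_le_pos; lra|].
      apply Rle_div_l; lra. }
    apply Rmult_le_compat_l; [nra|]. repeat apply Rmult_le_compat_r; lra.
Qed.

Lemma C_holo_div f g z : C_holo_at f z -> C_holo_at g z -> g z <> 0%C ->
  C_holo_at (fun w => f w / g w)%C z.
Proof. intros Hf Hg Hn. exact (C_holo_mult _ _ _ Hf (C_holo_inv _ _ Hg Hn)). Qed.

Lemma Cmod_sharp f z : Cmod (sharp f z) = Cmod (f (Cconj z)).
Proof. apply Cmod_conj. Qed.

Lemma is_derive_C_sharp f z l :
  @is_derive C_AbsRing C_NormedModule f (Cconj z) l ->
  @is_derive C_AbsRing C_NormedModule (sharp f) z (Cconj l).
Proof.
  intros H. apply is_derive_C_eps. intros eps He.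
  destruct (proj1 (is_derive_C_eps _ _ _) H eps He) as [d [Hd Hw]].
  exists d; split; auto. intros w Hwz.
  assert (E : Cmod (Cconj w - Cconj z)%C = Cmod (w - z)%C)
    by (rewrite <- Cminus_conj; apply Cmod_conj).
  unfold sharp.
  replace (Cconj (f (Cconj w)) - Cconj (f (Cconj z)) - Cconj l * (w - z))%C
    with (Cconj (f (Cconj w) - f (Cconj z) - l * (Cconj w - Cconj z)))%C.
  { rewrite Cmod_conj, <- E. apply Hw. rewrite E; auto. }
  rewrite !Cminus_conj, Cmult_conj, !Cminus_conj, !Cconj_conj. reflexivity.
Qed.

Lemma entire_sharp f : entire f -> entire (sharp f).
Proof. intros H z. destruct (H (Cconj z)) as [l Hl]. eexists; apply is_derive_C_sharp; eauto. Qed.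

(** An arc-length integral, not a maximum over the boundary: the Hardy condition supplies only
    integral bounds. *)
Definition sides_int (g : C -> C) (a b c d : R) : R :=
  RInt (fun x => Cmod (g (x, c))) a b + RInt (fun y => Cmod (g (b, y))) c d
  + RInt (fun x => Cmod (g (x, d))) a b + RInt (fun y => Cmod (g (a, y))) c d.

Lemma abs_RInt_le_dom f g a b : a <= b -> ex_RInt f a b -> ex_RInt g a b ->
  (forall x, a < x < b -> Rabs (f x) <= g x) -> Rabs (RInt f a b) <= RInt g a b.
Proof.
  intros Hab Hf Hg H. eapply Rle_trans; [apply abs_RInt_le; auto|].
  apply RInt_le; auto. apply ex_RInt_norm with (f := f); auto.
Qed.

Lemma ex_RInt_Rscal k f a b : ex_RInt f a b -> ex_RInt (fun x => k * f x) a b.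
Proof. exact (@ex_RInt_scal R_NormedModule f a b k). Qed.

Lemma RInt_Rscal k f a b : ex_RInt f a b -> RInt (fun x => k * f x) a b = k * RInt f a b.
Proof. exact (@RInt_scal R_CompleteNormedModule f a b k). Qed.

Lemma contour_im_le_sides k g m a b c d : a <= b -> c <= d ->
  on_sides a b c d (ccont k) -> on_sides a b c d (ccont g) ->
  on_sides a b c d (fun z => Cmod (k z) <= m * Cmod (g z)) ->
  Rabs (contour_im k a b c d) <= m * sides_int g a b c d.
Proof.
  intros Hab Hcd [H V] [H' V'] [Hm Vm]. unfold contour_im, sides_int.
  assert (I1 : Rabs (RInt (fun x => Im (k (x, c))) a b) <= m * RInt (fun x => Cmod (g (x, c))) a b).
  { rewrite <- RInt_Rscal by (apply ex_RInt_hline_Cmod; auto; intros; apply H'; auto).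
    apply abs_RInt_le_dom; auto.
    - apply ex_RInt_hline_Im; auto; intros; apply H; auto.
    - apply ex_RInt_Rscal, ex_RInt_hline_Cmod; auto; intros; apply H'; auto.
    - intros; eapply Rle_trans; [apply im_le_Cmod|]; apply Hm; lra. }
  assert (I2 : Rabs (RInt (fun x => Im (k (x, d))) a b) <= m * RInt (fun x => Cmod (g (x, d))) a b).
  { rewrite <- RInt_Rscal by (apply ex_RInt_hline_Cmod; auto; intros; apply H'; auto).
    apply abs_RInt_le_dom; auto.
    - apply ex_RInt_hline_Im; auto; intros; apply H; auto.
    - apply ex_RInt_Rscal, ex_RInt_hline_Cmod; auto; intros; apply H'; auto.
    - intros; eapply Rle_trans; [apply im_le_Cmod|]; apply Hm; lra. }
  assert (I3 : Rabs (RInt (fun x => Re (k (a, x))) c d) <= m * RInt (fun x => Cmod (g (a, x))) c d).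
  { rewrite <- RInt_Rscal by (apply ex_RInt_vline_Cmod; auto; intros; apply V'; auto).
    apply abs_RInt_le_dom; auto.
    - apply ex_RInt_vline_Re; auto; intros; apply V; auto.
    - apply ex_RInt_Rscal, ex_RInt_vline_Cmod; auto; intros; apply V'; auto.
    - intros; eapply Rle_trans; [apply re_le_Cmod|]; apply Vm; lra. }
  assert (I4 : Rabs (RInt (fun x => Re (k (b, x))) c d) <= m * RInt (fun x => Cmod (g (b, x))) c d).
  { rewrite <- RInt_Rscal by (apply ex_RInt_vline_Cmod; auto; intros; apply V'; auto).
    apply abs_RInt_le_dom; auto.
    - apply ex_RInt_vline_Re; auto; intros; apply V; auto.
    - apply ex_RInt_Rscal, ex_RInt_vline_Cmod; auto; intros; apply V'; auto.
    - intros; eapply Rle_trans; [apply re_le_Cmod|]; apply Vm; lra. }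
  apply Rabs_le. apply Rabs_le_between in I1, I2, I3, I4. lra.
Qed.

Lemma Cminus_neq_0 (z w : C) : z <> w -> (z - w)%C <> 0%C.
Proof. intros H E. apply H. replace z with (z - w + w)%C by ring. rewrite E. ring. Qed.

Lemma C_holo_kernel g k z1 z : C_holo_at g z -> z <> z1 ->
  C_holo_at (fun w => (g w - k) / (w - z1))%C z.
Proof.
  intros Hg Hz. apply (C_holo_div (fun w => g w - k)%C (fun w => w - z1)%C).
  - apply C_holo_minus; auto. apply C_holo_const.
  - apply C_holo_minus; [apply C_holo_id|apply C_holo_const].
  - apply Cminus_neq_0; auto.
Qed.

Lemma pair_neq_l (x y u v : R) : x <> u -> (x, y) <> ((u, v) : C).
Proof. congruence. Qed.
Lemma pair_neq_r (x y u v : R) : y <> v -> (x, y) <> ((u, v) : C).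
Proof. congruence. Qed.

(** The singularity is removable: differentiability at the point bounds the quotient near it, so a
    small square around it contributes arbitrarily little, and Goursat's theorem applies to the
    rest. *)
Lemma contour_im_quotient g a b c d x1 y1 : a < x1 < b -> c < y1 < d ->
  on_rect a b c d (C_holo_at g) ->
  contour_im (fun z => (g z - g (x1, y1)) / (z - (x1, y1)))%C a b c d = 0.
Proof.
  intros Hx Hy Hg. set (z1 := (x1, y1) : C).
  set (k := fun z => ((g z - g z1) / (z - z1))%C).
  assert (Hk : forall x y, a <= x <= b -> c <= y <= d -> (x, y) <> z1 -> C_holo_at k (x, y)).
  { intros x y Hx' Hy' Hn. apply C_holo_kernel; auto. }
  destruct (Hg x1 y1 ltac:(lra) ltac:(lra)) as [l Hl].
  destruct (proj1 (is_derive_C_eps g z1 l) Hl 1 Rlt_0_1) as [d0 [Hd0 H0]].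
  set (M := 1 + Cmod l). assert (HM : 0 < M) by (unfold M; generalize (Cmod_ge_0 l); lra).
  assert (Hb : forall w, w <> z1 -> Cmod (w - z1)%C < d0 -> Cmod (k w) <= M).
  { intros w Hn Hw. unfold k. rewrite Cmod_div by (apply Cminus_neq_0; auto).
    assert (Hp := proj1 (Cmod_gt_0 _) (Cminus_neq_0 w z1 Hn)).
    apply Rle_div_l; auto. specialize (H0 w Hw).
    replace (g w - g z1)%C with ((g w - g z1 - l * (w - z1)) + l * (w - z1))%C by ring.
    eapply Rle_trans; [apply Cmod_triangle|]. rewrite Cmod_mult. unfold M. lra. }
  apply Rabs_eq_0, Rle_antisym; [|apply Rabs_pos].
  apply le_epsilon; intros e0 He0. rewrite Rplus_0_l.
  (* The square of half-side e stays in the rectangle, lies within 4e < d0 of the point, and has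
     perimeter 8e, so its contribution is at most 8eM <= e0. *)
  pose (e := Rmin (Rmin (x1 - a) (b - x1)) (Rmin (Rmin (y1 - c) (d - y1)) (Rmin (d0 / 5) (e0 / (8 * M))))).
  assert (He : 0 < e).
  { repeat apply Rmin_pos; try lra. apply Rdiv_lt_0_compat; lra. }
  assert (E1 : e <= x1 - a) by (unfold e; eapply Rle_trans; [apply Rmin_l|apply Rmin_l]).
  assert (E2 : e <= b - x1) by (unfold e; eapply Rle_trans; [apply Rmin_l|apply Rmin_r]).
  assert (E0 : e <= Rmin (Rmin (y1 - c) (d - y1)) (Rmin (d0 / 5) (e0 / (8 * M)))) by apply Rmin_r.
  assert (E3 : e <= y1 - c) by (eapply Rle_trans; [apply E0|]; eapply Rle_trans; [apply Rmin_l|apply Rmin_l]).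
  assert (E4 : e <= d - y1) by (eapply Rle_trans; [apply E0|]; eapply Rle_trans; [apply Rmin_l|apply Rmin_r]).
  assert (E5 : e <= d0 / 5) by (eapply Rle_trans; [apply E0|]; eapply Rle_trans; [apply Rmin_r|apply Rmin_l]).
  assert (E6 : e <= e0 / (8 * M)) by (eapply Rle_trans; [apply E0|]; eapply Rle_trans; [apply Rmin_r|apply Rmin_r]).
  clear E0.
  fold k. 
  assert (Hkc : forall x y, a <= x <= b -> c <= y <= d -> x <> x1 \/ y <> y1 -> ccont k (x, y)).
  { intros x y ? ? Hn. apply holo_ccont, Hk; auto. unfold z1. destruct Hn; [apply pair_neq_l|apply pair_neq_r]; auto. }
  assert (Z : forall a' b' c' d', a <= a' -> a' <= b' -> b' <= b -> c <= c' -> c' <= d' -> d' <= d ->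
     b' < x1 \/ x1 < a' \/ d' < y1 \/ y1 < c' -> contour_im k a' b' c' d' = 0).
  { intros a' b' c' d' ? ? ? ? ? ? Hn. apply goursat_rect; auto. intros x y Hx' Hy'.
    apply Hk; try lra. unfold z1. destruct (Req_dec x x1) as [->|Hne].
    - apply pair_neq_r; lra.
    - apply pair_neq_l; auto. }
  rewrite (contour_im_split_x k a (x1 - e) b) by (try lra; intros; split; apply Hkc; lra).
  rewrite (contour_im_split_x k (x1 - e) (x1 + e) b) by (try lra; intros; split; apply Hkc; lra).
  rewrite (contour_im_split_y k (x1 - e) (x1 + e) c (y1 - e) d) by (try lra; intros; split; apply Hkc; lra).
  rewrite (contour_im_split_y k (x1 - e) (x1 + e) (y1 - e) (y1 + e) d) by (try lra; intros; split; apply Hkc; lra).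
  rewrite (Z a (x1 - e)), (Z (x1 + e) b), (Z (x1 - e) (x1 + e) c), (Z (x1 - e) (x1 + e) (y1 + e) d) by lra.
  replace (0 + (0 + (contour_im k (x1 - e) (x1 + e) (y1 - e) (y1 + e) + 0) + 0))
    with (contour_im k (x1 - e) (x1 + e) (y1 - e) (y1 + e)) by ring.
  apply Rle_trans with (M * (2 * ((x1 + e - (x1 - e)) + (y1 + e - (y1 - e))))).
  - apply contour_im_bound; try lra.
    + split; intros; split; apply Hkc; lra.
    + assert (Hd : forall x y, x1 - e <= x <= x1 + e -> y1 - e <= y <= y1 + e -> Cmod ((x, y) - z1)%C < d0).
      { intros x y ? ?. eapply Rle_lt_trans; [apply (rect_dist (x1 - e) (x1 + e) (y1 - e) (y1 + e)); lra|]. lra. }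
      split; intros; split; apply Hb; try (apply Hd; lra); unfold z1;
      try (apply pair_neq_r; lra); apply pair_neq_l; lra.
  - apply Rle_div_r in E6; lra.
Qed.

(** The exact value is 2 pi v, but any positive multiple of v will do. Each side contributes v times
    the angle it subtends at the point, hence a nonnegative amount, and only the bottom side is
    estimated. *)
Lemma contour_im_kernel_ge v a b c d x1 y1 : 0 <= v -> a < x1 < b -> c < y1 < d ->
  v * ((b - a) * (y1 - c) / ((b - a) ^ 2 + (y1 - c) ^ 2))
    <= contour_im (fun z => RtoC v / (z - (x1, y1)))%C a b c d.
Proof.
  intros Hv Hx Hy.
  set (k := fun z => (RtoC v / (z - (x1, y1)))%C).
  assert (Hkc : forall x y, x <> x1 \/ y <> y1 -> ccont k (x, y)).
  { intros x y Hn. apply holo_ccont. unfold k.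
    apply (C_holo_div (fun _ => RtoC v) (fun w => w - (x1, y1))%C).
    - apply C_holo_const.
    - apply C_holo_minus; [apply C_holo_id|apply C_holo_const].
    - apply Cminus_neq_0. destruct Hn; [apply pair_neq_l|apply pair_neq_r]; auto. }
  assert (Hk : forall x y, x <> x1 \/ y <> y1 -> 0 < (x - x1) ^ 2 + (y - y1) ^ 2 /\
    Re (k (x, y)) = v * (x - x1) / ((x - x1) ^ 2 + (y - y1) ^ 2) /\
    Im (k (x, y)) = v * (y1 - y) / ((x - x1) ^ 2 + (y - y1) ^ 2)).
  { intros x y Hn. assert (Hp : 0 < (x - x1) ^ 2 + (y - y1) ^ 2).
    { destruct Hn as [Hn|Hn].
      - assert (0 < (x - x1) ^ 2) by (apply pow2_gt_0; lra). generalize (pow2_ge_0 (y - y1)); lra.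
      - assert (0 < (y - y1) ^ 2) by (apply pow2_gt_0; lra). generalize (pow2_ge_0 (x - x1)); lra. }
    split; [exact Hp|]. unfold k; simpl; split; field; simpl in Hp; lra. }
  unfold contour_im. fold k.
  assert (I1 : v * ((b - a) * (y1 - c) / ((b - a) ^ 2 + (y1 - c) ^ 2)) <= RInt (fun x => Im (k (x, c))) a b).
  { set (m := v * (y1 - c) / ((b - a) ^ 2 + (y1 - c) ^ 2)).
    replace (v * ((b - a) * (y1 - c) / ((b - a) ^ 2 + (y1 - c) ^ 2))) with (RInt (fun _ => m) a b).
    2:{ rewrite RInt_const. unfold scal; simpl; unfold mult; simpl. unfold m; field. nra. }
    apply RInt_le; try lra.
    - apply ex_RInt_const.
    - apply ex_RInt_hline_Im; try lra. intros; apply Hkc; lra.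
    - intros x Hx'. destruct (Hk x c) as (Hp & _ & ->); [lra|]. unfold m.
      unfold Rdiv. apply Rmult_le_compat_l; [nra|]. apply Rinv_le_contravar; [exact Hp|]. nra. }
  assert (I2 : 0 <= RInt (fun y => Re (k (b, y))) c d).
  { apply RInt_ge_0; try lra.
    - apply ex_RInt_vline_Re; try lra. intros; apply Hkc; lra.
    - intros y Hy'. destruct (Hk b y) as (Hp & -> & _); [lra|].
      apply Rdiv_le_0_compat; [nra|exact Hp]. }
  assert (I3 : 0 <= - RInt (fun x => Im (k (x, d))) a b).
  { replace (- RInt (fun x => Im (k (x, d))) a b) with (-1 * RInt (fun x => Im (k (x, d))) a b) by ring.
    rewrite <- RInt_Rscal by (apply ex_RInt_hline_Im; try lra; intros; apply Hkc; lra).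
    apply RInt_ge_0; try lra.
    - apply ex_RInt_Rscal, ex_RInt_hline_Im; try lra; intros; apply Hkc; lra.
    - intros x Hx'. destruct (Hk x d) as (Hp & _ & ->); [lra|].
      replace (-1 * (v * (y1 - d) / ((x - x1) ^ 2 + (d - y1) ^ 2)))
        with (v * (d - y1) / ((x - x1) ^ 2 + (d - y1) ^ 2)) by (field; simpl in Hp; lra).
      apply Rdiv_le_0_compat; [nra|exact Hp]. }
  assert (I4 : 0 <= - RInt (fun y => Re (k (a, y))) c d).
  { replace (- RInt (fun y => Re (k (a, y))) c d) with (-1 * RInt (fun y => Re (k (a, y))) c d) by ring.
    rewrite <- RInt_Rscal by (apply ex_RInt_vline_Re; try lra; intros; apply Hkc; lra).
    apply RInt_ge_0; try lra.
    - apply ex_RInt_Rscal, ex_RInt_vline_Re; try lra; intros; apply Hkc; lra.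
    - intros y Hy'. destruct (Hk a y) as (Hp & -> & _); [lra|].
      replace (-1 * (v * (a - x1) / ((a - x1) ^ 2 + (y - y1) ^ 2)))
        with (v * (x1 - a) / ((a - x1) ^ 2 + (y - y1) ^ 2)) by (field; simpl in Hp; lra).
      apply Rdiv_le_0_compat; [nra|exact Hp]. }
  lra.
Qed.

Lemma Cmod_ge_dist_l x y u v r : r <= Rabs (x - u) -> r <= Cmod ((x, y) - (u, v))%C.
Proof. intros H. eapply Rle_trans; [apply H|]. apply (re_le_Cmod ((x, y) - (u, v))%C). Qed.
Lemma Cmod_ge_dist_r x y u v r : r <= Rabs (y - v) -> r <= Cmod ((x, y) - (u, v))%C.
Proof. intros H. eapply Rle_trans; [apply H|]. apply (im_le_Cmod ((x, y) - (u, v))%C). Qed.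

(** Rotating g makes its value at the point a number v >= 0. Subtracting the quotient with zero
    contour integral turns h(z)/(z - z1) into v/(z - z1), whose imaginary part is bounded below. The
    lossy constant is harmless: it is removed by taking powers or hidden in an unspecified bound. *)
Lemma cauchy_estimate_rect g a b c d x1 y1 r : 0 < r -> a + r <= x1 <= b - r -> c + r <= y1 <= d - r ->
  on_rect a b c d (C_holo_at g) ->
  Cmod (g (x1, y1)) * ((b - a) * (y1 - c) / ((b - a) ^ 2 + (y1 - c) ^ 2))
    <= / r * sides_int g a b c d.
Proof.
  intros Hr Hx Hy Hg. set (z1 := (x1, y1) : C). set (v := Cmod (g z1)).
  assert (exists om : C, Cmod om = 1 /\ (om * g z1)%C = RtoC v) as [om [Hom1 Hom2]].
  { destruct (Req_dec v 0) as [H0|H0].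
    - exists 1%C. split; [apply Cmod_1|]. rewrite H0, (Cmod_eq_0 _ H0). ring.
    - exists (Cconj (g z1) / RtoC v)%C. 
      assert (Hv : RtoC v <> 0%C) by (intros E; apply H0, RtoC_inj, E).
      split.
      + rewrite Cmod_div, Cmod_conj, Cmod_R by auto. fold v.
        rewrite Rabs_pos_eq by apply Cmod_ge_0. field; auto.
      + replace (Cconj (g z1) / RtoC v * g z1)%C with (g z1 * Cconj (g z1) / RtoC v)%C by (field; auto).
        rewrite <- Cmod2_conj. fold v. rewrite RtoC_pow. field; auto. }
  set (h := fun z => (om * g z)%C).
  assert (Hh : on_rect a b c d (C_holo_at h)).
  { intros x y ? ?. apply C_holo_mult; [apply C_holo_const|apply Hg; auto]. }
  assert (Q := contour_im_quotient h a b c d x1 y1 ltac:(lra) ltac:(lra) Hh).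
  assert (Hz : on_sides a b c d (fun z => z <> z1 /\ C_holo_at g z /\ r <= Cmod (z - z1)%C)).
  { split; intros; repeat split; unfold z1; try (apply pair_neq_r; lra); try (apply pair_neq_l; lra);
    try (apply Hg; lra).
    - apply Cmod_ge_dist_r. rewrite Rabs_left; lra.
    - apply Cmod_ge_dist_r. rewrite Rabs_pos_eq; lra.
    - apply Cmod_ge_dist_l. rewrite Rabs_left; lra.
    - apply Cmod_ge_dist_l. rewrite Rabs_pos_eq; lra. }
  assert (Hs : forall P : C -> Prop, (forall z, z <> z1 -> C_holo_at g z -> r <= Cmod (z - z1)%C -> P z) -> on_sides a b c d P).
  { intros P HP. destruct Hz as [Hz1 Hz2]. split; intros t Ht; 
    [destruct (Hz1 t Ht)|destruct (Hz2 t Ht)]; split; apply HP; tauto. }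
  set (k := fun z => (h z / (z - z1))%C).
  assert (Hk : on_sides a b c d (ccont k)).
  { apply Hs. intros z Hn Hgz _. apply holo_ccont.
    apply (C_holo_div h (fun w => w - z1)%C).
    - apply C_holo_mult; [apply C_holo_const|auto].
    - apply C_holo_minus; [apply C_holo_id|apply C_holo_const].
    - apply Cminus_neq_0; auto. }
  assert (L := contour_im_kernel_ge v a b c d x1 y1 (Cmod_ge_0 _) ltac:(lra) ltac:(lra)).
  fold z1 in L, Q. 
  assert (E : contour_im k a b c d = contour_im (fun z => RtoC v / (z - z1))%C a b c d).
  { rewrite <- (Rplus_0_r (contour_im (fun z => RtoC v / (z - z1))%C a b c d)), <- Q.
    rewrite <- contour_im_plus; try lra.
    - apply contour_im_ext; try lra. apply Hs. intros z Hn _ _. unfold k.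
      replace (h z1) with (RtoC v) by (symmetry; exact Hom2).
      field. apply Cminus_neq_0; auto.
    - apply Hs. intros z Hn _ _. apply holo_ccont.
      apply (C_holo_div (fun _ => RtoC v) (fun w => w - z1)%C).
      + apply C_holo_const.
      + apply C_holo_minus; [apply C_holo_id|apply C_holo_const].
      + apply Cminus_neq_0; auto.
    - apply Hs. intros z Hn Hgz _. apply holo_ccont.
      apply C_holo_kernel; auto. apply C_holo_mult; [apply C_holo_const|auto]. }
  eapply Rle_trans; [apply L|]. rewrite <- E.
  eapply Rle_trans; [apply Rle_abs|].
  apply contour_im_le_sides; try lra; auto.
  - apply Hs. intros; apply holo_ccont; auto.
  - apply Hs. intros z Hn _ Hd. unfold k, h. rewrite Cmod_div, Cmod_mult, Hom1 by (apply Cminus_neq_0; auto).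
    rewrite Rmult_1_l. unfold Rdiv. rewrite Rmult_comm.
    apply Rmult_le_compat_r; [apply Cmod_ge_0|]. apply Rinv_le_contravar; auto.
Qed.

Lemma sides_int_le_const g a b c d m : a <= b -> c <= d ->
  on_sides a b c d (ccont g) -> on_sides a b c d (fun z => Cmod (g z) <= m) ->
  sides_int g a b c d <= m * (2 * ((b - a) + (d - c))).
Proof.
  intros Hab Hcd [H V] [Hm Vm]. unfold sides_int.
  assert (I : forall f u v, u <= v -> ex_RInt f u v -> (forall t, u <= t <= v -> f t <= m) -> RInt f u v <= m * (v - u)).
  { intros f u v Huv Hf Hb. rewrite Rmult_comm. 
    replace ((v - u) * m) with (RInt (fun _ => m) u v) by (rewrite RInt_const; reflexivity).
    apply RInt_le; auto. apply ex_RInt_const. intros; apply Hb; lra. }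
  assert (I1 := I (fun x => Cmod (g (x, c))) a b Hab). assert (I2 := I (fun x => Cmod (g (x, d))) a b Hab).
  assert (I3 := I (fun x => Cmod (g (a, x))) c d Hcd). assert (I4 := I (fun x => Cmod (g (b, x))) c d Hcd).
  cbv beta in *.
  apply Rle_trans with (m * (b - a) + m * (d - c) + m * (b - a) + m * (d - c)); [|right; ring].
  repeat apply Rplus_le_compat.
  - apply I1; [apply ex_RInt_hline_Cmod; auto; intros; apply H; auto|intros; apply Hm; auto].
  - apply I4; [apply ex_RInt_vline_Cmod; auto; intros; apply V; auto|intros; apply Vm; auto].
  - apply I2; [apply ex_RInt_hline_Cmod; auto; intros; apply H; auto|intros; apply Hm; auto].
  - apply I3; [apply ex_RInt_vline_Cmod; auto; intros; apply V; auto|intros; apply Vm; auto].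
Qed.

Lemma pow_bounded_le (x m B : R) : 0 <= m -> 0 <= B ->
  (forall n : nat, x ^ n <= B * m ^ n) -> x <= m.
Proof.
  intros Hm HB H. destruct (Rle_or_lt x m) as [|Hlt]; auto. exfalso.
  destruct (Req_dec m 0) as [->|Hm0].
  { specialize (H 1%nat). simpl in H. lra. }
  assert (Hq : 1 < x / m) by (apply Rlt_div_r; lra).
  destruct (Pow_x_infinity (x / m)) with (b := B + 1) as [N HN].
  { rewrite Rabs_pos_eq; lra. }
  specialize (HN N (le_n N)). rewrite Rabs_pos_eq in HN by (apply pow_le; lra).
  specialize (H N). unfold Rdiv in HN. rewrite Rpow_mult_distr, pow_inv in HN.
  assert (Hp : 0 < m ^ N) by (apply pow_lt; lra).
  assert (x ^ N * / m ^ N <= B) by (apply Rle_div_l; auto). lra.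
Qed.

(** Landau's trick: the Cauchy estimate for g^n gives |g(z)|^n <= C m^n with C independent of n, and
    letting n grow removes C. *)
Theorem max_principle_rect g a b c d m : a < b -> c < d ->
  on_rect a b c d (C_holo_at g) -> 0 <= m -> on_sides a b c d (fun z => Cmod (g z) <= m) ->
  on_rect a b c d (fun z => Cmod (g z) <= m).
Proof.
  intros Hab Hcd Hg Hm [Hs1 Hs2] x y Hx Hy.
  destruct (Req_dec x a) as [->|Hxa]; [apply Hs2; auto|].
  destruct (Req_dec x b) as [->|Hxb]; [apply Hs2; auto|].
  destruct (Req_dec y c) as [->|Hyc]; [apply Hs1; auto|].
  destruct (Req_dec y d) as [->|Hyd]; [apply Hs1; auto|].
  set (r := Rmin (Rmin (x - a) (b - x)) (Rmin (y - c) (d - y))).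
  assert (Hr : 0 < r) by (repeat apply Rmin_pos; lra).
  assert (R1 : r <= x - a) by (eapply Rle_trans; [apply Rmin_l|apply Rmin_l]).
  assert (R2 : r <= b - x) by (eapply Rle_trans; [apply Rmin_l|apply Rmin_r]).
  assert (R3 : r <= y - c) by (eapply Rle_trans; [apply Rmin_r|apply Rmin_l]).
  assert (R4 : r <= d - y) by (eapply Rle_trans; [apply Rmin_r|apply Rmin_r]).
  set (ka := (b - a) * (y - c) / ((b - a) ^ 2 + (y - c) ^ 2)).
  assert (Hka : 0 < ka) by (apply Rdiv_lt_0_compat; nra).
  set (w := 2 * ((b - a) + (d - c))).
  apply (pow_bounded_le _ _ (/ r * w / ka)); auto.
  { apply Rdiv_le_0_compat; auto. apply Rmult_le_pos; [apply Rlt_le, Rinv_0_lt_compat; auto|unfold w; lra]. }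
  intros n.
  assert (Hgn : on_rect a b c d (C_holo_at (fun z => g z ^ n)%C)).
  { intros u v ? ?. apply C_holo_pow, Hg; auto. }
  assert (B := cauchy_estimate_rect (fun z => g z ^ n)%C a b c d x y r Hr ltac:(lra) ltac:(lra) Hgn).
  fold ka in B. cbv beta in B. rewrite Cmod_pow in B.
  assert (S : sides_int (fun z => g z ^ n)%C a b c d <= m ^ n * w).
  { apply sides_int_le_const; try lra.
    - apply on_rect_sides; try lra. intros u v ? ?. apply holo_ccont, Hgn; auto.
    - split; intros t Ht; rewrite !Cmod_pow; split; apply pow_incr; split; try apply Cmod_ge_0; 
      first [apply Hs1|apply Hs2]; auto. }
  replace (/ r * w / ka * m ^ n) with (/ r * (m ^ n * w) / ka) by (field; lra).
  apply Rle_div_r; auto. eapply Rle_trans; [apply B|].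
  apply Rmult_le_compat_l; auto. apply Rlt_le, Rinv_0_lt_compat; auto.
Qed.

(** * The half-plane, real powers, and exchange of integrals *)

(** Dividing by 1 - i e z, which has modulus at least 1 in the closed half-plane and grows linearly,
    makes the bounded g small on the far sides of a large box; then e tends to 0. *)
Theorem phragmen_lindelof_half_plane g B m :
  (forall z, 0 <= Im z -> C_holo_at g z) -> (forall z, 0 <= Im z -> Cmod (g z) <= B) ->
  (forall x : R, Cmod (g (RtoC x)) <= m) -> forall z, 0 <= Im z -> Cmod (g z) <= m.
Proof.
  intros Hg HB Hm [x y] Hy. simpl in Hy.
  assert (Hm0 : 0 <= m) by (eapply Rle_trans; [apply (Cmod_ge_0 (g 0%C))|apply Hm]).
  assert (HB0 : 0 <= B) by (eapply Rle_trans; [apply (Cmod_ge_0 (g 0%C))|apply HB; simpl; lra]).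
  assert (K : forall e, 0 < e -> e <= 1 -> Cmod (g (x, y)) <= (m + e) * (1 + e * (Rabs x + y))).
  { intros e He He1.
    set (h := fun z => (1 - Ci * RtoC e * z)%C).
    assert (Hh : forall u v, h (u, v) = (1 + e * v, - (e * u))).
    { intros u v. unfold h, Cminus, Cmult, Cplus, Copp, Ci, RtoC; simpl. f_equal; ring. }
    assert (Hge : forall u v, 1 + e * v <= Cmod (h (u, v)) /\ e * Rabs u <= Cmod (h (u, v))).
    { intros u v. rewrite Hh. split.
      - eapply Rle_trans; [|apply re_le_Cmod]. apply Rle_abs.
      - eapply Rle_trans; [|apply im_le_Cmod]. simpl. rewrite Rabs_Ropp, Rabs_mult, (Rabs_pos_eq e); lra. }
    assert (Hn : forall u v, 0 <= v -> 1 <= Cmod (h (u, v)) /\ h (u, v) <> 0%C).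
    { intros u v Hv. destruct (Hge u v) as [H1 _].
      assert (1 <= Cmod (h (u, v))) by nra. split; auto.
      apply (Cmod_gt_neq_0 _ 0); lra. }
    (* The first terms put the point inside the box; the last gives (m + e) e T >= B on the far
       sides. The level m + e avoids a division by zero when m = 0. *)
    set (T := Rabs x + y + 1 + B / (e * (m + e))).
    assert (HT0 : 0 <= B / (e * (m + e))) by (apply Rdiv_le_0_compat; nra).
    assert (Hx := Rabs_pos x).
    assert (HT : B <= (m + e) * (e * T)).
    { unfold T. apply Rle_trans with ((m + e) * (e * (B / (e * (m + e))))).
      - right; field; lra.
      - apply Rmult_le_compat_l; [lra|]. apply Rmult_le_compat_l; lra. }
    set (k := fun z => (g z / h z)%C).
    assert (Hk : on_rect (- T) T 0 T (C_holo_at k)).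
    { intros u v Hu Hv. apply (C_holo_div g h).
      - apply Hg; simpl; lra.
      - apply (C_holo_minus (fun _ => RtoC 1) (fun z => (Ci * RtoC e) * z)%C); [apply (C_holo_const (RtoC 1))|].
        apply (C_holo_mult (fun _ => (Ci * RtoC e)%C) (fun z => z)); [apply C_holo_const|apply C_holo_id].
      - apply Hn; lra. }
    assert (Hb : forall u v, 0 <= v -> v = 0 \/ Rabs u = T \/ v = T -> Cmod (k (u, v)) <= m + e).
    { intros u v Hv Hc. destruct (Hn u v Hv) as [H1 H0]. unfold k.
      rewrite Cmod_div by auto. apply Rle_div_l; [lra|].
      destruct (Hge u v) as [H2 H3].
      destruct Hc as [-> | Hc].
      - generalize (Hm u). unfold RtoC. nra.
      - eapply Rle_trans; [apply HB; simpl; lra|]. eapply Rle_trans; [apply HT|].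
        apply Rmult_le_compat_l; [lra|]. destruct Hc as [<-|Hc]; [lra|]. rewrite Hc in H2 |- *. lra. }
    assert (Hin : Cmod (k (x, y)) <= m + e).
    { apply (max_principle_rect k (- T) T 0 T (m + e)); auto; try (unfold T; lra).
      - split.
        + intros t Ht. split; apply Hb; try lra.
        + intros t Ht. split; apply Hb; try lra; right; left; [rewrite Rabs_Ropp|]; apply Rabs_pos_eq; unfold T; lra.
      - assert (A1' := Rle_abs x). assert (A2' := Rle_abs (- x)). rewrite Rabs_Ropp in A2'. unfold T; split; lra. }
    destruct (Hn x y Hy) as [H1 H0].
    unfold k in Hin. rewrite Cmod_div in Hin by auto. apply Rle_div_l in Hin; [|lra].
    eapply Rle_trans; [apply Hin|]. apply Rmult_le_compat_l; [lra|].
    eapply Rle_trans; [apply Cmod_le_sum|]. rewrite Hh; simpl.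
    rewrite Rabs_Ropp, Rabs_mult, (Rabs_pos_eq (1 + e * y)), (Rabs_pos_eq e); nra. }
  apply le_epsilon. intros d Hd.
  (* For e <= 1 the bound of [K] is at most m + e w. *)
  set (w := 1 + (m + 1) * (Rabs x + y)).
  assert (Hw : 0 < w) by (unfold w; generalize (Rabs_pos x); nra).
  set (e := Rmin 1 (d / w)).
  assert (He : 0 < e) by (apply Rmin_pos; [lra|apply Rdiv_lt_0_compat; auto]).
  assert (He1 : e <= 1) by apply Rmin_l.
  assert (He2 : e * w <= d) by (apply Rle_div_r; auto; apply Rmin_r).
  eapply Rle_trans; [apply (K e He He1)|].
  unfold w in He2. generalize (Rabs_pos x); intros.
  assert (0 <= e * (Rabs x + y)) by (apply Rmult_le_pos; lra).
  nra.
Qed.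

Lemma rpow_pos x p : 0 < x -> rpow x p = Rpower x p.
Proof. intros H. unfold rpow. destruct Rle_dec; auto; lra. Qed.

Lemma rpow_0 x p : x <= 0 -> rpow x p = 0.
Proof. intros H. unfold rpow. destruct Rle_dec; auto; lra. Qed.

Lemma rpow_ge_0 x p : 0 <= rpow x p.
Proof. unfold rpow. destruct Rle_dec; [lra|]. apply Rlt_le, exp_pos. Qed.

Lemma rpow_gt_0 x p : 0 < x -> 0 < rpow x p.
Proof. intros H. rewrite rpow_pos; auto. apply exp_pos. Qed.

Lemma rpow_le x y p : 0 <= p -> x <= y -> rpow x p <= rpow y p.
Proof.
  intros Hp H. destruct (Rle_or_lt x 0) as [Hx|Hx].
  - rewrite (rpow_0 x); auto. apply rpow_ge_0.
  - rewrite !rpow_pos by lra. apply Rle_Rpower_l; lra.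
Qed.

Lemma rpow_mult_distr x y p : 0 <= x -> 0 <= y -> rpow (x * y) p = rpow x p * rpow y p.
Proof.
  intros [Hx| <-] [Hy| <-]; try (rewrite ?Rmult_0_l, ?Rmult_0_r, ?(rpow_0 0) by lra; ring).
  rewrite !rpow_pos by (auto; apply Rmult_lt_0_compat; auto).
  symmetry. apply Rpower_mult_distr; auto.
Qed.

Lemma rpow_rpow x p q : rpow (rpow x p) q = rpow x (p * q).
Proof.
  destruct (Rle_or_lt x 0) as [Hx|Hx].
  - rewrite (rpow_0 x), !rpow_0 by lra. reflexivity.
  - rewrite (rpow_pos (rpow x p)) by (apply rpow_gt_0; auto). rewrite !rpow_pos by auto. apply Rpower_mult.
Qed.

Lemma rpow_plus x p q : rpow x (p + q) = rpow x p * rpow x q.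
Proof.
  destruct (Rle_or_lt x 0) as [Hx|Hx].
  - rewrite !rpow_0 by lra. ring.
  - rewrite !rpow_pos by auto. apply Rpower_plus.
Qed.

Lemma rpow_1 x : 0 <= x -> rpow x 1 = x.
Proof.
  intros [Hx| <-]; [rewrite rpow_pos by auto; apply Rpower_1; auto|apply rpow_0; lra].
Qed.

Lemma rpow_INR x n : 0 <= x -> (0 < n)%nat -> rpow x (INR n) = x ^ n.
Proof.
  intros [Hx| <-] Hn; [rewrite rpow_pos by auto; apply Rpower_pow; auto|].
  rewrite rpow_0, pow_ne_zero by (lra || lia). reflexivity.
Qed.

Lemma rpow_inv x p : 0 <= x -> p <> 0 -> rpow (rpow x p) (1 / p) = x.
Proof. intros Hx Hp. rewrite rpow_rpow. replace (p * (1 / p)) with 1 by (field; auto). apply rpow_1; auto. Qed.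

Lemma continuous_rpow x p : 0 < p -> continuous (fun t => rpow t p) x.
Proof.
  intros Hp. destruct (Rtotal_order x 0) as [Hx|[Hx|Hx]].
  - apply (continuous_ext_loc _ (fun _ => 0)); [|apply continuous_const].
    exists (mkposreal (- x) ltac:(lra)). intros y Hy. 
    apply Rabs_def2 in Hy. simpl in Hy. unfold minus, plus, opp in Hy; simpl in Hy.
    rewrite rpow_0; lra.
  - apply continuous_R_eps. intros eps He. exists (Rpower eps (1 / p)); split; [apply exp_pos|].
    intros y Hy. rewrite (rpow_0 x) by lra. rewrite Hx in Hy.
    rewrite Rminus_0_r, Rabs_pos_eq by apply rpow_ge_0.
    destruct (Rle_or_lt y 0) as [Hy0|Hy0]; [rewrite rpow_0; lra|].
    rewrite Rminus_0_r, Rabs_pos_eq in Hy by lra. rewrite rpow_pos by auto.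
    rewrite <- (Rpower_1 eps) by auto. replace 1 with (1 / p * p) by (field; lra).
    rewrite <- Rpower_mult. apply Rlt_Rpower_l; auto.
  - apply (continuous_ext_loc _ (fun t => exp (p * ln t))).
    + exists (mkposreal x Hx). intros y Hy.
      apply Rabs_def2 in Hy. simpl in Hy. unfold minus, plus, opp in Hy; simpl in Hy.
      rewrite rpow_pos by lra. reflexivity.
    + apply (ex_derive_continuous (fun t => exp (p * ln t))). auto_derive; auto.
Qed.

(** Integrability is required near c only, because the integrands used later are known to be
    continuous only at positive heights. *)
Lemma RInt_param_continuous (f : R -> R -> R) (a b c : R) : a <= b ->
  (forall t, a <= t <= b -> continuity_2d_pt f c t) ->
  locally c (fun s => ex_RInt (f s) a b) -> continuous (fun s => RInt (f s) a b) c.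
Proof.
  intros Hab Hf [d0 Hi]. apply continuous_R_eps. intros eps He.
  assert (He' : 0 < eps / (1 + (b - a))) by (apply Rdiv_lt_0_compat; lra).
  destruct (uniform_continuity_2d_1d' f a b c Hf (mkposreal _ He')) as [d Hd].
  exists (Rmin d0 d). split; [apply Rmin_pos; [apply d0|apply d]|].
  intros s Hs. assert (Hs0 := Rlt_le_trans _ _ _ Hs (Rmin_l _ _)).
  assert (Hs1 := Rlt_le_trans _ _ _ Hs (Rmin_r _ _)).
  assert (I1 : ex_RInt (f s) a b) by (apply Hi; exact Hs0).
  assert (I2 : ex_RInt (f c) a b) by (apply Hi, ball_center).
  replace (RInt (f s) a b - RInt (f c) a b) with (RInt (fun t => f s t - f c t) a b)
    by exact (@RInt_minus R_CompleteNormedModule (f s) (f c) a b I1 I2).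
  apply Rle_lt_trans with ((b - a) * (eps / (1 + (b - a)))).
  - apply abs_RInt_le_const; auto.
    + exact (@ex_RInt_minus R_NormedModule (f s) (f c) a b I1 I2).
    + intros t Ht. apply Rlt_le. assert (Hd0 := cond_pos d). apply Rabs_def2 in Hs1. 
      apply (Hd t c t s); try lra. rewrite Rminus_diag, Rabs_R0. lra.
  - replace ((b - a) * (eps / (1 + (b - a)))) with (eps * ((b - a) / (1 + (b - a)))) by (field; lra).
    rewrite <- (Rmult_1_r eps) at 2. apply Rmult_lt_compat_l; auto. apply Rlt_div_l; lra.
Qed.

Lemma continuity_2d_pt_continuous_l (f : R -> R -> R) x y :
  continuity_2d_pt f x y -> continuous (fun t => f t y) x.
Proof.
  intros H. apply continuous_R_eps. intros eps He. destruct (H (mkposreal eps He)) as [d Hd].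
  exists d; split; [apply d|]. intros t Ht. apply Hd; auto. rewrite Rminus_diag, Rabs_R0. apply d.
Qed.

Lemma continuity_2d_pt_swap (f : R -> R -> R) x y :
  continuity_2d_pt f x y -> continuity_2d_pt (fun u v => f v u) y x.
Proof. intros H eps. destruct (H eps) as [d Hd]. exists d. intros; apply Hd; auto. Qed.

(** As functions of the right end point t of the x-interval, both sides vanish at t = a and have the
    same derivative, by differentiation under the integral sign. *)
Lemma RInt_swap_upper (f : R -> R -> R) (a b c d : R) : a <= b -> 0 < c -> c <= d ->
  (forall x y, 0 < y -> continuity_2d_pt f x y) ->
  RInt (fun x => RInt (fun y => f x y) c d) a b = RInt (fun y => RInt (fun x => f x y) a b) c d.
Proof.
  intros Hab Hc Hcd Hf.
  assert (Ix : forall y u v, 0 < y -> ex_RInt (fun x => f x y) u v).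
  { intros y u v Hy. apply (@ex_RInt_continuous R_CompleteNormedModule).
    intros x _. apply (continuity_2d_pt_continuous_l f); auto. }
  assert (Iy : forall x, ex_RInt (fun y => f x y) c d).
  { intros x. apply (@ex_RInt_continuous R_CompleteNormedModule).
    intros y Hy. rewrite Rmin_left in Hy by lra.
    apply (continuity_2d_pt_continuous_l (fun u v => f v u)), continuity_2d_pt_swap, Hf. lra. }
  set (V := fun x => RInt (fun y => f x y) c d).
  set (G := fun t => RInt (fun y => RInt (fun x => f x y) a t) c d).
  assert (HV : forall t, continuous V t).
  { intros t. apply (RInt_param_continuous f); auto.
    - intros y Hy. apply Hf; lra.
    - apply filter_forall. auto. }
  assert (HD : forall y t, 0 < y -> is_derive (fun t => RInt (fun x => f x y) a t) t (f t y)).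
  { intros y t Hy. apply (is_derive_RInt (fun x => f x y) _ a).
    - apply filter_forall. intros s. apply (@RInt_correct R_CompleteNormedModule). apply Ix; auto.
    - apply (continuity_2d_pt_continuous_l f); auto. }
  assert (HG : forall t, is_derive G t (V t)).
  { intros t.
    replace (V t) with (RInt (fun y => Derive (fun u => RInt (fun x => f x y) a u) t) c d).
    2:{ apply RInt_ext. intros y Hy. rewrite Rmin_left in Hy by lra.
        apply is_derive_unique, HD. lra. }
    apply (is_derive_RInt_param (fun t y => RInt (fun x => f x y) a t)).
    - apply filter_forall. intros s y Hy. rewrite Rmin_left in Hy by lra.
      exists (f s y). apply HD; lra.
    - intros y Hy. rewrite Rmin_left in Hy by lra.
      apply (continuity_2d_pt_ext_loc f); [|apply Hf; lra].
      exists (mkposreal y ltac:(lra)). intros u v _ Hv. apply Rabs_def2 in Hv. simpl in Hv.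
      symmetry. apply is_derive_unique, HD. lra.
    - apply filter_forall. intros s. apply (@ex_RInt_continuous R_CompleteNormedModule).
      intros y Hy. rewrite Rmin_left in Hy by lra.
      destruct (Rle_or_lt a s) as [Has|Has].
      + apply (RInt_param_continuous (fun y x => f x y)); auto.
        * intros x _. apply (continuity_2d_pt_swap f), Hf. lra.
        * exists (mkposreal y ltac:(lra)). intros v Hv. apply Rabs_def2 in Hv. simpl in Hv.
          unfold minus, plus, opp in Hv; simpl in Hv. apply Ix. lra.
      (* The derivative is taken at every t, so the inner integral may also run backwards, to s <
         a. *)
      + apply (continuous_ext_loc _ (fun y => opp (RInt (fun x => f x y) s a))).
        { exists (mkposreal y ltac:(lra)). intros v Hv. apply Rabs_def2 in Hv. simpl in Hv.
          unfold minus, plus, opp in Hv; simpl in Hv. 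
          apply (@opp_RInt_swap R_CompleteNormedModule). apply Ix. lra. }
        apply (@continuous_opp R_UniformSpace R_AbsRing R_NormedModule (fun y : R => RInt (fun x => f x y) s a)).
        apply (RInt_param_continuous (fun y x => f x y)); try lra.
        * intros x _. apply (continuity_2d_pt_swap f), Hf. lra.
        * exists (mkposreal y ltac:(lra)). intros v Hv. apply Rabs_def2 in Hv. simpl in Hv.
          unfold minus, plus, opp in Hv; simpl in Hv. apply Ix. lra. }
  assert (R1 := is_RInt_derive G V a b (fun t _ => HG t) (fun t _ => HV t)).
  apply is_RInt_unique in R1. fold V. rewrite R1.
  unfold G at 2. rewrite (RInt_ext (fun y => RInt (fun x => f x y) a a) (fun _ => 0)).
  - rewrite RInt_const. unfold minus, plus, opp, scal; simpl. unfold mult; simpl. 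
    unfold G. ring.
  - intros y _. apply (@RInt_point R_CompleteNormedModule).
Qed.

(** * Interior estimates for Hardy functions *)

Lemma ccont_Cmod_2d g x y : ccont g (x, y) -> continuity_2d_pt (fun u v => Cmod (g (u, v))) x y.
Proof.
  intros H [eps He]. destruct (H eps He) as [d [Hd Hw]].
  exists (mkposreal (d / 2) ltac:(lra)). simpl. intros u v Hu Hv.
  apply Rle_lt_trans with (Cmod (g (u, v) - g (x, y))%C).
  - apply Rabs_le.
    assert (T1 := Cmod_triangle (g (u, v) - g (x, y)) (g (x, y))).
    assert (T2 := Cmod_triangle (- (g (u, v) - g (x, y))) (g (u, v))).
    replace (g (u, v) - g (x, y) + g (x, y))%C with (g (u, v)) in T1 by ring.
    replace (- (g (u, v) - g (x, y)) + g (u, v))%C with (g (x, y)) in T2 by ring.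
    rewrite Cmod_opp in T2. split; lra.
  - apply Hw. eapply Rle_lt_trans; [apply Cmod_le_sum|]. simpl. unfold Rminus in Hu, Hv. lra.
Qed.

Lemma ccont_rpow_2d g p x y : 0 < p -> ccont g (x, y) ->
  continuity_2d_pt (fun u v => rpow (Cmod (g (u, v))) p) x y.
Proof.
  intros Hp H. apply (continuity_1d_2d_pt_comp (fun t => rpow t p) (fun u v => Cmod (g (u, v)))).
  - apply continuity_pt_filterlim. exact (continuous_rpow _ _ Hp).
  - apply ccont_Cmod_2d; auto.
Qed.

Lemma ccont_bounded_rect g a b c d : a <= b -> c <= d -> on_rect a b c d (ccont g) ->
  exists M, on_rect a b c d (fun z => Cmod (g z) <= M).
Proof.
  intros Hab Hcd Hg.
  apply (rect_bisection (fun a b c d => exists M, on_rect a b c d (fun z => Cmod (g z) <= M)) a b c d); auto.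
  - intros a' b' c' d' _ _ [M1 H1] [M2 H2] [M3 H3] [M4 H4].
    exists (Rmax (Rmax M1 M2) (Rmax M3 M4)). intros x y Hx Hy.
    destruct (Rle_or_lt x ((a' + b') / 2)) as [X|X]; destruct (Rle_or_lt y ((c' + d') / 2)) as [Y|Y].
    + eapply Rle_trans; [apply H1; lra|]. eapply Rle_trans; apply Rmax_l.
    + eapply Rle_trans; [apply H3; lra|]. eapply Rle_trans; [apply Rmax_l|apply Rmax_r].
    + eapply Rle_trans; [apply H2; lra|]. eapply Rle_trans; [apply Rmax_r|apply Rmax_l].
    + eapply Rle_trans; [apply H4; lra|]. eapply Rle_trans; apply Rmax_r.
  - intros x y Hx Hy. destruct (Hg x y Hx Hy 1 Rlt_0_1) as [del [Hd Hw]].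
    exists (del / 2); split; [lra|]. intros a' b' c' d' ? ? ? ? ? ? ? ?.
    exists (1 + Cmod (g (x, y))). intros u v Hu Hv.
    assert (D : Cmod ((u, v) - (x, y))%C < del).
    { eapply Rle_lt_trans; [apply (rect_dist a' b' c' d'); lra|]. lra. }
    specialize (Hw _ D).
    assert (T1 := Cmod_triangle (g (u, v) - g (x, y)) (g (x, y))).
    replace (g (u, v) - g (x, y) + g (x, y))%C with (g (u, v)) in T1 by ring. lra.
Qed.

(** The point nearly maximizes u times the distance to the boundary of the square, up to a factor 2.
    Within half of its distance d1 this distance stays at least d1/2, which costs a second factor 2.
    The resulting comparability of u is a substitute for subharmonicity of |F|^p. *)
Lemma near_maximizer (u : R -> R -> R) (x0 y0 r M : R) : 0 < r ->
  (forall x y, 0 <= u x y) ->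
  (forall x y, Rabs (x - x0) <= r -> Rabs (y - y0) <= r -> u x y <= M) -> 0 < u x0 y0 ->
  exists x1 y1 d1, 0 < d1 /\ d1 <= r /\ Rabs (x1 - x0) <= r - d1 /\ Rabs (y1 - y0) <= r - d1 /\
    u x0 y0 * r <= 2 * (u x1 y1 * d1) /\
    forall x y, Rabs (x - x1) <= d1 / 2 -> Rabs (y - y1) <= d1 / 2 -> u x y <= 4 * u x1 y1.
Proof.
  intros Hr Hu HM H0.
  set (d := fun x y => r - Rmax (Rabs (x - x0)) (Rabs (y - y0))).
  assert (Hd : forall x y, d x y <= r).
  { intros x y. unfold d. assert (H := Rabs_pos (x - x0)).
    assert (H' := Rmax_l (Rabs (x - x0)) (Rabs (y - y0))). lra. }
  destruct (completeness (fun v => exists x y, Rabs (x - x0) <= r /\ Rabs (y - y0) <= r /\ v = u x y * d x y)) as [Phi [HP1 HP2]].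
  { exists (M * r). intros v (x & y & Hx & Hy & ->).
    assert (u x y <= M) by auto. specialize (Hd x y). specialize (Hu x y).
    apply Rle_trans with (u x y * r); [apply Rmult_le_compat_l; auto|apply Rmult_le_compat_r; lra]. }
  { exists (u x0 y0 * d x0 y0), x0, y0. rewrite !Rminus_diag, Rabs_R0. repeat split; lra. }
  assert (HP0 : u x0 y0 * r <= Phi).
  { apply HP1. exists x0, y0. unfold d. rewrite !Rminus_diag, Rabs_R0, Rmax_left by lra. repeat split; lra. }
  assert (HPp : 0 < Phi) by nra.
  assert (exists x y, Rabs (x - x0) <= r /\ Rabs (y - y0) <= r /\ Phi / 2 < u x y * d x y) as (x1 & y1 & Hx1 & Hy1 & Hv).
  { apply NNPP. intros N. apply (Rlt_irrefl Phi). apply Rle_lt_trans with (Phi / 2); [|lra].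
    apply HP2. intros v (x & y & Hx & Hy & ->). apply Rnot_lt_le. intros L. apply N. eauto. }
  assert (Hu1 := Hu x1 y1).
  assert (Hd1 : 0 < d x1 y1) by nra.
  assert (Dx : forall x y, Rabs (x - x0) <= r - d x y /\ Rabs (y - y0) <= r - d x y).
  { intros x y. unfold d. split; ring_simplify; [apply Rmax_l|apply Rmax_r]. }
  exists x1, y1, (d x1 y1). repeat split; auto; try apply Dx; [lra|].
  intros x y Hx Hy. destruct (Dx x1 y1) as [D1 D2].
  assert (E1 : Rabs (x - x0) <= r - d x1 y1 / 2).
  { replace (x - x0) with ((x - x1) + (x1 - x0)) by ring. eapply Rle_trans; [apply Rabs_triang|]. lra. }
  assert (E2 : Rabs (y - y0) <= r - d x1 y1 / 2).
  { replace (y - y0) with ((y - y1) + (y1 - y0)) by ring. eapply Rle_trans; [apply Rabs_triang|]. lra. }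
  assert (E3 : d x1 y1 / 2 <= d x y).
  { unfold d at 2. assert (Rmax (Rabs (x - x0)) (Rabs (y - y0)) <= r - d x1 y1 / 2) by (apply Rmax_lub; auto). lra. }
  assert (E4 : u x y * d x y <= Phi).
  { apply HP1. exists x, y. repeat split; lra. }
  specialize (Hu x y).
  apply Rmult_le_reg_r with (d x1 y1 / 2); [lra|]. nra.
Qed.

Lemma RInt_sub_le (f : R -> R) a b a' b' : a <= a' -> a' <= b' -> b' <= b ->
  (forall x, a <= x <= b -> continuous f x) -> (forall x, 0 <= f x) -> RInt f a' b' <= RInt f a b.
Proof.
  intros Ha Hab Hb Hc Hf.
  assert (I : forall u v, a <= u -> u <= v -> v <= b -> ex_RInt f u v).
  { intros u v ? ? ?. apply (@ex_RInt_continuous R_CompleteNormedModule). intros t.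
    rewrite Rmin_left, Rmax_right by lra. intros; apply Hc; lra. }
  rewrite <- (@RInt_Chasles R_CompleteNormedModule f a a' b) by (apply I; lra).
  rewrite <- (@RInt_Chasles R_CompleteNormedModule f a' b' b) by (apply I; lra).
  unfold plus; simpl.
  assert (0 <= RInt f a a') by (apply RInt_ge_0; auto; apply I; lra).
  assert (0 <= RInt f b' b) by (apply RInt_ge_0; auto; apply I; lra).
  lra.
Qed.

(* Cauchy's estimate for F^n, with |F|^n = |F|^p |F|^(n-p) and the last factor bounded by the
   near-maximality of (x1, y1): this covers all p > 0, including p < 1. *)
Lemma local_power_mean (F : C -> C) p n x1 y1 d1 s : 0 < p -> p < INR n -> 0 < s -> s <= d1 / 2 ->
  0 < Cmod (F (x1, y1)) ->
  on_rect (x1 - s) (x1 + s) (y1 - s) (y1 + s) (C_holo_at F) ->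
  (forall x y, Rabs (x - x1) <= d1 / 2 -> Rabs (y - y1) <= d1 / 2 ->
     rpow (Cmod (F (x, y))) p <= 4 * rpow (Cmod (F (x1, y1))) p) ->
  rpow (Cmod (F (x1, y1))) p * (2 / 5 * s) <=
   rpow 4 ((INR n - p) / p) *
   (RInt (fun x => rpow (Cmod (F (x, y1 - s))) p) (x1 - s) (x1 + s)
    + RInt (fun y => rpow (Cmod (F (x1 + s, y))) p) (y1 - s) (y1 + s)
    + RInt (fun x => rpow (Cmod (F (x, y1 + s))) p) (x1 - s) (x1 + s)
    + RInt (fun y => rpow (Cmod (F (x1 - s, y))) p) (y1 - s) (y1 + s)).
Proof.
  intros Hp Hn Hs Hsd H0 Hg Hmax.
  (* The exponent is chosen so that |F|^n = u u^e; the factor u(z1)^e then appears on both sides of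
     the estimate and cancels at the end. *)
  set (u := fun z : C => rpow (Cmod (F z)) p). set (e := (INR n - p) / p).
  assert (He : 0 < e) by (apply Rdiv_lt_0_compat; lra).
  assert (Hn0 : (0 < n)%nat) by (apply INR_lt; simpl; lra).
  set (z1 := (x1, y1) : C).
  assert (Hu0 : forall z, 0 <= u z) by (intros; apply rpow_ge_0).
  assert (Hu1 : 0 < u z1) by (apply rpow_gt_0; auto).
  assert (Hpow : forall z, Cmod (F z ^ n)%C = u z * rpow (u z) e).
  { intros z. rewrite Cmod_pow. rewrite <- rpow_INR by (auto; apply Cmod_ge_0).
    unfold u. rewrite rpow_rpow, <- rpow_plus. f_equal. unfold e. field. lra. }
  set (A := rpow 4 e * rpow (u z1) e).
  assert (HA : 0 < rpow (u z1) e) by (apply rpow_gt_0; auto).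
  assert (HF : forall x y, Rabs (x - x1) <= d1 / 2 -> Rabs (y - y1) <= d1 / 2 ->
    Cmod (F (x, y) ^ n)%C <= A * u (x, y)).
  { intros x y Hx Hy. rewrite Hpow, Rmult_comm. apply Rmult_le_compat_r; auto.
    unfold A. rewrite <- rpow_mult_distr by (auto; lra). apply rpow_le; [lra|]. apply Hmax; auto. }
  assert (Hgn : on_rect (x1 - s) (x1 + s) (y1 - s) (y1 + s) (C_holo_at (fun z : C => F z ^ n)%C)).
  { intros x y ? ?. apply C_holo_pow, Hg; auto. }
  assert (B := cauchy_estimate_rect (fun z : C => F z ^ n)%C (x1 - s) (x1 + s) (y1 - s) (y1 + s) x1 y1 s Hs ltac:(lra) ltac:(lra) Hgn).
  cbv beta in B.
  replace (x1 + s - (x1 - s)) with (2 * s) in B by ring.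
  replace (y1 - (y1 - s)) with s in B by ring.
  replace (2 * s * s / ((2 * s) ^ 2 + s ^ 2)) with (2 / 5) in B by (field; nra).
  fold z1 in B. rewrite Hpow in B.
  change (forall x y, Rabs (x - x1) <= d1 / 2 -> Rabs (y - y1) <= d1 / 2 ->
    Cmod (F (x, y) ^ n)%C <= A * u (x, y)) in HF.
  assert (Hc : forall x y, x1 - s <= x <= x1 + s -> y1 - s <= y <= y1 + s ->
     continuous (fun t => u (t, y)) x /\ continuous (fun t => u (x, t)) y).
  { intros x y ? ?. assert (C2 := ccont_rpow_2d F p x y Hp (holo_ccont _ _ (Hg x y ltac:(lra) ltac:(lra)))).
    split; [exact (continuity_2d_pt_continuous_l _ _ _ C2)|exact (continuity_2d_pt_continuous_l _ _ _ (continuity_2d_pt_swap _ _ _ C2))]. }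
  assert (Ih : forall y, y1 - s <= y <= y1 + s -> 
    RInt (fun x => Cmod (F (x, y) ^ n)%C) (x1 - s) (x1 + s) <= A * RInt (fun x => u (x, y)) (x1 - s) (x1 + s)).
  { intros y Hy.
    assert (E : ex_RInt (fun x => u (x, y)) (x1 - s) (x1 + s)).
    { apply (@ex_RInt_continuous R_CompleteNormedModule). intros t. rewrite Rmin_left, Rmax_right by lra.
      intros. apply Hc; lra. }
    rewrite <- RInt_Rscal by exact E. apply RInt_le; try lra.
    - apply (ex_RInt_hline_Cmod (fun z : C => F z ^ n)%C); [lra|]. intros; apply holo_ccont, Hgn; lra.
    - apply ex_RInt_Rscal; exact E.
    - intros x Hx. apply HF; apply Rabs_le; lra. }
  assert (Iv : forall x, x1 - s <= x <= x1 + s -> 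
    RInt (fun y => Cmod (F (x, y) ^ n)%C) (y1 - s) (y1 + s) <= A * RInt (fun y => u (x, y)) (y1 - s) (y1 + s)).
  { intros x Hx.
    assert (E : ex_RInt (fun y => u (x, y)) (y1 - s) (y1 + s)).
    { apply (@ex_RInt_continuous R_CompleteNormedModule). intros t. rewrite Rmin_left, Rmax_right by lra.
      intros. apply Hc; lra. }
    rewrite <- RInt_Rscal by exact E. apply RInt_le; try lra.
    - apply (ex_RInt_vline_Cmod (fun z : C => F z ^ n)%C); [lra|]. intros; apply holo_ccont, Hgn; lra.
    - apply ex_RInt_Rscal; exact E.
    - intros y Hy. apply HF; apply Rabs_le; lra. }
  unfold sides_int in B.
  assert (I1 := Ih (y1 - s) ltac:(lra)). assert (I2 := Ih (y1 + s) ltac:(lra)).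
  assert (I3 := Iv (x1 - s) ltac:(lra)). assert (I4 := Iv (x1 + s) ltac:(lra)).
  fold (u z1).
  change (u z1 * (2 / 5 * s) <= rpow 4 e *
    (RInt (fun x => u (x, y1 - s)) (x1 - s) (x1 + s) + RInt (fun y => u (x1 + s, y)) (y1 - s) (y1 + s)
    + RInt (fun x => u (x, y1 + s)) (x1 - s) (x1 + s) + RInt (fun y => u (x1 - s, y)) (y1 - s) (y1 + s))).
  apply Rmult_le_compat_l with (r := s) in B; [|lra].
  rewrite <- (Rmult_assoc s (/ s)), Rinv_r, Rmult_1_l in B by lra.
  unfold A in *.
  apply Rmult_le_reg_l with (rpow (u z1) e); auto.
  nra.
Qed.

(** The hypothesis controls the horizontal sides of a square but not the vertical ones. Averaging
    over the half-side s in [d1/4, d1/2] turns the vertical integrals into area integrals, and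
    exchanging the order bounds these by d1 B. *)
Lemma hardy_interior_bound (F : C -> C) p B : 0 < p ->
  (forall z, upper z -> C_holo_at F z) ->
  (forall y a b, 0 < y -> a <= b -> RInt (fun x => rpow (Cmod (F (x, y))) p) a b <= B) ->
  exists C0, forall x y, 0 < y -> rpow (Cmod (F (x, y))) p * y <= C0.
Proof.
  intros Hp Hg HB.
  set (u := fun x y => rpow (Cmod (F (x, y))) p).
  assert (Hu : forall x y, 0 <= u x y) by (intros; apply rpow_ge_0).
  assert (HB0 : 0 <= B).
  { generalize (HB 1 0 0 ltac:(lra) ltac:(lra)). rewrite RInt_point. exact (fun h => h). }
  destruct (INR_unbounded p) as [n Hn].
  set (k := rpow 4 ((INR n - p) / p)).
  assert (Hk : 0 < k) by (apply rpow_gt_0; lra).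
  (* The average gives u(x1, y1) d1 <= 100 k B; near-maximality (factor 2) and y0 = 2r (factor 2)
     give 400. *)
  exists (400 * k * B). intros x0 y0 Hy0. change (u x0 y0 * y0 <= 400 * k * B).
  destruct (Rle_or_lt (u x0 y0) 0) as [Hz|Hz]; [nra|].
  set (r := y0 / 2). assert (Hr : 0 < r) by (unfold r; lra).
  destruct (ccont_bounded_rect F (x0 - r) (x0 + r) (y0 - r) (y0 + r)) as [M HM]; try lra.
  { intros x y ? ?. apply holo_ccont, Hg. unfold upper; simpl. unfold r in *; lra. }
  destruct (near_maximizer u x0 y0 r (rpow M p)) as (x1 & y1 & d1 & Hd1 & Hdr & Hx1 & Hy1 & Hv & Hmax); auto.
  { intros x y Hx Hy. apply Rabs_le_between in Hx, Hy. apply rpow_le; [lra|]. apply HM; lra. }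
  assert (Hu1 : 0 < u x1 y1) by nra.
  assert (HF1 : 0 < Cmod (F (x1, y1))).
  { destruct (Rle_or_lt (Cmod (F (x1, y1))) 0) as [H|H]; auto.
    unfold u in Hu1. rewrite rpow_0 in Hu1; lra. }
  apply Rabs_le_between in Hx1, Hy1.
  assert (Hy1' : d1 < y1) by (unfold r in *; lra).
  assert (Hc2 : forall x y, 0 < y -> continuity_2d_pt u x y).
  { intros x y Hy. apply ccont_rpow_2d; auto. apply holo_ccont, Hg. exact Hy. }
  assert (Hcx : forall x y, 0 < y -> continuous (fun t => u t y) x).
  { intros; apply continuity_2d_pt_continuous_l; auto. }
  assert (Hcy : forall x y, 0 < y -> continuous (fun t => u x t) y).
  { intros x y Hy; exact (continuity_2d_pt_continuous_l _ _ _ (continuity_2d_pt_swap _ _ _ (Hc2 x y Hy))). }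
  set (V := fun x => RInt (u x) (y1 - d1 / 2) (y1 + d1 / 2)).
  assert (HVc : forall x, continuous V x).
  { intros x. apply (RInt_param_continuous u); try lra.
    - intros y Hy. apply Hc2; lra.
    - apply filter_forall. intros t. apply (@ex_RInt_continuous R_CompleteNormedModule).
      intros y. rewrite Rmin_left by lra. intros; apply Hcy; lra. }
  assert (HVi : forall a b, ex_RInt V a b).
  { intros. apply (@ex_RInt_continuous R_CompleteNormedModule). auto. }
  assert (HVB : forall a b, a <= b -> RInt V a b <= d1 * B).
  { intros a b Hab. unfold V. rewrite RInt_swap_upper; auto; try lra.
    replace (d1 * B) with (RInt (fun _ => B) (y1 - d1 / 2) (y1 + d1 / 2)).
    2:{ rewrite RInt_const. unfold scal; simpl; unfold mult; simpl. field. }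
    apply RInt_le; try lra.
    - apply (@ex_RInt_continuous R_CompleteNormedModule). intros y. rewrite Rmin_left, Rmax_right by lra. intros Hy.
      apply (RInt_param_continuous (fun y x => u x y)); auto.
      + intros t _. apply (continuity_2d_pt_swap u). apply Hc2; lra.
      + exists (mkposreal y ltac:(lra)). intros v Hv'. apply Rabs_def2 in Hv'. simpl in Hv'.
        unfold minus, plus, opp in Hv'; simpl in Hv'. 
        apply (@ex_RInt_continuous R_CompleteNormedModule). intros; apply Hcx; lra.
    - apply ex_RInt_const.
    - intros y Hy. apply HB; lra. }
  set (c := 2 / 5 * u x1 y1 * (d1 / 4) - k * (2 * B)).
  assert (Hs : forall s, d1 / 4 <= s <= d1 / 2 -> c <= k * (V (x1 + s) + V (x1 - s))).
  { intros s Hs.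
    assert (L := local_power_mean F p n x1 y1 d1 s Hp Hn ltac:(lra) ltac:(lra) HF1).
    assert (L' := L ltac:(intros x y ? ?; apply Hg; unfold upper; simpl; lra) Hmax). clear L.
    fold k in L'.
    change (u x1 y1 * (2 / 5 * s) <= k * (RInt (fun x => u x (y1 - s)) (x1 - s) (x1 + s) 
       + RInt (u (x1 + s)) (y1 - s) (y1 + s) + RInt (fun x => u x (y1 + s)) (x1 - s) (x1 + s) 
       + RInt (u (x1 - s)) (y1 - s) (y1 + s))) in L'.
    assert (B1 := HB (y1 - s) (x1 - s) (x1 + s) ltac:(lra) ltac:(lra)).
    assert (B2 := HB (y1 + s) (x1 - s) (x1 + s) ltac:(lra) ltac:(lra)).
    change (RInt (fun x => u x (y1 - s)) (x1 - s) (x1 + s) <= B) in B1.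
    change (RInt (fun x => u x (y1 + s)) (x1 - s) (x1 + s) <= B) in B2.
    assert (V1 : RInt (u (x1 + s)) (y1 - s) (y1 + s) <= V (x1 + s)).
    { apply RInt_sub_le; auto; try lra. intros; apply Hcy; lra. }
    assert (V2 : RInt (u (x1 - s)) (y1 - s) (y1 + s) <= V (x1 - s)).
    { apply RInt_sub_le; auto; try lra. intros; apply Hcy; lra. }
    assert (T : k * (RInt (fun x => u x (y1 - s)) (x1 - s) (x1 + s) 
       + RInt (u (x1 + s)) (y1 - s) (y1 + s) + RInt (fun x => u x (y1 + s)) (x1 - s) (x1 + s) 
       + RInt (u (x1 - s)) (y1 - s) (y1 + s)) <= k * (2 * B + (V (x1 + s) + V (x1 - s)))).
    { apply Rmult_le_compat_l; lra. }
    unfold c. nra. }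
  (* The shape required by affine substitution: [V2] is minus V(x1 - s), hence the factors -1
     below. *)
  set (V1 := fun s => scal 1 (V (1 * s + x1))). set (V2 := fun s => scal (-1) (V (-1 * s + x1))).
  assert (E1 : ex_RInt V1 (d1 / 4) (d1 / 2)) by (apply (@ex_RInt_comp_lin R_NormedModule V), HVi).
  assert (E2 : ex_RInt V2 (d1 / 4) (d1 / 2)) by (apply (@ex_RInt_comp_lin R_NormedModule V), HVi).
  assert (F1 : RInt V1 (d1 / 4) (d1 / 2) <= d1 * B).
  { unfold V1. rewrite (@RInt_comp_lin R_CompleteNormedModule V) by apply HVi. apply HVB. lra. }
  assert (F2 : - RInt V2 (d1 / 4) (d1 / 2) <= d1 * B).
  { unfold V2. rewrite (@RInt_comp_lin R_CompleteNormedModule V) by apply HVi.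
    rewrite <- (@opp_RInt_swap R_CompleteNormedModule V) by apply HVi. 
    unfold opp; simpl. rewrite Ropp_involutive. apply HVB. lra. }
  assert (G : c * (d1 / 4) <= k * (RInt V1 (d1 / 4) (d1 / 2) + -1 * RInt V2 (d1 / 4) (d1 / 2))).
  { rewrite <- (RInt_Rscal (-1) V2) by auto.
    rewrite <- RInt_Rplus by (auto; apply ex_RInt_Rscal; auto).
    rewrite <- RInt_Rscal by (apply (@ex_RInt_plus R_NormedModule); auto; apply ex_RInt_Rscal; auto).
    replace (c * (d1 / 4)) with (RInt (fun _ => c) (d1 / 4) (d1 / 2)).
    2:{ rewrite RInt_const. unfold scal; simpl; unfold mult; simpl. field. }
    apply RInt_le; try lra.
    - apply ex_RInt_const.
    - apply ex_RInt_Rscal, (@ex_RInt_plus R_NormedModule); auto; apply ex_RInt_Rscal; auto.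
    - intros s Hs'. unfold V1, V2, scal; simpl; unfold mult; simpl.
      replace (1 * V (1 * s + x1) + -1 * (-1 * V (-1 * s + x1))) with (V (x1 + s) + V (x1 - s)).
      + apply Hs; lra.
      + replace (1 * s + x1) with (x1 + s) by ring. replace (-1 * s + x1) with (x1 - s) by ring. ring. }
  assert (G' : c * (d1 / 4) <= k * (2 * (d1 * B))).
  { eapply Rle_trans; [apply G|]. apply Rmult_le_compat_l; lra. }
  unfold c in G'.
  assert (G2 : 2 / 5 * u x1 y1 * (d1 / 4) - k * (2 * B) <= 8 * (k * B)).
  { apply Rmult_le_reg_r with (d1 / 4); [lra|]. nra. }
  unfold r in Hv. nra.
Qed.

(** * Boundary behaviour across the real axis *)

Lemma is_derive_R_eps (f : R -> R) (x l : R) :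
  (forall eps, 0 < eps -> exists del, 0 < del /\ forall y, Rabs (y - x) < del ->
     Rabs (f y - f x - l * (y - x)) <= eps * Rabs (y - x)) -> is_derive f x l.
Proof.
  intros H. split; [apply is_linear_scal_l|].
  intros z Hz. rewrite <- (is_filter_lim_locally_unique x z Hz). clear z Hz.
  intros [eps He]. destruct (H eps He) as [d [Hd Hw]].
  exists (mkposreal d Hd). intros y Hy.
  specialize (Hw y Hy). rewrite (Rmult_comm l) in Hw. exact Hw.
Qed.

Lemma is_derive_hline g x y l : @is_derive C_AbsRing C_NormedModule g (x, y) l ->
  is_derive (fun t : R => Re (g (t, y))) x (Re l) /\ is_derive (fun t : R => Im (g (t, y))) x (Im l).
Proof.
  intros H.
  assert (K : forall eps, 0 < eps -> exists del, 0 < del /\ forall t, Rabs (t - x) < del ->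
     Cmod (g (t, y) - g (x, y) - l * RtoC (t - x))%C <= eps * Rabs (t - x)).
  { intros eps He. destruct (proj1 (is_derive_C_eps _ _ _) H eps He) as [d [Hd Hw]].
    exists d; split; auto. intros t Ht.
    assert (E : ((t, y) - (x, y))%C = RtoC (t - x))
      by (unfold RtoC, Cminus, Cplus, Copp; simpl; f_equal; ring).
    specialize (Hw (t, y)). rewrite E, Cmod_R in Hw. auto. }
  split; apply is_derive_R_eps; intros eps He; destruct (K eps He) as [d [Hd Hw]]; exists d; split; auto;
    intros t Ht; eapply Rle_trans; try apply (Hw t Ht).
  - eapply Rle_trans; [|apply re_le_Cmod]. right; apply f_equal; unfold Re, Im; simpl; ring.
  - eapply Rle_trans; [|apply im_le_Cmod]. right; apply f_equal; unfold Re, Im; simpl; ring.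
Qed.

Lemma is_derive_vline g x y l : @is_derive C_AbsRing C_NormedModule g (x, y) l ->
  is_derive (fun t : R => Re (g (x, t))) y (- Im l) /\ is_derive (fun t : R => Im (g (x, t))) y (Re l).
Proof.
  intros H.
  assert (K : forall eps, 0 < eps -> exists del, 0 < del /\ forall t, Rabs (t - y) < del ->
     Cmod (g (x, t) - g (x, y) - l * (Ci * RtoC (t - y)))%C <= eps * Rabs (t - y)).
  { intros eps He. destruct (proj1 (is_derive_C_eps _ _ _) H eps He) as [d [Hd Hw]].
    exists d; split; auto. intros t Ht.
    assert (E : ((x, t) - (x, y))%C = (Ci * RtoC (t - y))%C)
      by (unfold RtoC, Cminus, Cplus, Copp, Ci, Cmult; simpl; f_equal; ring).
    specialize (Hw (x, t)). rewrite E, Cmod_mult, Cmod_Ci, Cmod_R, Rmult_1_l in Hw. auto. }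
  split; apply is_derive_R_eps; intros eps He; destruct (K eps He) as [d [Hd Hw]]; exists d; split; auto;
    intros t Ht; eapply Rle_trans; try apply (Hw t Ht).
  - eapply Rle_trans; [|apply re_le_Cmod]. right; apply f_equal; unfold Re, Im; simpl; ring.
  - eapply Rle_trans; [|apply im_le_Cmod]. right; apply f_equal; unfold Re, Im; simpl; ring.
Qed.

(** The vertical derivative of g is i l, so that of |g|^2 is 2 Re (conj(g) i l). *)
Lemma is_derive_Cmod2_vline g x y l : @is_derive C_AbsRing C_NormedModule g (x, y) l ->
  is_derive (fun t : R => Cmod (g (x, t)) ^ 2) y (-2 * Im (Cconj (g (x, y)) * l)%C).
Proof.
  intros H. destruct (is_derive_vline _ _ _ _ H) as [H1 H2].
  apply (is_derive_ext (fun t : R => Re (g (x, t)) * Re (g (x, t)) + Im (g (x, t)) * Im (g (x, t)))).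
  { intros t. rewrite Cmod2_alt. unfold Re, Im; simpl; ring. }
  replace (-2 * Im (Cconj (g (x, y)) * l)%C)
    with ((- Im l * Re (g (x, y)) + Re (g (x, y)) * - Im l) + (Re l * Im (g (x, y)) + Im (g (x, y)) * Re l))
    by (unfold Re, Im; simpl; ring).
  apply (is_derive_plus (fun t : R => Re (g (x, t)) * Re (g (x, t))) (fun t : R => Im (g (x, t)) * Im (g (x, t)))).
  - apply (Derive.is_derive_mult (fun t : R => Re (g (x, t))) (fun t : R => Re (g (x, t)))); auto.
  - apply (Derive.is_derive_mult (fun t : R => Im (g (x, t))) (fun t : R => Im (g (x, t)))); auto.
Qed.

Lemma derive_ge_0_right (f : R -> R) (l del : R) : 0 < del -> is_derive f 0 l -> f 0 = 0 ->
  (forall y, 0 < y < del -> 0 <= f y) -> 0 <= l.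
Proof.
  intros Hd H H0 Hf. apply Rnot_lt_le. intros Hl.
  apply is_derive_Reals in H. destruct (H (- l / 2)) as [[d Hd'] Hh]; [lra|]. simpl in Hh.
  set (y := Rmin d del / 2).
  assert (Hm : 0 < Rmin d del) by (apply Rmin_pos; auto).
  assert (Hy : 0 < y < del) by (unfold y; generalize (Rmin_r d del); lra).
  assert (Hy2 : y < d) by (unfold y; generalize (Rmin_l d del); lra).
  specialize (Hh y ltac:(lra)). rewrite Rabs_pos_eq in Hh by lra. specialize (Hh Hy2).
  rewrite Rplus_0_l, H0, Rminus_0_r in Hh. apply Rabs_def2 in Hh.
  assert (0 <= f y / y) by (apply Rdiv_le_0_compat; [apply Hf; auto|lra]). lra.
Qed.

Lemma hb_nonzero E : hermite_biehler E -> (forall x : R, E (RtoC x) <> RtoC 0) ->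
  forall z, 0 <= Im z -> E z <> RtoC 0.
Proof.
  intros [_ H] H0 [x y] Hy. simpl in Hy. destruct Hy as [Hy| <-]; [|apply H0].
  apply (Cmod_gt_neq_0 _ (Cmod (E (Cconj (x, y))))); [apply Cmod_ge_0|]. apply H. exact Hy.
Qed.

Lemma Cconj_R (x : R) : Cconj (RtoC x) = RtoC x.
Proof. unfold Cconj, RtoC; simpl. f_equal; ring. Qed.

(** In other words phi' = -2 (arg E)'. The proof differentiates conj(E) = e^{i phi} E componentwise,
    so no branch of the argument is chosen. With the formula for the vertical derivative, this says
    that log |E|^2 has y-derivative phi' on the axis. *)
Lemma phase_derivative E phi x l : (forall x : R, E (RtoC x) <> RtoC 0) -> phase_function E phi ->
  @is_derive C_AbsRing C_NormedModule E (RtoC x) l ->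
  -2 * Im (Cconj (E (RtoC x)) * l)%C = Cmod (E (RtoC x)) ^ 2 * Derive phi x.
Proof.
  intros H0 [Hs Hphi] Hl.
  set (a := fun t : R => Re (E (RtoC t))). set (b := fun t : R => Im (E (RtoC t))).
  assert (Hp : is_derive phi x (Derive phi x)).
  { apply Derive_correct. exact (Hs 1%nat x). }
  destruct (is_derive_hline _ _ _ _ Hl) as [Ha Hb].
  change (is_derive a x (Re l)) in Ha. change (is_derive b x (Im l)) in Hb.
  assert (Hab : forall t, a t = cos (phi t) * a t - sin (phi t) * b t /\
     - b t = cos (phi t) * b t + sin (phi t) * a t).
  { intros t. specialize (Hphi t). unfold sharp in Hphi. rewrite Cconj_R in Hphi.
    assert (K : Cconj (E (RtoC t)) = ((cos (phi t), sin (phi t)) * E (RtoC t))%C).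
    { rewrite <- Hphi. field. apply H0. }
    unfold a, b. destruct (E (RtoC t)) as [u v]. unfold Cconj, Cmult in K; simpl in K.
    injection K; simpl; intros; split; lra. }
  assert (Hc : is_derive (fun t => cos (phi t)) x (Derive phi x * - sin (phi x))).
  { apply (is_derive_comp cos phi); auto. apply is_derive_cos. }
  assert (Hsn : is_derive (fun t => sin (phi t)) x (Derive phi x * cos (phi x))).
  { apply (is_derive_comp sin phi); auto. apply is_derive_sin. }
  assert (D1 : Re l = ((Derive phi x * - sin (phi x)) * a x + cos (phi x) * Re l)
                      - ((Derive phi x * cos (phi x)) * b x + sin (phi x) * Im l)).
  { assert (Ha' := is_derive_unique a _ _ Ha). rewrite <- Ha' at 1. apply is_derive_unique.
    apply (is_derive_ext (fun t => cos (phi t) * a t - sin (phi t) * b t)); [intros; symmetry; apply Hab|].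
    apply (is_derive_minus (fun t => cos (phi t) * a t) (fun t => sin (phi t) * b t)).
    - apply (Derive.is_derive_mult (fun t => cos (phi t)) a); auto.
    - apply (Derive.is_derive_mult (fun t => sin (phi t)) b); auto. }
  assert (D2 : - Im l = ((Derive phi x * - sin (phi x)) * b x + cos (phi x) * Im l)
                      + ((Derive phi x * cos (phi x)) * a x + sin (phi x) * Re l)).
  { assert (Hb' : is_derive (fun t => - b t) x (- Im l)) by exact (is_derive_opp b x _ Hb).
    apply is_derive_unique in Hb'. rewrite <- Hb' at 1. apply is_derive_unique.
    apply (is_derive_ext (fun t => cos (phi t) * b t + sin (phi t) * a t)); [intros; symmetry; apply Hab|].
    apply (is_derive_plus (fun t => cos (phi t) * b t) (fun t => sin (phi t) * a t)).
    - apply (Derive.is_derive_mult (fun t => cos (phi t)) b); auto.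
    - apply (Derive.is_derive_mult (fun t => sin (phi t)) a); auto. }
  destruct (Hab x) as [A1' A2'].
  rewrite Cmod2_alt. change (Re (E (RtoC x))) with (a x). change (Im (E (RtoC x))) with (b x).
  replace (Im (Cconj (E (RtoC x)) * l)%C) with (a x * Im l - b x * Re l) by (unfold a, b, Re, Im; simpl; ring).
  revert D1 D2 A1' A2'. generalize (a x) (b x) (Re l) (Im l) (Derive phi x) (cos (phi x)) (sin (phi x)).
  clear. intros a b a' b' d c s D1 D2 A B.
  assert (E1 : d * b = a' - a' * c + b' * s).
  { transitivity (- d * (c * b + s * a)); [rewrite <- B; ring|lra]. }
  assert (E2 : d * a = - b' - b' * c - a' * s).
  { transitivity (d * (c * a - s * b)); [rewrite <- A; ring|lra]. }
  transitivity (b * (d * b) + a * (d * a)); [|ring]. rewrite E1, E2.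
  replace (b * (a' - a' * c + b' * s) + a * (- b' - b' * c - a' * s))
    with (a' * (b - (c * b + s * a)) + b' * (- a - (c * a - s * b))) by ring.
  rewrite <- A, <- B. ring.
Qed.

(** The side on the real axis is left out, since no bound is available there beforehand. *)
Definition on_outer_sides (a b d : R) (P : C -> Prop) : Prop :=
  (forall x, a <= x <= b -> P (x, d)) /\ (forall y, 0 <= y <= d -> P (a, y) /\ P (b, y)).

Lemma Cmod_mult_div_le z w v b : v <> RtoC 0 -> (Cmod (z * w / v)%C <= b <-> Cmod z * Cmod w <= b * Cmod v).
Proof.
  intros H. rewrite Cmod_div, Cmod_mult by auto. symmetry.
  assert (Hp := proj1 (Cmod_gt_0 v) H). apply iff_sym, Rle_div_l; auto.
Qed.

(* An interior maximum m > b on the real segment is impossible: in the product of the values at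
   x1 + iy and x1 - iy the first-order terms of g cancel, and the y-derivative of
   log |z - x0 + i r| is at least 1/(2r) whereas that of log |E| is phi'/2. *)
Lemma strip_maximum E phi g M x0 r b : hermite_biehler E -> (forall x : R, E (RtoC x) <> RtoC 0) ->
  phase_function E phi -> (forall x, Rabs (Derive phi x) <= M) -> entire g -> 0 < r -> r * M < 1 -> 0 <= b ->
  let q := fun z => Cminus z (x0, - r) in
  on_outer_sides (x0 - r) (x0 + r) r (fun z => Cmod (g z * q z / E z)%C <= b) ->
  on_outer_sides (x0 - r) (x0 + r) r (fun z => Cmod (sharp g z * q z / E z)%C <= b) ->
  on_rect (x0 - r) (x0 + r) 0 r (fun z => Cmod (g z * q z / E z)%C <= b).
Proof.
  intros HE HE0 Hphi HM Hg Hr HrM Hb q [Ht Hv] [Ht' Hv'].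
  assert (HEn := hb_nonzero E HE HE0).
  assert (HhE : forall z, C_holo_at E z) by apply HE.
  assert (Hhq : forall z, C_holo_at q z).
  { intros z. apply (C_holo_minus (fun z => z) (fun _ => ((x0, - r) : C))); [apply C_holo_id|apply C_holo_const]. }
  assert (Hholo : forall f, entire f -> on_rect (x0 - r) (x0 + r) 0 r (C_holo_at (fun z => f z * q z / E z)%C)).
  { intros f Hf x y Hx Hy. apply (C_holo_div (fun z => f z * q z)%C E); auto.
    - apply C_holo_mult; auto.
    - apply HEn; simpl; lra. }
  (* The two quotients have equal moduli on the axis, so one maximum m serves for both. *)
  assert (Hreal : forall x, Cmod (sharp g (x, 0) * q (x, 0) / E (x, 0))%C = Cmod (g (x, 0) * q (x, 0) / E (x, 0))%C).
  { intros x. rewrite !Cmod_div, !Cmod_mult, Cmod_sharp by apply (HE0 x).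
    change ((x, 0) : C) with (RtoC x). rewrite Cconj_R. reflexivity. }
  set (u := fun x => Cmod (g (x, 0) * q (x, 0) / E (x, 0))%C).
  destruct (continuity_ab_maj u (x0 - r) (x0 + r)) as [x1 [Hmax Hx1]]; [lra| |].
  { intros x Hx. apply continuity_pt_filterlim.
    apply (ccont_hline (fun z => g z * q z / E z)%C). apply holo_ccont, Hholo; auto; lra. }
  set (m := u x1).
  assert (Hm0 : 0 <= m) by apply Cmod_ge_0.
  assert (Hmp : forall f B, entire f -> b <= B -> 0 <= B ->
     on_outer_sides (x0 - r) (x0 + r) r (fun z => Cmod (f z * q z / E z)%C <= b) ->
     (forall x, x0 - r <= x <= x0 + r -> Cmod (f (x, 0) * q (x, 0) / E (x, 0))%C <= B) ->
     on_rect (x0 - r) (x0 + r) 0 r (fun z => Cmod (f z * q z / E z)%C <= B)).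
  { intros f B Hf HbB HB [S1 S2] S3. apply max_principle_rect; auto; try lra. split.
    - intros x Hx. split; [apply S3; auto|]. eapply Rle_trans; [apply S1; auto|auto].
    - intros y Hy. destruct (S2 y Hy). split; lra. }
  destruct (Rle_or_lt m b) as [Hmb|Hmb].
  { apply Hmp; auto; try lra. { split; auto. } intros x Hx. eapply Rle_trans; [apply Hmax; auto|exact Hmb]. }
  exfalso.
  assert (K1 := Hmp g m Hg ltac:(lra) Hm0 (conj Ht Hv) Hmax).
  assert (K2 := Hmp (sharp g) m (entire_sharp g Hg) ltac:(lra) Hm0 (conj Ht' Hv')
     ltac:(intros x Hx; rewrite Hreal; apply Hmax; auto)).
  set (N := fun y => Cmod (g (x1, y)) ^ 2). set (D := fun y => Cmod (E (x1, y)) ^ 2).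
  set (Q := fun y => (x1 - x0) ^ 2 + (y + r) ^ 2).
  assert (HQ : forall y, Cmod (q (x1, y)) ^ 2 = Q y).
  { intros y. rewrite Cmod2_alt. unfold Q, q; simpl. ring. }
  assert (HNDQ : forall y, 0 <= y <= r -> N y * N (- y) * (Q y * Q y) <= m ^ 4 * (D y * D y)).
  { intros y Hy. assert (L1 := K1 x1 y Hx1 Hy). assert (L2 := K2 x1 y Hx1 Hy). cbv beta in L1, L2.
    assert (Hn : E (x1, y) <> RtoC 0) by (apply HEn; simpl; lra).
    apply (Cmod_mult_div_le _ _ _ _ Hn) in L1, L2. rewrite Cmod_sharp in L2.
    change (Cconj (x1, y)) with ((x1, - y) : C) in L2.
    rewrite <- HQ. unfold N, D.
    assert (P1 := Cmod_ge_0 (g (x1, y))). assert (P2 := Cmod_ge_0 (g (x1, - y))).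
    assert (P3 := Cmod_ge_0 (q (x1, y))). assert (P4 := Cmod_ge_0 (E (x1, y))).
    assert (L3 : (Cmod (g (x1, y)) * Cmod (q (x1, y))) * (Cmod (g (x1, - y)) * Cmod (q (x1, y))) <=
       (m * Cmod (E (x1, y))) * (m * Cmod (E (x1, y)))).
    { apply Rmult_le_compat; auto; apply Rmult_le_pos; auto. }
    apply Rle_trans with (((m * Cmod (E (x1, y))) * (m * Cmod (E (x1, y)))) ^ 2); [|right; ring].
    eapply Rle_trans; [|apply pow_incr; split; [|apply L3]].
    - right; ring.
    - repeat apply Rmult_le_pos; auto. }
  destruct (HhE (x1, 0)) as [lE HlE]. destruct (Hg (x1, 0)) as [lg Hlg].
  assert (DD := is_derive_Cmod2_vline _ _ _ _ HlE). assert (DN := is_derive_Cmod2_vline _ _ _ _ Hlg).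
  change ((x1, 0) : C) with (RtoC x1) in DD.
  rewrite (phase_derivative E phi x1 lE HE0 Hphi HlE) in DD.
  change (Cmod (E (RtoC x1)) ^ 2) with (D 0) in DD. change (is_derive D 0 (D 0 * Derive phi x1)) in DD.
  set (nn := -2 * Im (Cconj (g (x1, 0)) * lg)%C) in *. change (is_derive N 0 nn) in DN.
  assert (DN' : is_derive (fun y => N (- y)) 0 (-1 * nn)).
  { apply (is_derive_comp N (fun y => - y)); [rewrite Ropp_0; auto|]. auto_derive; auto. }
  assert (DQ : is_derive Q 0 (2 * r)).
  { unfold Q. auto_derive; auto. ring. }
  assert (HD0 : 0 < D 0) by (apply pow_lt, Cmod_gt_0, HE0).
  assert (HQ0 : 0 < Q 0) by (unfold Q; assert (H := pow2_ge_0 (x1 - x0)); nra).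
  assert (EQ : N 0 * Q 0 = m ^ 2 * D 0).
  { unfold m, u. rewrite Cmod_div, Cmod_mult by apply (HE0 x1).
    rewrite <- HQ. unfold N, D. field. change ((x1, 0) : C) with (RtoC x1). 
    apply Rgt_not_eq, Cmod_gt_0, HE0. }
  (* [HNDQ] is an equality at y = 0, so the difference of its sides has a nonnegative derivative
     there. N(y) N(-y) is even and contributes nothing, which leaves 2r/Q(0) <= phi'(x1). *)
  assert (Dp : 0 <= m ^ 4 * (D 0 * Derive phi x1 * D 0 + D 0 * (D 0 * Derive phi x1))
     - ((nn * N (- 0) + N 0 * (-1 * nn)) * (Q 0 * Q 0) + N 0 * N (- 0) * (2 * r * Q 0 + Q 0 * (2 * r)))).
  { apply (derive_ge_0_right (fun y => m ^ 4 * (D y * D y) - N y * N (- y) * (Q y * Q y)) _ r Hr).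
    - apply (is_derive_minus (fun y => m ^ 4 * (D y * D y)) (fun y => N y * N (- y) * (Q y * Q y))).
      + apply (is_derive_scal (fun y => D y * D y)). apply (Derive.is_derive_mult D D); auto.
      + apply (Derive.is_derive_mult (fun y => N y * N (- y)) (fun y => Q y * Q y)).
        * apply (Derive.is_derive_mult N (fun y => N (- y))); auto.
        * apply (Derive.is_derive_mult Q Q); auto.
    - rewrite Ropp_0. replace (N 0 * N 0 * (Q 0 * Q 0)) with ((N 0 * Q 0) * (N 0 * Q 0)) by ring.
      rewrite EQ. ring.
    - intros y Hy. specialize (HNDQ y ltac:(lra)). lra. }
  rewrite Ropp_0 in Dp.
  assert (Dq : 0 <= (m ^ 2 * D 0) ^ 2 * (Derive phi x1 - 2 * r / Q 0)).
  { replace ((m ^ 2 * D 0) ^ 2 * (Derive phi x1 - 2 * r / Q 0))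
      with (m ^ 4 * D 0 * D 0 * Derive phi x1 - (m ^ 2 * D 0) * (m ^ 2 * D 0) * (2 * r / Q 0)) by ring.
    rewrite <- EQ. replace (N 0 * Q 0 * (N 0 * Q 0) * (2 * r / Q 0)) with (N 0 * N 0 * (2 * r) * Q 0) by (field; lra).
    nra. }
  assert (Hmp2 : 0 < (m ^ 2 * D 0) ^ 2) by (apply pow_lt, Rmult_lt_0_compat; auto; apply pow_lt; lra).
  assert (Hfin : 2 * r / Q 0 <= Derive phi x1).
  { apply Rnot_lt_le. intros L. nra. }
  (* On the segment Q(0) <= 2 r^2. Hence 1/r <= phi'(x1) <= M, against r M < 1. *)
  assert (HQr : / r <= 2 * r / Q 0).
  { apply Rle_div_r; auto. apply Rmult_le_reg_l with r; auto.
    rewrite <- Rmult_assoc, Rinv_r, Rmult_1_l by lra. unfold Q. 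
    assert ((x1 - x0) ^ 2 <= r ^ 2) by (rewrite <- !Rsqr_pow2; apply Rsqr_le_abs_1; rewrite (Rabs_pos_eq r) by lra; apply Rabs_le; lra).
    nra. }
  assert (HM1 := HM x1). apply Rabs_le_between in HM1.
  assert (Hrr : r * / r = 1) by (apply Rinv_r; lra).
  assert (/ r <= M) by lra. 
  assert (r * / r <= r * M) by (apply Rmult_le_compat_l; lra). lra.
Qed.

(** * Boundedness in the half-plane and perturbed phases *)

Lemma RInt_le_int_R g a b B : a <= b -> Rbar_le (int_R g) (Finite B) -> RInt g a b <= B.
Proof.
  intros Hab H. destruct (Lub_Rbar_correct (fun v => exists a b, a <= b /\ v = RInt g a b)) as [H1 _].
  exact (Rbar_le_trans (Finite (RInt g a b)) _ (Finite B) (H1 _ (ex_intro _ a (ex_intro _ b (conj Hab eq_refl)))) H).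
Qed.

Lemma hardy_p_interior p F : 0 < p -> hardy_p p F ->
  exists C0, forall x y, 0 < y -> rpow (Cmod (F (x, y))) p * y <= C0.
Proof.
  intros Hp [Hh [B HB]]. apply (hardy_interior_bound F p B); auto.
  intros y a b Hy Hab. apply (RInt_le_int_R (fun x => rpow (Cmod (F (x, y))) p)); auto.
Qed.

Lemma sharp_sharp f z : sharp (sharp f) z = f z.
Proof. unfold sharp. rewrite !Cconj_conj. reflexivity. Qed.

(** The interior estimate allows growth like y^(-1/p); for y <= 1 a power y^k with k >= 1/p cancels
    it. *)
Lemma pole_power_bound w y C0 p k : 0 < p -> 0 <= w -> 0 < y <= 1 -> 1 <= INR k * p ->
  rpow w p * y <= C0 -> w * y ^ k <= rpow C0 (1 / p).
Proof.
  intros Hp Hw Hy Hk H.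
  assert (Hyk : 0 < y ^ k) by (apply pow_lt; lra).
  assert (Hk0 : (0 < k)%nat).
  { destruct k; [simpl in Hk; lra|lia]. }
  rewrite <- (rpow_inv (w * y ^ k) p) by (try lra; apply Rmult_le_pos; lra).
  apply rpow_le.
  { apply Rlt_le, Rdiv_lt_0_compat; lra. }
  eapply Rle_trans; [|apply H]. rewrite rpow_mult_distr by lra.
  apply Rmult_le_compat_l; [apply rpow_ge_0|].
  rewrite <- rpow_INR, rpow_rpow, rpow_pos by (lra || auto).
  rewrite <- (exp_ln y) at 2 by lra. unfold Rpower.
  assert (Hln : ln y <= 0) by (rewrite <- ln_1; apply ln_le; lra).
  assert (INR k * p * ln y <= ln y) by nra.
  destruct H0 as [H0|H0]; [left; apply exp_increasing; auto|rewrite H0; right; auto].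
Qed.

(** At heights at least r the interior estimate suffices. Below, f is multiplied by h^k, where h
    vanishes at the corners x0 - r and x0 + r: the product is bounded on the outer sides, and the
    strip lemma carries the bound inside. Since r and b do not depend on x0, the bound is
    uniform. *)
Lemma quotient_bounded E phi f M p C0 : hermite_biehler E -> (forall x : R, E (RtoC x) <> RtoC 0) ->
  phase_function E phi -> (forall x, Rabs (Derive phi x) <= M) -> entire f -> 0 < p ->
  (forall x y, 0 < y -> rpow (Cmod (f (x, y) / E (x, y))%C) p * y <= C0) ->
  (forall x y, 0 < y -> rpow (Cmod (sharp f (x, y) / E (x, y))%C) p * y <= C0) ->
  exists A, forall z, 0 <= Im z -> Cmod (f z / E z)%C <= A.
Proof.
  intros HE HE0 Hphi HM Hf Hp H1 H2.
  assert (HEn := hb_nonzero E HE HE0).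
  assert (HM0 : 0 <= M) by (eapply Rle_trans; [apply Rabs_pos|apply (HM 0)]).
  (* This gives both r M < 1 and r <= 1. *)
  set (r := / (1 + M)).
  assert (Hr : 0 < r) by (apply Rinv_0_lt_compat; lra).
  assert (HrM' : r * (1 + M) = 1) by (apply Rinv_l; lra).
  assert (Hr1 : r <= 1) by nra.
  assert (HrM : r * M < 1) by nra.
  destruct (INR_unbounded (/ p)) as [k Hk].
  assert (Hkp : 1 <= INR k * p).
  { apply Rlt_le. apply Rmult_lt_compat_r with (r := p) in Hk; auto. rewrite Rinv_l in Hk by lra. exact Hk. }
  assert (Hk0 : (0 < k)%nat).
  { destruct k; [simpl in Hkp; lra|lia]. }
  set (c0 := rpow C0 (1 / p)). set (b := 9 ^ k * 4 * c0).
  assert (Hc0 : 0 <= c0) by apply rpow_ge_0.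
  assert (H9 : 0 < 9 ^ k) by (apply pow_lt; lra).
  assert (Hb : 0 <= b) by (unfold b; repeat apply Rmult_le_pos; lra).
  exists (Rmax (rpow (C0 / r) (1 / p)) (b / (r ^ (2 * k) * r))).
  intros [x0 y0] Hy0. simpl in Hy0.
  destruct (Rle_or_lt r y0) as [Hry|Hry].
  { eapply Rle_trans; [|apply Rmax_l].
    rewrite <- (rpow_inv (Cmod (f (x0, y0) / E (x0, y0))%C) p) by (try lra; apply Cmod_ge_0).
    apply rpow_le; [apply Rlt_le, Rdiv_lt_0_compat; lra|].
    apply Rle_div_r; auto. eapply Rle_trans; [|apply (H1 x0 y0); lra].
    apply Rmult_le_compat_l; [apply rpow_ge_0|auto]. }
  eapply Rle_trans; [|apply Rmax_r].
  set (h := fun z : C => (Cminus z (RtoC (x0 + r)) * Cminus z (RtoC (x0 - r)))%C).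
  set (g := fun z : C => (f z * h z ^ k)%C).
  set (q := fun z => Cminus z (x0, - r)).
  assert (Hhh : entire h).
  { intros z. apply (C_holo_mult (fun z => Cminus z (RtoC (x0 + r))) (fun z => Cminus z (RtoC (x0 - r))));
    (apply (C_holo_minus (fun z => z)); [apply C_holo_id|apply C_holo_const]). }
  assert (Hg : entire g).
  { intros z. apply (C_holo_mult f (fun z => h z ^ k)%C); auto. apply C_holo_pow; auto. }
  assert (Hsg : forall z, sharp g z = (sharp f z * h z ^ k)%C).
  { intros z. unfold sharp, g. rewrite Cmult_conj, Cpow_conj. f_equal. f_equal. unfold h.
    rewrite Cmult_conj, !Cminus_conj, !Cconj_conj, !Cconj_R. reflexivity. }
  assert (Hq : forall x y, x0 - r <= x <= x0 + r -> 0 <= y <= r -> Cmod (q (x, y)) <= 4).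
  { intros x y Hx Hy. unfold q. eapply Rle_trans; [apply (rect_dist (x0 - r) (x0 + r) (- r) r); lra|]. lra. }
  assert (Hcore : forall F x y, x0 - r <= x <= x0 + r -> 0 <= y <= r ->
     x = x0 - r \/ x = x0 + r \/ y = r ->
     (forall x y, 0 < y -> rpow (Cmod (F (x, y) / E (x, y))%C) p * y <= C0) ->
     Cmod ((F (x, y) * h (x, y) ^ k) * q (x, y) / E (x, y))%C <= b).
  { intros F x y Hx Hy Ho HF.
    (* On a vertical side one factor of h has modulus at most y and the other at most 3r <= 3; on
       the top side y = r and both factors are at most 3r. *)
    assert (Hhy : Cmod (h (x, y)) <= 9 * y).
    { unfold h. rewrite Cmod_mult.
      assert (D1 := rect_dist (x0 - r) (x0 + r) 0 r x y (x0 + r) 0 ltac:(lra) ltac:(lra) ltac:(lra) ltac:(lra)).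
      assert (D2 := rect_dist (x0 - r) (x0 + r) 0 r x y (x0 - r) 0 ltac:(lra) ltac:(lra) ltac:(lra) ltac:(lra)).
      change (x0 + r, 0) with (RtoC (x0 + r)) in D1. change (x0 - r, 0) with (RtoC (x0 - r)) in D2.
      assert (P1 := Cmod_ge_0 ((x, y) - RtoC (x0 + r))%C). assert (P2 := Cmod_ge_0 ((x, y) - RtoC (x0 - r))%C).
      assert (S : forall t, Cmod ((t, y) - RtoC t)%C <= y).
      { intros t. eapply Rle_trans; [apply Cmod_le_sum|]. simpl.
        replace (t + - t) with 0 by ring. rewrite Rabs_R0, Ropp_0, Rplus_0_r, (Rabs_pos_eq y); lra. }
      destruct Ho as [Ho|[Ho|Ho]].
      - assert (S1 := S (x0 - r)). rewrite <- Ho in S1 at 1.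
        apply Rle_trans with (3 * y); [apply Rmult_le_compat; auto; lra|lra].
      - assert (S1 := S (x0 + r)). rewrite <- Ho in S1 at 1. rewrite Rmult_comm.
        apply Rle_trans with (3 * y); [apply Rmult_le_compat; auto; lra|lra].
      - apply Rle_trans with ((3 * r) * 3); [apply Rmult_le_compat; auto; lra|lra]. }
    assert (Hn : E (x, y) <> RtoC 0) by (apply HEn; simpl; lra).
    replace ((F (x, y) * h (x, y) ^ k) * q (x, y) / E (x, y))%C
      with (F (x, y) / E (x, y) * (h (x, y) ^ k) * q (x, y))%C by (field; auto).
    rewrite !Cmod_mult, Cmod_pow.
    assert (Pq := Cmod_ge_0 (q (x, y))). assert (Ph := Cmod_ge_0 (h (x, y))).
    assert (PF := Cmod_ge_0 (F (x, y) / E (x, y))%C).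
    specialize (Hq x y Hx Hy).
    destruct (Rle_lt_or_eq_dec 0 y (proj1 Hy)) as [Hy1|Hy1].
    - assert (L := pole_power_bound _ y C0 p k Hp PF ltac:(lra) Hkp (HF x y Hy1)). fold c0 in L.
      assert (Hhk : Cmod (h (x, y)) ^ k <= 9 ^ k * y ^ k).
      { rewrite <- Rpow_mult_distr. apply pow_incr. split; auto. }
      assert (Hyk : 0 < y ^ k) by (apply pow_lt; lra).
      assert (L2 : Cmod (F (x, y) / E (x, y))%C * Cmod (h (x, y)) ^ k <= 9 ^ k * c0).
      { apply Rle_trans with (Cmod (F (x, y) / E (x, y))%C * (9 ^ k * y ^ k)); [apply Rmult_le_compat_l; auto|].
        replace (Cmod (F (x, y) / E (x, y))%C * (9 ^ k * y ^ k)) with (9 ^ k * (Cmod (F (x, y) / E (x, y))%C * y ^ k)) by ring.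
        apply Rmult_le_compat_l; lra. }
      apply Rle_trans with ((9 ^ k * c0) * 4); [|unfold b; lra].
      apply Rmult_le_compat; auto. apply Rmult_le_pos; auto. apply pow_le; auto.
    (* At the two corners on the axis there is no interior estimate, but h = 0 there and k > 0. *)
    - rewrite <- Hy1, Rmult_0_r in Hhy. rewrite <- Hy1 in Ph, PF |- *.
      replace (Cmod (h (x, 0))) with 0 by lra. rewrite pow_i by lia.
      rewrite Rmult_0_r, Rmult_0_l. exact Hb. }
  assert (Hout : on_rect (x0 - r) (x0 + r) 0 r (fun z => Cmod (g z * q z / E z)%C <= b)).
  { apply (strip_maximum E phi g M x0 r b); auto.
    - split; [|intros; split]; intros; apply Hcore; auto; lra.
    - split; [|intros; split]; intros; rewrite Hsg; apply Hcore; auto; lra. }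
  assert (HW := Hout x0 y0 ltac:(lra) ltac:(lra)). cbv beta in HW.
  assert (Hn : E (x0, y0) <> RtoC 0) by (apply HEn; simpl; lra).
  replace (g (x0, y0) * q (x0, y0) / E (x0, y0))%C
      with (f (x0, y0) / E (x0, y0) * (h (x0, y0) ^ k * q (x0, y0)))%C in HW by (unfold g; field; auto).
  rewrite !Cmod_mult, Cmod_pow in HW.
  assert (Hrk : 0 < r ^ (2 * k)) by (apply pow_lt; auto).
  apply Rle_div_r; [apply Rmult_lt_0_compat; auto|].
  eapply Rle_trans; [|apply HW]. apply Rmult_le_compat_l; [apply Cmod_ge_0|].
  apply Rmult_le_compat; try lra.
  (* On the middle line Re z = x0 the modulus of h is r^2 + y0^2 >= r^2, and that of q is r + y0 >=
     r. *)
  - rewrite pow_mult. apply pow_incr. split; [nra|].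
    unfold h. eapply Rle_trans; [|apply re_le_Cmod].
    replace (Re (((x0, y0) - RtoC (x0 + r)) * ((x0, y0) - RtoC (x0 - r)))%C) with (- (r ^ 2 + y0 ^ 2))
      by (unfold Re; simpl; ring).
    rewrite Rabs_Ropp, Rabs_pos_eq; nra.
  - unfold q. eapply Rle_trans; [|apply im_le_Cmod]. unfold Im; simpl. rewrite Rabs_pos_eq; lra.
Qed.

Lemma Hp_quotient_bounded E phi f M p : hermite_biehler E -> (forall x : R, E (RtoC x) <> RtoC 0) ->
  phase_function E phi -> (forall x, Rabs (Derive phi x) <= M) -> 0 < p -> HpE p E f ->
  exists A, forall z, 0 <= Im z -> Cmod (f z / E z)%C <= A /\ Cmod (sharp f z / E z)%C <= A.
Proof.
  intros HE HE0 Hphi HM Hp (Hf & H1 & H2).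
  destruct (hardy_p_interior p _ Hp H1) as [C1 HC1].
  destruct (hardy_p_interior p _ Hp H2) as [C2 HC2].
  assert (K1 : forall x y, 0 < y -> rpow (Cmod (f (x, y) / E (x, y))%C) p * y <= Rmax C1 C2).
  { intros; eapply Rle_trans; [apply HC1; auto|apply Rmax_l]. }
  assert (K2 : forall x y, 0 < y -> rpow (Cmod (sharp f (x, y) / E (x, y))%C) p * y <= Rmax C1 C2).
  { intros; eapply Rle_trans; [apply HC2; auto|apply Rmax_r]. }
  destruct (quotient_bounded E phi f M p (Rmax C1 C2)) as [A HA]; auto.
  destruct (quotient_bounded E phi (sharp f) M p (Rmax C1 C2)) as [A' HA']; auto.
  { apply entire_sharp; auto. }
  { intros x y Hy. rewrite sharp_sharp. apply K1; auto. }
  exists (Rmax A A'). intros z Hz. split.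
  - eapply Rle_trans; [apply HA; auto|apply Rmax_l].
  - eapply Rle_trans; [apply HA'; auto|apply Rmax_r].
Qed.

Lemma quotient_le_real_sup E f A L : hermite_biehler E -> (forall x : R, E (RtoC x) <> RtoC 0) ->
  entire f -> (forall z, 0 <= Im z -> Cmod (f z / E z)%C <= A) ->
  (forall x : R, Cmod (f (RtoC x) / E (RtoC x))%C <= L) ->
  forall z, 0 <= Im z -> Cmod (f z) <= L * Cmod (E z).
Proof.
  intros HE HE0 Hf HA HL z Hz.
  assert (HEn := hb_nonzero E HE HE0).
  assert (H : Cmod (f z / E z)%C <= L).
  { apply (phragmen_lindelof_half_plane (fun z => f z / E z)%C A L); auto.
    intros w Hw. apply C_holo_div; auto. apply HE. }
  rewrite Cmod_div in H by auto. apply Rle_div_l in H; auto. apply Cmod_gt_0; auto.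
Qed.

(* E - lam f is again of Hermite-Biehler type (with <=), so its phase is monotone as well. *)
Lemma perturbed_phase E f rho lam x lE lf : hermite_biehler E -> (forall x : R, E (RtoC x) <> RtoC 0) ->
  entire f -> rho < 1 -> (forall z, 0 <= Im z -> Cmod (f z) <= rho * Cmod (E z)) ->
  (forall z, sharp f z = f z) -> Cmod lam = 1 ->
  @is_derive C_AbsRing C_NormedModule E (RtoC x) lE ->
  @is_derive C_AbsRing C_NormedModule f (RtoC x) lf ->
  Im (Cconj (E (RtoC x) - lam * f (RtoC x)) * (lE - lam * lf))%C <= 0.
Proof.
  intros HE HE0 Hf Hrho Hb Hs Hlam HlE Hlf.
  assert (HEn := hb_nonzero E HE HE0).
  set (G := fun z => (E z - lam * f z)%C).
  assert (HG : entire G).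
  { intros z. apply (C_holo_minus E (fun z => lam * f z)%C); [apply HE|].
    apply (C_holo_mult (fun _ => lam) f); [apply C_holo_const|apply Hf]. }
  assert (HsG : forall z, sharp G z = (sharp E z - Cconj lam * f z)%C).
  { intros z. rewrite <- (Hs z). unfold sharp, G. rewrite Cminus_conj, Cmult_conj. reflexivity. }
  assert (HsE : forall z, 0 <= Im z -> Cmod (sharp E z) <= Cmod (E z)).
  { intros [u v] Hv. simpl in Hv. rewrite Cmod_sharp. destruct Hv as [Hv| <-].
    - apply Rlt_le, HE. exact Hv.
    - change (u, 0) with (RtoC u). rewrite Cconj_R. lra. }
  assert (HGE : forall z, 0 <= Im z -> (1 - rho) * Cmod (E z) <= Cmod (G z)).
  { intros z Hz. specialize (Hb z Hz).
    assert (T := Cmod_triangle (G z) (lam * f z)%C). rewrite Cmod_mult, Hlam in T.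
    replace (G z + lam * f z)%C with (E z) in T by (unfold G; ring). lra. }
  assert (HGn : forall z, 0 <= Im z -> G z <> RtoC 0).
  { intros z Hz. apply (Cmod_gt_neq_0 _ 0); [lra|]. eapply Rlt_le_trans; [|apply HGE; auto].
    apply Rmult_lt_0_compat; [lra|]. apply Cmod_gt_0; auto. }
  (* The strict bound rho < 1 keeps |G| >= (1 - rho) |E|, so the quotient is bounded; it has modulus
     1 on the axis, and the half-plane principle applies. *)
  assert (HGG : forall z, 0 <= Im z -> Cmod (sharp G z / G z)%C <= 1).
  { apply (phragmen_lindelof_half_plane (fun z => sharp G z / G z)%C ((1 + rho) / (1 - rho))).
    - intros z Hz. apply C_holo_div; auto. apply entire_sharp; auto.
    - intros z Hz. rewrite Cmod_div by auto. assert (Hp := proj1 (Cmod_gt_0 _) (HGn z Hz)).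
      apply Rle_div_l; auto.
      apply Rle_trans with ((1 + rho) * Cmod (E z)).
      + rewrite HsG. assert (T := Cmod_triangle (sharp E z) (- (Cconj lam * f z))%C).
        rewrite Cmod_opp, Cmod_mult, Cmod_conj, Hlam in T. 
        specialize (Hb z Hz). specialize (HsE z Hz). 
        change (sharp E z + - (Cconj lam * f z))%C with (sharp E z - Cconj lam * f z)%C in T. lra.
      + specialize (HGE z Hz). specialize (Hb z Hz). assert (P1 := Cmod_ge_0 (f z)).
        assert (P2 := proj1 (Cmod_gt_0 _) (HEn z Hz)).
        assert (P3 : 0 <= rho) by (apply Rmult_le_reg_r with (Cmod (E z)); lra).
        replace ((1 + rho) / (1 - rho) * Cmod (G z)) with ((1 + rho) * (Cmod (G z) / (1 - rho))) by (field; lra).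
        apply Rmult_le_compat_l; [lra|]. apply Rle_div_r; lra.
    - intros t. rewrite Cmod_div by (apply HGn; simpl; lra).
      rewrite Cmod_sharp, Cconj_R. right. field. apply Rgt_not_eq, Cmod_gt_0, HGn. simpl; lra. }
  (* This makes the y-derivative of |G|^2 nonnegative on the axis, which is the claim up to the
     factor -2. *)
  assert (HGd : forall y, 0 < y -> Cmod (G (x, - y)) <= Cmod (G (x, y))).
  { intros y Hy. specialize (HGG (x, y) ltac:(simpl; lra)). 
    rewrite Cmod_div in HGG by (apply HGn; simpl; lra).
    apply Rle_div_l in HGG; [|apply Cmod_gt_0, HGn; simpl; lra].
    rewrite Cmod_sharp, Rmult_1_l in HGG. exact HGG. }
  assert (HlG : @is_derive C_AbsRing C_NormedModule G (x, 0) (lE - lam * lf)%C).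
  { apply (is_derive_C_minus E (fun z => lam * f z)%C); auto.
    replace (lam * lf)%C with (RtoC 0 * f (x, 0) + lam * lf)%C by ring.
    apply (is_derive_C_mult (fun _ => lam) f); auto. apply is_derive_C_const. }
  assert (DG := is_derive_Cmod2_vline _ _ _ _ HlG).
  set (N := fun t => Cmod (G (x, t)) ^ 2) in *.
  set (n := -2 * Im (Cconj (G (x, 0)) * (lE - lam * lf))%C) in *.
  assert (DN' : is_derive (fun y => N (- y)) 0 (-1 * n)).
  { apply (is_derive_comp N (fun y => - y)); [rewrite Ropp_0; auto|]. auto_derive; auto. }
  assert (Hn : 0 <= n - -1 * n).
  { apply (derive_ge_0_right (fun y => N y - N (- y)) _ 1 Rlt_0_1).
    - apply (is_derive_minus N (fun y => N (- y))); auto.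
    - rewrite Ropp_0. ring.
    - intros y [Hy _]. unfold N. specialize (HGd y Hy).
      assert (Cmod (G (x, - y)) ^ 2 <= Cmod (G (x, y)) ^ 2) by (apply pow_incr; split; auto; apply Cmod_ge_0). lra. }
  change (E (RtoC x) - lam * f (RtoC x))%C with (G (x, 0)). unfold n in Hn. lra.
Qed.

(** * The Bernstein-Szego inequality and the cosine comparison *)

Lemma is_derive_acos x : -1 < x < 1 -> is_derive acos x (- / sqrt (1 - x ^ 2)).
Proof.
  intros Hx. apply is_derive_Reals.
  replace (- / sqrt (1 - x ^ 2)) with (-1 / sqrt (1 - Rsqr x)).
  - apply (derive_pt_eq_1 acos x _ (derivable_pt_acos x Hx)), derive_pt_acos.
  - rewrite Rsqr_pow2. unfold Rdiv. ring.
Qed.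

(* With h = f/|E|, the number |conj(E) f' - conj(E') f| / |E|^2 is the modulus of
   h' - i (phi'/2) h. *)
Lemma bernstein_szego E phi f rho : hermite_biehler E -> (forall x : R, E (RtoC x) <> RtoC 0) ->
  phase_function E phi -> entire f -> rho < 1 ->
  (forall z, 0 <= Im z -> Cmod (f z) <= rho * Cmod (E z)) -> (forall z, sharp f z = f z) ->
  exists h' : R -> R, forall x,
    is_derive (fun t => Re (f (RtoC t)) / Cmod (E (RtoC t))) x (h' x) /\
    h' x ^ 2 <= (Derive phi x / 2) ^ 2 * (1 - (Re (f (RtoC x)) / Cmod (E (RtoC x))) ^ 2).
Proof.
  intros HE HE0 Hphi Hf Hrho Hb Hs.
  assert (Hreal : forall t : R, Im (f (RtoC t)) = 0).
  { intros t. specialize (Hs (RtoC t)). unfold sharp in Hs. rewrite Cconj_R in Hs.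
    apply (f_equal Im) in Hs. rewrite im_conj in Hs. lra. }
  cut (forall x, exists h', is_derive (fun t => Re (f (RtoC t)) / Cmod (E (RtoC t))) x h' /\
    h' ^ 2 <= (Derive phi x / 2) ^ 2 * (1 - (Re (f (RtoC x)) / Cmod (E (RtoC x))) ^ 2)).
  { intros H. exists (fun x => proj1_sig (constructive_indefinite_description _ (H x))).
    intros x. exact (proj2_sig (constructive_indefinite_description _ (H x))). }
  intros x.
  destruct HE as [HEe HEi]. assert (HE : hermite_biehler E) by (split; auto).
  destruct (HEe (RtoC x)) as [lE HlE]. destruct (Hf (RtoC x)) as [lf Hlf].
  destruct (is_derive_hline _ _ _ _ HlE) as [D1 D2]. destruct (is_derive_hline _ _ _ _ Hlf) as [D3 D4].
  set (v := fun t : R => Re (f (RtoC t))). set (e1 := fun t : R => Re (E (RtoC t))).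
  set (e2 := fun t : R => Im (E (RtoC t))).
  change (is_derive e1 x (Re lE)) in D1. change (is_derive e2 x (Im lE)) in D2.
  change (is_derive v x (Re lf)) in D3.
  assert (HIlf : Im lf = 0).
  { apply is_derive_unique in D4. rewrite <- D4.
    rewrite (Derive_ext _ (fun _ => 0)); [apply Derive_const|]. intros t. apply (Hreal t). }
  assert (HN : forall t, Cmod (E (RtoC t)) ^ 2 = e1 t ^ 2 + e2 t ^ 2) by (intros; apply Cmod2_alt).
  assert (Hn : 0 < Cmod (E (RtoC x))) by (apply Cmod_gt_0, HE0).
  assert (Hph := phase_derivative E phi x lE HE0 Hphi HlE).
  set (n := Cmod (E (RtoC x))) in *.
  assert (Hn2 : n ^ 2 = e1 x ^ 2 + e2 x ^ 2) by apply HN.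
  set (h' := Re lf / n - v x * (e1 x * Re lE + e2 x * Im lE) / n ^ 3).
  exists h'. split.
  { apply (is_derive_ext (fun t => v t / sqrt (e1 t ^ 2 + e2 t ^ 2))).
    { intros t. unfold v, Cmod, e1, e2, Re, Im. reflexivity. }
    assert (Hsq : sqrt (e1 x ^ 2 + e2 x ^ 2) = n) by reflexivity.
    auto_derive.
    - split; [exact (ex_intro _ _ D3)|]. split; [exact (ex_intro _ _ D1)|].
      split; [exact (ex_intro _ _ D2)|]. repeat split.
      + change (0 < e1 x ^ 2 + e2 x ^ 2). rewrite <- Hn2. apply pow_lt; auto.
      + change (sqrt (e1 x ^ 2 + e2 x ^ 2) <> 0). rewrite Hsq; lra.
      change (Derive (fun x => v x) x) with (Derive v x). change (Derive (fun x => e1 x) x) with (Derive e1 x). change (Derive (fun x => e2 x) x) with (Derive e2 x).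
      rewrite (is_derive_unique v _ _ D3), (is_derive_unique e1 _ _ D1), (is_derive_unique e2 _ _ D2).
      replace (sqrt (e1 x * (e1 x * 1) + e2 x * (e2 x * 1))) with n by reflexivity.
      unfold h'. field. lra. }
  set (P := (Cconj (E (RtoC x)) * lf - Cconj lE * f (RtoC x))%C).
  (* In the expanded product the term |lam|^2 conj(f) f' is real, because f and f' are real on the
     axis; the two mixed terms combine to -Im(lam P). *)
  assert (Hmain : forall lam, Cmod lam = 1 -> Im (Cconj (E (RtoC x)) * lE)%C - Im (lam * P)%C <= 0).
  { intros lam Hlam. assert (K := perturbed_phase E f rho lam x lE lf HE HE0 Hf Hrho Hb Hs Hlam HlE Hlf).
    revert K. unfold P. 
    assert (Hl2 : Re lam ^ 2 + Im lam ^ 2 = 1) by (rewrite <- Cmod2_alt, Hlam; ring).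
    specialize (Hreal x). revert Hl2 HIlf Hreal.
    destruct lam as [l1 l2], lE as [a b], lf as [c d], (E (RtoC x)) as [u w], (f (RtoC x)) as [s t].
    unfold Re, Im; simpl. intros Hl2 -> -> K. nra. }
  assert (HP : Cmod P <= - Im (Cconj (E (RtoC x)) * lE)%C).
  { destruct (Req_dec (Cmod P) 0) as [H0|H0].
    - specialize (Hmain 1%C Cmod_1). rewrite (Cmod_eq_0 _ H0) in Hmain. rewrite H0.
      replace (Im (1 * 0)%C) with 0 in Hmain by (simpl; ring). lra.
    - assert (HPn : RtoC (Cmod P) <> RtoC 0) by (intros E0; apply H0, RtoC_inj, E0).
      (* The extremal choice: lam P = -i |P|. *)
      assert (Hl : Cmod (- Ci * Cconj P / RtoC (Cmod P))%C = 1).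
      { rewrite Cmod_div, Cmod_mult, Cmod_opp, Cmod_Ci, Cmod_conj, Cmod_R by auto.
        rewrite Rabs_pos_eq by apply Cmod_ge_0. field; auto. }
      specialize (Hmain _ Hl).
      replace (- Ci * Cconj P / RtoC (Cmod P) * P)%C with (- Ci * RtoC (Cmod P))%C in Hmain.
      + replace (Im (- Ci * RtoC (Cmod P))%C) with (- Cmod P) in Hmain by (simpl; ring). lra.
      + replace (- Ci * Cconj P / RtoC (Cmod P) * P)%C with (- Ci * (P * Cconj P) / RtoC (Cmod P))%C by (field; auto).
        rewrite <- Cmod2_conj, RtoC_pow. field. auto. }
  set (d := Derive phi x) in *.
  assert (HP2 : Cmod P ^ 2 <= (n ^ 2 * d / 2) ^ 2).
  { apply pow_incr. split; [apply Cmod_ge_0|]. lra. }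
  assert (EP : Cmod P ^ 2 = (e1 x * Re lf - Re lE * v x) ^ 2 + (e2 x * Re lf - Im lE * v x) ^ 2).
  { rewrite Cmod2_alt. unfold P, e1, e2, v. specialize (Hreal x). revert HIlf Hreal.
    destruct lE as [a b], lf as [c d'], (E (RtoC x)) as [u w], (f (RtoC x)) as [s t].
    unfold Re, Im; simpl. intros -> ->. ring. }
  assert (Ed : n ^ 2 * d / 2 = - (e1 x * Im lE - e2 x * Re lE)).
  { rewrite <- Hph. unfold e1, e2. destruct lE as [a b], (E (RtoC x)) as [u w].
    unfold Re, Im; simpl. field. }
  assert (E1 : n ^ 3 * h' = n ^ 2 * Re lf - v x * (e1 x * Re lE + e2 x * Im lE)).
  { unfold h'. field. lra. }
  assert (E2 : n ^ 3 * (d / 2 * (v x / n)) = - (e1 x * Im lE - e2 x * Re lE) * v x).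
  { rewrite <- Ed. field. lra. }
  assert (E3 : n ^ 6 * (h' ^ 2 + (d / 2 * (v x / n)) ^ 2) = n ^ 2 * Cmod P ^ 2).
  { transitivity ((n ^ 3 * h') ^ 2 + (n ^ 3 * (d / 2 * (v x / n))) ^ 2); [ring|].
    rewrite E1, E2, EP, Hn2. ring. }
  assert (Hn6 : 0 < n ^ 6) by (apply pow_lt; auto).
  apply Rmult_le_reg_l with (n ^ 6); auto.
  assert (n ^ 2 * Cmod P ^ 2 <= n ^ 2 * (n ^ 2 * d / 2) ^ 2).
  { apply Rmult_le_compat_l; auto. apply pow_le; lra. }
  fold (v x).
  replace (n ^ 6 * ((d / 2) ^ 2 * (1 - (v x / n) ^ 2)))
    with (n ^ 2 * (n ^ 2 * d / 2) ^ 2 - n ^ 6 * (d / 2 * (v x / n)) ^ 2) by (field; lra).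
  lra.
Qed.

(** The derivative of arccos h is -h'/sqrt(1 - h^2), of modulus at most tau; the strict bounds on h
    keep arccos differentiable. The restriction to angles up to pi stays where the cosine
    decreases. *)
Lemma cosine_comparison (h h' : R -> R) tau x0 c x : 0 <= tau ->
  (forall t, is_derive h t (h' t)) -> (forall t, -1 < h t < 1) ->
  (forall t, h' t ^ 2 <= tau ^ 2 * (1 - h t ^ 2)) ->
  0 <= c -> cos c <= h x0 -> c + tau * Rabs (x - x0) <= PI ->
  cos (c + tau * Rabs (x - x0)) <= h x.
Proof.
  intros Ht Hd Hh Hb Hc Hcx Hpi.
  assert (Htx : 0 <= tau * Rabs (x - x0)) by (apply Rmult_le_pos; auto; apply Rabs_pos).
  assert (HA : Rabs (acos (h x) - acos (h x0)) <= tau * Rabs (x - x0)).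
  { apply (bounded_variation (fun t => acos (h t)) (fun t => h' t * - / sqrt (1 - h t ^ 2))).
    intros t _. specialize (Hh t). specialize (Hb t). split.
    - apply (is_derive_comp acos h); [|apply Hd]. apply is_derive_acos. auto.
    - assert (Hp : 0 < 1 - h t ^ 2) by nra.
      assert (Hs : 0 < sqrt (1 - h t ^ 2)) by (apply sqrt_lt_R0; auto).
      rewrite Rabs_mult, Rabs_Ropp, Rabs_inv, (Rabs_pos_eq (sqrt _)) by lra.
      change (Rabs (h' t) / sqrt (1 - h t ^ 2) <= tau). apply Rle_div_l; auto.
      apply Rsqr_incr_0_var; [|apply Rmult_le_pos; lra].
      rewrite <- Rsqr_abs, Rsqr_mult, Rsqr_sqrt, !Rsqr_pow2 by lra. exact Hb. }
  assert (H0 : acos (h x0) <= c).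
  { apply Rnot_lt_le. intros L. assert (B := acos_bound (h x0)).
    assert (cos (acos (h x0)) < cos c) by (apply cos_decreasing_1; lra).
    rewrite cos_acos in H by (specialize (Hh x0); lra). lra. }
  rewrite <- (cos_acos (h x)) by (specialize (Hh x); lra).
  assert (B := acos_bound (h x)). apply Rabs_le_between in HA.
  apply cos_decr_1; lra.
Qed.

Lemma cosine_lower_bound E phi f M tau L c : hermite_biehler E -> (forall x : R, E (RtoC x) <> RtoC 0) ->
  phase_function E phi -> (forall x, Rabs (Derive phi x) <= M) -> M <= 2 * tau -> entire f ->
  0 < L -> 0 < c < PI / 2 ->
  (forall z, 0 <= Im z -> Cmod (f z) <= L * Cmod (E z)) ->
  (forall z, 0 <= Im z -> Cmod (sharp f z) <= L * Cmod (E z)) ->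
  is_lub (fun v => exists x : R, v = Cmod (f (RtoC x) / E (RtoC x))%C) L ->
  exists x0, forall x, c + tau * Rabs (x - x0) <= PI ->
    L * cos (c + tau * Rabs (x - x0)) <= Cmod (f (RtoC x) / E (RtoC x))%C.
Proof.
  intros HE HE0 Hphi HM HMt Hf HL Hc Hb Hb' [HL1 HL2].
  assert (Hcc : 0 < cos c < 1).
  { split; [apply cos_gt_0; lra|]. rewrite <- cos_0. apply cos_decreasing_1; lra. }
  (* The harmonic mean of L and L / cos c: strictly above L, so that f/L' is a strict contraction
     relative to E, and with L' cos c < L, so that some x0 exceeds this level. *)
  set (L' := 2 * L / (1 + cos c)).
  assert (HL' : L < L') by (apply Rlt_div_r; nra).
  assert (HLc : cos c * L' < L).
  { replace (cos c * L') with (2 * cos c * L / (1 + cos c)) by (unfold L'; field; lra).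
    apply Rlt_div_l; nra. }
  assert (exists x0 : R, cos c * L' < Cmod (f (RtoC x0) / E (RtoC x0))%C) as [x0 Hx0].
  { apply NNPP. intros N. apply (Rlt_irrefl L). eapply Rle_lt_trans; [|exact HLc].
    apply HL2. intros v [x ->]. apply Rnot_lt_le. intros K. apply N. eauto. }
  exists x0.
  assert (HEp : forall x, 0 < Cmod (E (RtoC x))) by (intros; apply Cmod_gt_0, HE0).
  rewrite Cmod_div in Hx0 by auto.
  set (A := Cmod (f (RtoC x0))) in *.
  assert (HA : 0 < A).
  { assert (0 < cos c * L') by (apply Rmult_lt_0_compat; lra).
    assert (T := Rlt_trans _ _ _ H Hx0). apply (Rlt_div_r 0 A _ (HEp x0)) in T. lra. }
  assert (HAn : RtoC (A * L') <> RtoC 0) by (intros E0; apply RtoC_inj in E0; nra).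
  set (mu := (Cconj (f (RtoC x0)) / RtoC (A * L'))%C).
  assert (Hmu : Cmod mu = / L').
  { unfold mu. rewrite Cmod_div, Cmod_conj, Cmod_R by auto. fold A.
    rewrite Rabs_pos_eq by nra. field. lra. }
  (* F is real and equals Re(mu f) on the axis, so |F| <= |f|/L' there. At x0 nothing is lost, since
     mu rotates f(x0) to the positive number A/L'. *)
  set (F := fun z => (RtoC (/ 2) * (mu * f z + Cconj mu * sharp f z))%C).
  assert (HF : entire F).
  { intros z. apply (C_holo_mult (fun _ => RtoC (/ 2)) (fun z => mu * f z + Cconj mu * sharp f z)%C); [apply C_holo_const|].
    apply (C_holo_plus (fun z => mu * f z)%C (fun z => Cconj mu * sharp f z)%C).
    - apply (C_holo_mult (fun _ => mu) f); [apply C_holo_const|auto].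
    - apply (C_holo_mult (fun _ => Cconj mu) (sharp f)); [apply C_holo_const|apply entire_sharp; auto]. }
  assert (HFs : forall z, sharp F z = F z).
  { intros z. unfold sharp, F. rewrite Cmult_conj, Cconj_R, Cplus_conj, !Cmult_conj.
    rewrite Cconj_conj. unfold sharp. rewrite !Cconj_conj. f_equal. ring. }
  set (rho := L / L').
  assert (Hrho : rho < 1) by (apply Rlt_div_l; lra).
  assert (HFn : forall z, Cmod (F z) <= / 2 * (/ L' * Cmod (f z) + / L' * Cmod (sharp f z))).
  { intros z. unfold F. rewrite Cmod_mult, Cmod_R, Rabs_pos_eq by lra.
    apply Rmult_le_compat_l; [lra|]. eapply Rle_trans; [apply Cmod_triangle|].
    rewrite !Cmod_mult, Cmod_conj, Hmu. lra. }
  assert (HLi : 0 < / L') by (apply Rinv_0_lt_compat; lra).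
  assert (HFb : forall z, 0 <= Im z -> Cmod (F z) <= rho * Cmod (E z)).
  { intros z Hz. eapply Rle_trans; [apply HFn|]. specialize (Hb z Hz). specialize (Hb' z Hz).
    unfold rho, Rdiv. nra. }
  destruct (bernstein_szego E phi F rho HE HE0 Hphi HF Hrho HFb HFs) as [h' Hh'].
  set (h := fun t => Re (F (RtoC t)) / Cmod (E (RtoC t))) in *.
  assert (Hhu : forall x, Rabs (h x) <= Cmod (f (RtoC x)) / Cmod (E (RtoC x)) / L').
  { intros x. unfold h. unfold Rdiv at 1. rewrite Rabs_mult, Rabs_inv, (Rabs_pos_eq (Cmod (E _))) by apply Cmod_ge_0.
    replace (Cmod (f (RtoC x)) / Cmod (E (RtoC x)) / L') with ((/ L' * Cmod (f (RtoC x))) * / Cmod (E (RtoC x))) by (field; specialize (HEp x); lra).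
    apply Rmult_le_compat_r; [apply Rlt_le, Rinv_0_lt_compat; auto|].
    eapply Rle_trans; [apply re_le_Cmod|]. eapply Rle_trans; [apply HFn|].
    rewrite Cmod_sharp, Cconj_R. lra. }
  assert (Hh1 : forall x, -1 < h x < 1).
  { intros x. cut (Rabs (h x) < 1); [intros K; apply Rabs_def2 in K; lra|]. eapply Rle_lt_trans; [apply Hhu|].
    apply Rlt_div_l; [lra|]. apply Rlt_div_l; [apply HEp|].
    specialize (Hb (RtoC x) ltac:(simpl; lra)). specialize (HEp x). nra. }
  assert (Hhx0 : h x0 = A / Cmod (E (RtoC x0)) / L').
  { unfold h. replace (F (RtoC x0)) with (RtoC (A / L')).
    - change (Re (RtoC (A / L'))) with (A / L'). field. specialize (HEp x0); lra.
    - unfold F, sharp. rewrite Cconj_R, <- Cmult_conj.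
      replace (mu * f (RtoC x0))%C with (RtoC (A / L')).
      + rewrite Cconj_R, <- RtoC_plus, <- RtoC_mult. f_equal. field. lra.
      + unfold mu. replace (Cconj (f (RtoC x0)) / RtoC (A * L') * f (RtoC x0))%C
          with (f (RtoC x0) * Cconj (f (RtoC x0)) / RtoC (A * L'))%C by (field; auto).
        rewrite <- Cmod2_conj. fold A. rewrite <- RtoC_div by nra. f_equal. field. nra. }
  intros x Hx.
  assert (Hm := cosine_comparison h h' tau x0 c x).
  assert (Htau : 0 <= tau) by (specialize (HM 0); generalize (Rabs_pos (Derive phi 0)); lra).
  assert (Hcmp : cos (c + tau * Rabs (x - x0)) <= h x).
  { apply Hm; auto; try lra.
    - intros t. apply Hh'.
    - intros t. destruct (Hh' t) as [_ K]. eapply Rle_trans; [apply K|].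
      specialize (Hh1 t). fold (h t). apply Rmult_le_compat_r; [nra|].
      rewrite <- !Rsqr_pow2. apply Rsqr_le_abs_1. 
      unfold Rdiv. rewrite Rabs_mult, (Rabs_pos_eq (/ 2)), (Rabs_pos_eq tau) by lra.
      specialize (HM t). lra.
    - rewrite Hhx0. apply Rlt_le, Rlt_div_r; lra. }
  rewrite Cmod_div by auto.
  specialize (Hhu x). apply Rabs_le_between in Hhu.
  assert (K : cos (c + tau * Rabs (x - x0)) * L' <= Cmod (f (RtoC x)) / Cmod (E (RtoC x))).
  { apply Rle_div_r; lra. }
  (* The factor L' can be lowered to L only when the cosine is nonnegative; otherwise the claim is
     trivial. *)
  destruct (Rle_or_lt 0 (cos (c + tau * Rabs (x - x0)))) as [P|P]; [nra|].
  apply Rle_trans with 0; [nra|]. apply Rdiv_le_0_compat; [apply Cmod_ge_0|auto].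
Qed.

(** * Integration *)

Lemma continuous_rpow_comp (f : R -> R) p x : 0 < p -> continuous f x -> continuous (fun t => rpow (f t) p) x.
Proof. intros Hp Hf. apply (continuous_comp f (fun t => rpow t p)); auto. apply continuous_rpow; auto. Qed.

Lemma continuous_cos_power p x : 0 < p -> continuous (fun t => rpow (cos t) p) x.
Proof. intros Hp. apply continuous_rpow_comp; auto. apply continuous_cos. Qed.

Lemma ex_RInt_cos_power p a b : 0 < p -> ex_RInt (fun t => rpow (cos t) p) a b.
Proof. intros Hp. apply (@ex_RInt_continuous R_CompleteNormedModule). intros; apply continuous_cos_power; auto. Qed.

Lemma RInt_abs_cos_power p : 0 < p ->
  RInt (fun x => rpow (Rabs (cos x)) p) (- (PI / 2)) (PI / 2)
    = 2 * RInt (fun t => rpow (cos t) p) 0 (PI / 2).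
Proof.
  intros Hp. assert (HPI := PI_RGT_0). set (w := fun t => rpow (cos t) p).
  rewrite (RInt_ext _ w).
  2:{ intros x. rewrite Rmin_left, Rmax_right by lra. intros Hx. unfold w.
      rewrite Rabs_pos_eq; auto. apply cos_ge_0; lra. }
  assert (HI : forall a b, ex_RInt w a b) by (intros; apply ex_RInt_cos_power; auto).
  rewrite <- (@RInt_Chasles R_CompleteNormedModule w _ 0) by auto.
  assert (E : RInt w (- (PI / 2)) 0 = RInt w 0 (PI / 2)).
  { assert (K := @RInt_comp_lin R_CompleteNormedModule w (-1) 0 0 (PI / 2) (HI _ _)).
    replace (-1 * 0 + 0) with 0 in K by ring. replace (-1 * (PI / 2) + 0) with (- (PI / 2)) in K by ring.
    rewrite <- (@opp_RInt_swap R_CompleteNormedModule w) by auto. rewrite <- K.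
    rewrite (RInt_ext _ (fun y => -1 * w y)).
    - rewrite RInt_Rscal by auto. unfold opp; simpl. ring.
    - intros y _. unfold scal; simpl; unfold mult; simpl. unfold w.
      replace (-1 * y + 0) with (- y) by ring. rewrite cos_neg. reflexivity. }
  rewrite E. unfold plus; simpl. unfold w. ring.
Qed.

Lemma cos_power_integral_gt_0 p : 0 < p -> 0 < RInt (fun t => rpow (cos t) p) 0 (PI / 2).
Proof.
  intros Hp. assert (HPI := PI_RGT_0). apply RInt_gt_0; [lra| |].
  - intros x Hx. apply rpow_gt_0, cos_gt_0; lra.
  - intros x _. apply continuous_cos_power; auto.
Qed.

Lemma cos_power_tail p c : 0 < p -> 0 < c < PI / 2 ->
  RInt (fun t => rpow (cos t) p) 0 (PI / 2) - c <= RInt (fun t => rpow (cos t) p) c (PI / 2).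
Proof.
  intros Hp Hc. set (w := fun t => rpow (cos t) p).
  assert (HI : forall a b, ex_RInt w a b) by (intros; apply ex_RInt_cos_power; auto).
  rewrite <- (@RInt_Chasles R_CompleteNormedModule w 0 c) by auto.
  assert (RInt w 0 c <= c).
  { apply Rle_trans with (RInt (fun _ => 1) 0 c).
    - apply RInt_le; auto; [lra|apply ex_RInt_const|]. intros x Hx. unfold w.
      apply Rle_trans with (rpow 1 p).
      + apply rpow_le; [lra|]. apply COS_bound.
      + rewrite rpow_pos by lra. unfold Rpower. rewrite ln_1, Rmult_0_r, exp_0. lra.
    - rewrite RInt_const. unfold scal; simpl; unfold mult; simpl. lra. }
  unfold plus; simpl. lra.
Qed.

(** The comparison is integrated over [x0 - T, x0 + T], at whose ends the angle reaches pi/2. Each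
    half contributes L^p/tau times the integral of cos^p from c to pi/2; dropping [0, c] costs at
    most c, as cos^p <= 1. *)
Lemma integral_cosine_lower (u : R -> R) p tau L c x0 : 0 < p -> 0 < tau -> 0 < L -> 0 < c < PI / 2 ->
  (forall x, continuous u x) ->
  (forall x, c + tau * Rabs (x - x0) <= PI -> L * cos (c + tau * Rabs (x - x0)) <= u x) ->
  (forall a b, a <= b -> RInt (fun x => rpow (u x) p) a b <= 1) ->
  rpow L p * (2 * (RInt (fun t => rpow (cos t) p) 0 (PI / 2) - c)) <= tau.
Proof.
  intros Hp Ht HL Hc Hu Hlow H1. assert (HPI := PI_RGT_0).
  set (w := fun t => rpow (cos t) p).
  assert (HI : forall a b, ex_RInt w a b) by (intros; apply ex_RInt_cos_power; auto).
  assert (HU : forall a b, ex_RInt (fun x => rpow (u x) p) a b).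
  { intros. apply (@ex_RInt_continuous R_CompleteNormedModule). intros; apply continuous_rpow_comp; auto. }
  set (T := (PI / 2 - c) / tau).
  assert (HT : 0 < T) by (apply Rdiv_lt_0_compat; lra).
  assert (HtT : tau * T = PI / 2 - c) by (unfold T; field; lra).
  assert (HLp : 0 < rpow L p) by (apply rpow_gt_0; auto).
  (* One affine substitution serves both halves, with slope tau on the right and -tau on the
     left. *)
  assert (Hlin : forall s v a b, a <= b -> s <> 0 ->
     (forall x, a < x < b -> s * x + v = c + tau * Rabs (x - x0) /\ tau * Rabs (x - x0) <= PI / 2 - c) ->
     rpow L p * / s * RInt w (s * a + v) (s * b + v) <= RInt (fun x => rpow (u x) p) a b).
  { intros s v a b Hab Hs Hx.
    assert (E := @ex_RInt_comp_lin R_NormedModule w s v a b (HI _ _)).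
    rewrite <- (@RInt_comp_lin R_CompleteNormedModule w s v a b) by auto.
    rewrite <- RInt_Rscal by exact E.
    apply RInt_le; auto; [apply ex_RInt_Rscal; exact E|].
    intros x Hab'. destruct (Hx x Hab') as [E1 E2]. unfold scal; simpl; unfold mult; simpl.
    replace (rpow L p * / s * (s * w (s * x + v))) with (rpow L p * w (s * x + v)) by (field; auto).
    rewrite E1. unfold w.
    assert (0 <= tau * Rabs (x - x0)) by (apply Rmult_le_pos; [lra|apply Rabs_pos]).
    rewrite <- rpow_mult_distr; [|lra|apply cos_ge_0; lra].
    apply rpow_le; [lra|]. apply Hlow. lra. }
  assert (R1 := Hlin tau (c - tau * x0) x0 (x0 + T) ltac:(lra) ltac:(lra)).
  assert (R2 := Hlin (- tau) (c + tau * x0) (x0 - T) x0 ltac:(lra) ltac:(lra)).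
  replace (tau * x0 + (c - tau * x0)) with c in R1 by ring.
  replace (tau * (x0 + T) + (c - tau * x0)) with (PI / 2) in R1 by lra.
  replace (- tau * (x0 - T) + (c + tau * x0)) with (PI / 2) in R2 by lra.
  replace (- tau * x0 + (c + tau * x0)) with c in R2 by ring.
  rewrite <- (@opp_RInt_swap R_CompleteNormedModule w c (PI / 2)) in R2 by auto.
  assert (S1 : rpow L p * / tau * RInt w c (PI / 2) <= RInt (fun x => rpow (u x) p) x0 (x0 + T)).
  { apply R1. intros x Hx. rewrite Rabs_pos_eq by lra. split; [ring|nra]. }
  assert (S2 : rpow L p * / tau * RInt w c (PI / 2) <= RInt (fun x => rpow (u x) p) (x0 - T) x0).
  { replace (rpow L p * / tau * RInt w c (PI / 2)) with (rpow L p * / - tau * opp (RInt w c (PI / 2)))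
      by (unfold opp; simpl; field; lra).
    apply R2. intros x Hx. rewrite Rabs_left by lra. split; [ring|nra]. }
  assert (S3 := H1 (x0 - T) (x0 + T) ltac:(lra)).
  rewrite <- (@RInt_Chasles R_CompleteNormedModule _ (x0 - T) x0) in S3 by auto.
  unfold plus in S3; simpl in S3.
  assert (Tl := cos_power_tail p c Hp Hc). fold w in Tl |- *.
  assert (S4 : rpow L p * (2 * RInt w c (PI / 2)) <= tau).
  { replace (rpow L p * (2 * RInt w c (PI / 2))) with (tau * (2 * (rpow L p * / tau * RInt w c (PI / 2)))) by (field; lra).
    rewrite <- (Rmult_1_r tau) at 3. apply Rmult_le_compat_l; lra. }
  eapply Rle_trans; [|apply S4]. apply Rmult_le_compat_l; lra.
Qed.

Lemma sup_power_bound E phi f M p L : hermite_biehler E -> (forall x : R, E (RtoC x) <> RtoC 0) ->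
  phase_function E phi -> (forall x, Rabs (Derive phi x) <= M) -> 0 < p -> HpE p E f ->
  (forall a b, a <= b -> RInt (fun x => rpow (Cmod (f (RtoC x) / E (RtoC x))%C) p) a b <= 1) ->
  0 < L -> is_lub (fun v => exists x : R, v = Cmod (f (RtoC x) / E (RtoC x))%C) L ->
  rpow L p * (2 * RInt (fun x => rpow (Rabs (cos x)) p) (- (PI / 2)) (PI / 2)) <= M.
Proof.
  intros HE HE0 Hphi HM Hp Hf H1 HL Hlub.
  assert (HPI := PI_RGT_0).
  rewrite RInt_abs_cos_power by auto. set (J := RInt (fun t => rpow (cos t) p) 0 (PI / 2)).
  assert (HM0 : 0 <= M) by (eapply Rle_trans; [apply Rabs_pos|apply (HM 0)]).
  destruct (Hp_quotient_bounded E phi f M p HE HE0 Hphi HM Hp Hf) as [A HA].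
  assert (Hfe : entire f) by apply Hf.
  assert (HLu : forall x : R, Cmod (f (RtoC x) / E (RtoC x))%C <= L).
  { intros x. apply Hlub. eauto. }
  assert (Hb := quotient_le_real_sup E f A L HE HE0 Hfe (fun z Hz => proj1 (HA z Hz)) HLu).
  assert (Hb' : forall z, 0 <= Im z -> Cmod (sharp f z) <= L * Cmod (E z)).
  { apply (quotient_le_real_sup E (sharp f) A L HE HE0 (entire_sharp f Hfe) (fun z Hz => proj2 (HA z Hz))).
    intros x. rewrite Cmod_div, Cmod_sharp, Cconj_R, <- Cmod_div by auto. auto. }
  assert (HLp : 0 < rpow L p) by (apply rpow_gt_0; auto).
  assert (Hkey : forall c tau, 0 < c < PI / 2 -> 0 < tau -> M <= 2 * tau -> rpow L p * (2 * (J - c)) <= tau).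
  { intros c tau Hc Ht HMt.
    destruct (cosine_lower_bound E phi f M tau L c) as [x0 Hx0]; auto.
    apply (integral_cosine_lower (fun x => Cmod (f (RtoC x) / E (RtoC x))%C) p tau L c x0); auto.
    intros x. apply (ccont_hline (fun z => f z / E z)%C x 0). apply holo_ccont, C_holo_div; auto.
    - apply HE.
    - apply HE0. }
  apply le_epsilon. intros e He.
  set (X := rpow L p) in *.
  assert (Hx : 0 < e / (8 * X)) by (apply Rdiv_lt_0_compat; lra).
  (* After doubling, the slack c costs 4 X c <= e/2, and the choice tau = M/2 + e/4 costs another
     e/2. The latter also keeps tau > 0 when M = 0. *)
  set (c := Rmin (PI / 4) (e / (8 * X))).
  assert (Hc : 0 < c) by (apply Rmin_pos; lra).
  assert (Hc1 : c <= PI / 4) by apply Rmin_l.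
  assert (Hc2 : c <= e / (8 * X)) by apply Rmin_r.
  apply Rle_div_r in Hc2; [|lra].
  assert (K := Hkey c (M / 2 + e / 4) ltac:(lra) ltac:(lra) ltac:(lra)).
  nra.
Qed.

Theorem theorem6 (E : C -> C) (phi : R -> R) (p : R) :
  hermite_biehler E ->
  (forall x : R, E (RtoC x) <> RtoC 0) ->
  phase_function E phi ->
  (exists M : R, forall x, Rabs (Derive phi x) <= M) ->
  0 < p ->
  Rbar_le (embed_const p E)
    (Finite (rpow (real (sup_abs (Derive phi))) (1 / p)
             / (rpow 2 (1 / p) * K p))).
Proof.
  intros HE HE0 Hphi [M0 HM0] Hp.
  (* [real] sends infinite values to 0, so [M] is a bound for |phi'| only because [M0] makes the
     supremum finite. *)
  set (M := real (sup_abs (Derive phi))).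
  assert (HM : forall x, Rabs (Derive phi x) <= M).
  { destruct (Lub_Rbar_correct (fun v => exists x, v = Rabs (Derive phi x))) as [H1 H2].
    fold (sup_abs (Derive phi)) in H1, H2.
    assert (H3 : Rbar_le (sup_abs (Derive phi)) (Finite M0)).
    { apply H2. intros v [x ->]. apply HM0. }
    intros x. assert (H4 : Rbar_le (Finite (Rabs (Derive phi x))) (sup_abs (Derive phi))).
    { apply H1. eauto. }
    unfold M. destruct (sup_abs (Derive phi)); simpl in *; tauto || auto. }
  assert (Hp1 : 0 <= 1 / p) by (apply Rlt_le, Rdiv_lt_0_compat; lra).
  set (I := RInt (fun x => rpow (Rabs (cos x)) p) (- (PI / 2)) (PI / 2)).
  assert (HI : 0 < I).
  { unfold I. rewrite RInt_abs_cos_power by auto. generalize (cos_power_integral_gt_0 p Hp). lra. }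
  assert (HK : 0 < rpow 2 (1 / p) * K p).
  { apply Rmult_lt_0_compat; apply rpow_gt_0; [lra|exact HI]. }
  set (bound := rpow M (1 / p) / (rpow 2 (1 / p) * K p)).
  assert (Hb0 : 0 <= bound) by (apply Rdiv_le_0_compat; [apply rpow_ge_0|auto]).
  unfold embed_const, Rbar_lub. destruct Rbar_ex_lub as [l [Hl1 Hl2]]; simpl.
  apply Hl2. intros v (f & Hf & Hn & ->).
  destruct (Lub_Rbar_correct (fun v => exists x : R, v = Cmod (f (RtoC x) / E (RtoC x))%C)) as [_ Hlub].
  apply Hlub. intros v [x0 ->]. clear Hlub Hl1 Hl2 l.
  assert (H1 : forall a b, a <= b -> RInt (fun x => rpow (Cmod (f (RtoC x) / E (RtoC x))%C) p) a b <= 1).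
  { intros a b Hab. 
    destruct (Lub_Rbar_correct (fun v => exists a b, a <= b /\ v = RInt (fun x => rpow (Cmod (f (RtoC x) / E (RtoC x))%C) p) a b)) as [Hub _].
    assert (Hab' := Hub _ (ex_intro _ a (ex_intro _ b (conj Hab eq_refl)))).
    unfold Lp_norm_R in Hn. unfold int_R in Hn.
    (* An infinite integral contradicts the norm bound; a finite value t > 1 would give t^(1/p) >
       1. *)
    destruct (Lub_Rbar _) as [t| |]; simpl in Hn, Hab'; try tauto.
    eapply Rle_trans; [apply Hab'|]. apply Rnot_lt_le. intros Ht.
    assert (Hln : 0 < ln t) by (rewrite <- ln_1; apply ln_increasing; lra).
    rewrite rpow_pos in Hn by lra. unfold Rpower in Hn.
    assert (0 < 1 / p * ln t) by (apply Rmult_lt_0_compat; auto; apply Rdiv_lt_0_compat; lra).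
    apply exp_increasing in H. rewrite exp_0 in H. lra. }
  destruct (Hp_quotient_bounded E phi f M p HE HE0 Hphi HM Hp Hf) as [A HA].
  destruct (completeness (fun v => exists x : R, v = Cmod (f (RtoC x) / E (RtoC x))%C)) as [L HL].
  { exists A. intros v [x ->]. apply HA. simpl; lra. }
  { eexists; exists 0; reflexivity. }
  assert (HxL : Cmod (f (RtoC x0) / E (RtoC x0))%C <= L) by (apply HL; eauto).
  simpl. eapply Rle_trans; [apply HxL|].
  (* The comparison divides by multiples of L; the case L <= 0 follows from nonnegativity of the
     bound. *)
  destruct (Rle_or_lt L 0) as [HL0|HL0]; [lra|].
  assert (S := sup_power_bound E phi f M p L HE HE0 Hphi HM Hp Hf H1 HL0 HL). fold I in S.
  apply Rle_div_r; auto.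
  apply (rpow_le _ _ (1 / p) Hp1) in S.
  rewrite !rpow_mult_distr, rpow_inv in S by (try lra; apply rpow_ge_0). exact S.
Qed.
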